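(* Let $F$ be a regularly varying function such that \[ \frac{F(x)}{\log x}\xrightarrow{x\to\infty}\infty \quad\text{and}\quad F(x)\le (1+o(1))\,\frac{1}{(h-1)!}\,\frac{x^{h-1}}{b_1\cdots b_h}. \] Then there exists $A\subseteq\mathbb{Z}_{\ge 0}$ such that $r_{A,h}(n)\sim F(n)$ as $n\to\infty$.
   Context: Fix an integer $h\ge 2$ and positive integers $b_1,\dots,b_h$, not necessarily distinct, with $\gcd(b_1,\dots,b_h)=1$. For $A\subseteq\mathbb{Z}_{\ge 0}$, $1\le\ell\le h$ and an integer $n\ge 0$, let $r_{A,\ell}(n)$ be the number of $\ell$-tuples $(k_1,\dots,k_\ell)\in A^\ell$ with $b_1k_1+\cdots+b_\ell k_\ell=n$. A function $F$ is regularly varying if it is a positive measurable function on $[1,\infty)$ such that for every real $\lambda>0$ the limit $\lim_{x\to\infty}F(\lambda x)/F(x)$ exists and is finite and positive. $X\sim Y$ means $X/Y\to1$. *)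

(* Defs.v *)
From HB Require Import structures.
From mathcomp Require Import all_boot all_order all_algebra.
From mathcomp Require Import all_classical all_reals all_analysis.
From mathcomp Require Import measurable_realfun.
Set Implicit Arguments. Unset Strict Implicit. Unset Printing Implicit Defensive.
Import Order.TTheory GRing.Theory Num.Theory numFieldNormedType.Exports.
Local Open Scope classical_set_scope.
Local Open Scope ring_scope.

(* r_{A,h}(n): number of h-tuples (k_1,..,k_h) in A^h with
   b_1 k_1 + ... + b_h k_h = n.  Since every b_i >= 1 (standing assumption),
   any such k_i satisfies k_i <= n, so tuples are enumerated in 'I_(n+1)^h. *)
Definition rep_count (h : nat) (b : 'I_h -> nat) (A : pred nat) (n : nat) : nat :=
  #|[set k : {ffun 'I_h -> 'I_n.+1} |
     [forall i, A (k i)] && ((\sum_(i < h) b i * k i)%N == n)]|.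

(* Lebesgue measurable subsets of R: the completed (Lebesgue) sigma-algebra,
   i.e. the sigma-algebra generated by sets (Borel set) U (Lebesgue-null set). *)
Definition lebesgue_measurable_set (R : realType) (E : set R) : Prop :=
  (completed_algebra_gen (@lebesgue_measure R)).-sigma.-measurable E.

Definition measurable_on_ge1 (R : realType) (F : R -> R) : Prop :=
  forall B : set R, measurable B ->
    lebesgue_measurable_set ([set x | 1 <= x] `&` F @^-1` B).

Definition regularly_varying (R : realType) (F : R -> R) : Prop :=
  (forall x : R, 1 <= x -> 0 < F x) /\
  measurable_on_ge1 F /\
  (forall lam : R, 0 < lam ->
     exists2 L : R, 0 < L & (F (lam * x) / F x) @[x --> +oo%R] --> (L : R)).

(* Main.v *)
(* Take A random, each k lying in A independently with probability p(k), where p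
   is regularly varying and normalised so that the expected number of representations
   s(n) of n is asymptotic to F(n): writing p(n)^h = F(n) / (C n^(h-1)), the growth of
   F makes the index of p larger than -1, the upper bound on F makes p <= 1 possible,
   and s(n) is an iterated convolution whose asymptotics are a Riemann sum
   (gcd(b) = 1 removes the arithmetic obstruction).

   Concentration: representations with fewer than h distinct entries, or through
   prescribed elements, number at most n^theta with n^theta log n = o(F(n)).  The
   lower tail is then Janson's inequality; for the upper tail, a surplus of
   representations forces many pairwise disjoint ones, and the expected number of
   disjoint M-tuples is at most s(n)^M.  Both tails are summable in n, so some finite
   A works up to any N, and compactness gives A. *)

Require Import Defs.
From HB Require Import structures.
From mathcomp Require Import all_boot all_order all_algebra.
From mathcomp Require Import all_classical all_reals all_analysis.
From mathcomp Require Import measurable_realfun lra ring zify.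
Set Implicit Arguments. Unset Strict Implicit. Unset Printing Implicit Defensive.
Import Order.TTheory GRing.Theory Num.Theory numFieldNormedType.Exports.
Local Open Scope classical_set_scope.
Local Open Scope ring_scope.

(** * Random finite sets, Harris and Janson inequalities *)

(** Probability enters only through the finite expectation [Ex]. An exceptional event is encoded by
    a nonnegative function [G] of the set, with small expectation, such that [G A < 1] excludes the
    event. Such functions add up, and one set with total below 1 avoids all the events at once.

    The greedy choice of disjoint representations is blocked by those through used elements and by
    those with repeated entries. Both kinds are representations with one variable less, a weight
    having been dropped or two weights added. Their random number has to be bounded as well, so all
    derived weight families are treated together, by induction on the number of variables, with a
    power saving that pays for the union over all targets.

    Intermediate convolutions live on the multiples of the gcd of their weights, so their limits
    carry a divisibility indicator. The limiting constant depends only on the index and the weights,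
    hence [p] can be normalised by it without circularity. When [p] has index 0, the bound [p <= 1]
    is a matter of constants, and that case is computed exactly. *)

Section bernoulli.
Variables (R : realType) (p : nat -> R).
Hypothesis p01 : forall x, 0 <= p x <= 1.
Implicit Types (A : pred nat) (f g : pred nat -> R).

Definition addp (s : seq nat) A : pred nat := fun y => (y \in s) || A y.

(* Expectation of f A when each x < N lies in A independently with probability p x. *)
Fixpoint Ex (N : nat) f : R :=
  if N is N'.+1 then
    p N' * Ex N' (fun A => f (addp [:: N'] A)) + (1 - p N') * Ex N' f
  else f xpred0.

Lemma addpC s t A : addp s (addp t A) = addp t (addp s A).
Proof. by apply/funext => y; rewrite /addp orbCA. Qed.

Lemma addp_id x A : A x -> addp [:: x] A = A.
Proof. by move=> Ax; apply/funext => y; rewrite /addp inE; case: eqP => // ->. Qed.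

(** [Ex N] evaluates its argument only at subsets of [0, N), so a comparison there suffices. *)
Lemma Ex_le_supp N f g :
  (forall A, (forall x, (N <= x)%N -> A x = false) -> f A <= g A) -> Ex N f <= Ex N g.
Proof.
elim: N f g => [|N IH] f g fg /=; first exact: fg.
have /andP[p0 p1] := p01 N.
apply: lerD; apply: ler_wpM2l; rewrite ?subr_ge0//; apply: IH => A HA; apply: fg => x Nx.
  by rewrite /addp inE HA ?(ltnW Nx)// orbF gtn_eqF.
by rewrite HA// ltnW.
Qed.

Lemma Ex_le N f g : (forall A, f A <= g A) -> Ex N f <= Ex N g.
Proof. by move=> fg; apply: Ex_le_supp. Qed.

Lemma Ex_eq N f g : (forall A, f A = g A) -> Ex N f = Ex N g.
Proof. by move=> fg; congr Ex; apply/funext. Qed.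

Lemma Ex_eq_supp N f g :
  (forall A, (forall x, (N <= x)%N -> A x = false) -> f A = g A) -> Ex N f = Ex N g.
Proof. by move=> fg; apply: le_anti; rewrite !Ex_le_supp// => A HA; rewrite fg. Qed.

Lemma Ex_cst N c : Ex N (fun=> c) = c.
Proof. by elim: N => //= N ->; ring. Qed.

Lemma ExD N f g : Ex N (fun A => f A + g A) = Ex N f + Ex N g.
Proof. by elim: N f g => //= N IH f g; rewrite !IH; ring. Qed.

Lemma ExZ N c f : Ex N (fun A => c * f A) = c * Ex N f.
Proof. by elim: N f => //= N IH f; rewrite !IH; ring. Qed.

Lemma Ex_sum (I : Type) (r : seq I) (P : pred I) N (f : I -> pred nat -> R) :
  Ex N (fun A => \sum_(i <- r | P i) f i A) = \sum_(i <- r | P i) Ex N (f i).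
Proof.
elim: r => [|i r IH].
  by rewrite big_nil -[RHS](Ex_cst N); apply: Ex_eq => A; rewrite big_nil.
rewrite big_cons -IH; case: ifPn => Pi.
  by rewrite -ExD; apply: Ex_eq => A; rewrite big_cons Pi.
by apply: Ex_eq => A; rewrite big_cons (negbTE Pi).
Qed.

Lemma Ex_ge0 N f : (forall A, 0 <= f A) -> 0 <= Ex N f.
Proof. by move=> f0; rewrite -[leLHS](Ex_cst N); exact: Ex_le. Qed.

(** The first-moment method, by which a set is finally extracted from the random model. *)
Lemma Ex_exists N f c : Ex N f < c -> exists A, f A < c.
Proof.
move=> fc; apply: contrapT => /forallNP H.
have : Ex N f >= Ex N (fun=> c) by apply: Ex_le => A; rewrite leNgt; apply/negP/H.
by rewrite Ex_cst leNgt fc.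
Qed.

(** Conditioning on x being in A amounts to inserting x, because the other memberships are
    independent of this one. *)
Lemma Ex_cond1 N x f : (x < N)%N ->
  Ex N (fun A => (A x)%:R * f A) = p x * Ex N (fun A => f (addp [:: x] A)).
Proof.
elim: N f => // N IH f /=; rewrite ltnS leq_eqVlt => /orP[/eqP <-{IH}|xN].
  have -> : Ex x (fun A => (A x)%:R * f A) = 0.
    by rewrite -[RHS](Ex_cst x 0); apply: Ex_eq_supp => A HA; rewrite HA// mul0r.
  rewrite mulr0 addr0; congr (_ * _).
  rewrite [X in Ex x X](_ : _ = (fun A => f (addp [:: x] A))).
    transitivity (p x * Ex x (fun A => f (addp [:: x] A)) + (1 - p x) * Ex x (fun A => f (addp [:: x] A))); first ring.
    congr (_ * _ + _); apply: Ex_eq => A; rewrite [in RHS]addp_id//.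
    by rewrite /addp inE eqxx.
  by apply/funext => A; rewrite /addp inE eqxx mul1r.
rewrite (_ : Ex N (fun A => (addp [:: N] A x)%:R * f (addp [:: N] A)) = p x * Ex N (fun A => f (addp [:: x] (addp [:: N] A)))).
  rewrite IH// mulrDr; congr (_ + _); last ring.
  rewrite mulrCA; congr (_ * (_ * _)); by apply: Ex_eq => A; rewrite addpC.
rewrite (_ : (fun A => (addp [:: N] A x)%:R * f (addp [:: N] A)) = (fun A => (A x)%:R * f (addp [:: N] A))).
  by rewrite (IH (fun A => f (addp [:: N] A)) xN); congr (_ * _); apply: Ex_eq => A; rewrite addpC.
by apply/funext => A; rewrite {1}/addp inE ltn_eqF.
Qed.

Lemma Ex_cond N (s : seq nat) f : uniq s -> {in s, forall x, (x < N)%N} ->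
  Ex N (fun A => (all A s)%:R * f A) = (\prod_(x <- s) p x) * Ex N (fun A => f (addp s A)).
Proof.
elim: s f => [|x s IH] f /=.
  by move=> _ _; rewrite big_nil mul1r; apply: Ex_eq => A; rewrite mul1r.
move=> /andP[xs us] sN; rewrite big_cons.
rewrite (_ : (fun A => _) = (fun A => (A x)%:R * ((all A s)%:R * f A))); last first.
  by apply/funext => A; case: (A x) => /=; rewrite ?mul1r ?mul0r.
rewrite Ex_cond1; last by apply: sN; rewrite mem_head.
rewrite -mulrA; congr (_ * _).
rewrite (_ : (fun A => _) = (fun A => (all A s)%:R * f (addp [:: x] A))); last first.
  apply/funext => A; congr (_%:R * _); congr nat_of_bool.
  apply/allP/allP => H y ys; have := H y ys; rewrite /addp inE; last by move=> ->; rewrite orbT.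
  by case: eqP => // yx; move: xs; rewrite -yx ys.
rewrite (IH (fun A => f (addp [:: x] A)))//; last by move=> y ys; apply: sN; rewrite inE ys orbT.
congr (_ * _); apply: Ex_eq => A; congr f; apply/funext => y.
by rewrite /addp !inE orbA.
Qed.

Lemma Ex_all N (s : seq nat) : uniq s -> {in s, forall x, (x < N)%N} ->
  Ex N (fun A => (all A s)%:R) = \prod_(x <- s) p x.
Proof.
move=> us sN; have := Ex_cond (fun=> 1) us sN; rewrite Ex_cst mulr1 => <-.
by apply: Ex_eq => A; rewrite mulr1.
Qed.

Definition decreasing f := forall A x, f (addp [:: x] A) <= f A.

(** Induction on the number of coordinates. Averaging over the last one is Chebyshev's inequality on
    two points: the defect is p (1 - p) (f0 - f1) (g0 - g1), where both differences are
    nonnegative. *)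
Lemma Ex_harris N f g : decreasing f -> decreasing g ->
  Ex N f * Ex N g <= Ex N (fun A => f A * g A).
Proof.
elim: N f g => [|N IH] f g df dg /=; first by [].
have dadd h : decreasing h -> decreasing (fun A => h (addp [:: N] A)).
  by move=> dh A x; rewrite addpC.
have /andP[p0 p1] := p01 N.
have h1 := IH _ _ (dadd _ df) (dadd _ dg).
have h0 := IH _ _ df dg.
have lf : Ex N (fun A => f (addp [:: N] A)) <= Ex N f by apply: Ex_le => A; exact: df.
have lg : Ex N (fun A => g (addp [:: N] A)) <= Ex N g by apply: Ex_le => A; exact: dg.
set f1 := Ex N (fun A => f (addp _ A)) in h1 lf *; set g1 := Ex N (fun A => g (addp _ A)) in h1 lg *.
set f0 := Ex N f in lf h0 *; set g0 := Ex N g in lg h0 *.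
apply: (@le_trans _ _ (p N * (f1 * g1) + (1 - p N) * (f0 * g0))).
  rewrite -subr_ge0.
  have -> : p N * (f1 * g1) + (1 - p N) * (f0 * g0) - (p N * f1 + (1 - p N) * f0) * (p N * g1 + (1 - p N) * g0)
    = p N * (1 - p N) * ((f0 - f1) * (g0 - g1)) by ring.
  by rewrite !mulr_ge0// subr_ge0.
by apply: lerD; apply: ler_wpM2l; rewrite ?subr_ge0.
Qed.

(** The Weierstrass product inequality. *)
Lemma prod_1B_ge (I : Type) (r : seq I) (P : pred I) (x : I -> R) :
  (forall i, 0 <= x i <= 1) ->
  1 - \sum_(i <- r | P i) x i <= \prod_(i <- r | P i) (1 - x i).
Proof.
move=> x01; elim: r => [|i r IH]; first by rewrite !big_nil subr0.
rewrite !big_cons; case: ifPn => // Pi; have /andP[x0 x1] := x01 i.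
have s0 : 0 <= \sum_(j <- r | P j) x j by apply: sumr_ge0 => j _; case/andP: (x01 j).
apply: (@le_trans _ _ ((1 - x i) * (1 - \sum_(j <- r | P j) x j))).
  by rewrite -subr_ge0 (_ : _ - _ = x i * \sum_(j <- r | P j) x j); [rewrite mulr_ge0|ring].
by apply: ler_wpM2l; rewrite ?subr_ge0.
Qed.

(* The Boppana-Spencer product form of Janson's inequality. *)
Lemma janson_prod N (t d : R) (Us : seq (seq nat)) :
  0 <= t <= 1 -> {in Us, forall U, uniq U /\ {in U, forall x, (x < N)%N}} ->
  {in Us, forall U, \sum_(V <- Us | has (mem U) V) \prod_(x <- V | x \notin U) p x <= d} ->
  Ex N (fun A => \prod_(U <- Us) (1 - t * (all A U)%:R)) <=
    expR (- t * (1 - t * d) * \sum_(U <- Us) \prod_(x <- U) p x).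
Proof.
move=> /andP[t0 t1].
pose Pr (P : pred (seq nat)) Vs A := \prod_(U <- Vs | P U) (1 - t * (all A U)%:R).
have tb (b : bool) : 0 <= t * b%:R <= 1 by case: b; rewrite ?mulr1 ?mulr0 ?t0 ?t1 ?lexx ?ler01.
have Prge0 P Vs A : 0 <= Pr P Vs A.
  by apply: prodr_ge0 => U _; rewrite subr_ge0; case/andP: (tb (all A U)).
have allS U (A B : pred nat) : (forall x, A x -> B x) -> (all A U)%:R <= (all B U)%:R :> R.
  move=> AB; rewrite ler_nat; case: (boolP (all A U)) => //= /allP H.
  by rewrite (_ : all B U = true)//; apply/allP => x /H /AB.
have dPr P Vs (s : seq nat) : decreasing (fun A => Pr P Vs (addp s A)).
  move=> A x; apply: ler_prod => U _; rewrite subr_ge0; apply/andP; split; first by case/andP: (tb (all (addp s (addp [:: x] A)) U)).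
  rewrite lerD2l lerN2; apply: ler_wpM2l => //; apply: allS => y; rewrite /addp.
  by move=> /orP[->//|->]; rewrite !orbT.
elim: Us => [|U Vs IH] HU Hd.
  rewrite !big_nil mulr0 expR0 -[leRHS](Ex_cst N 1); apply: Ex_le => A; by rewrite big_nil.
have [uU UN] := HU U (mem_head _ _).
set E := Ex N (fun A => \prod_(U <- Vs) (1 - t * (all A U)%:R)).
have E0 : 0 <= E by apply: Ex_ge0 => A; exact: (Prge0 xpredT).
have {}IH : E <= expR (- t * (1 - t * d) * \sum_(U <- Vs) \prod_(x <- U) p x).
  apply: IH => V VV; first by apply: HU; rewrite inE VV orbT.
  apply: le_trans (Hd V _); last by rewrite inE VV orbT.
  rewrite big_cons; case: ifP => // _; rewrite lerDr prodr_ge0// => x _.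
  by case/andP: (p01 x).
pose q := \prod_(x <- U) p x.
have q0 : 0 <= q by apply: prodr_ge0 => x _; case/andP: (p01 x).
(* The factor of [U] is peeled off; conditioning on [U] inside A turns its correction term into the
   expectation of the remaining product with [U] inserted. *)
have -> : Ex N (fun A => \prod_(V <- U :: Vs) (1 - t * (all A V)%:R)) =
    E - t * q * Ex N (fun A => Pr xpredT Vs (addp U A)).
  rewrite -mulrA -(Ex_cond (Pr xpredT Vs) uU UN) -mulNr /E -!ExZ -ExD; apply: Ex_eq => A.
  by rewrite big_cons /Pr; ring.
(* Once [U] is inserted, factors of sets disjoint from [U] are unchanged, and the product of those
   meeting [U] has mean at least 1 - t d. Harris separates the two groups. *)
have step : (1 - t * d) * E <= Ex N (fun A => Pr xpredT Vs (addp U A)).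
  pose hit V := has (mem U) V.
  have -> : Ex N (fun A => Pr xpredT Vs (addp U A)) =
      Ex N (fun A => Pr hit Vs (addp U A) * Pr (predC hit) Vs (addp U A)).
    by apply: Ex_eq => A; rewrite /Pr [LHS](bigID hit).
  apply: le_trans (Ex_harris N (dPr _ _ _) (dPr _ _ _)).
  have h1 : 1 - t * d <= Ex N (fun A => Pr hit Vs (addp U A)).
    apply: (@le_trans _ _ (Ex N (fun A => 1 - \sum_(V <- Vs | hit V) t * (all (addp U A) V)%:R))); last first.
      by apply: Ex_le => A; apply: prod_1B_ge.
    rewrite (_ : Ex N _ = 1 - t * \sum_(V <- Vs | hit V) \prod_(x <- V | x \notin U) p x); last first.
      rewrite (_ : \sum_(V <- Vs | hit V) _ = Ex N (fun A => \sum_(V <- Vs | hit V) (all (addp U A) V)%:R)); last first.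
        rewrite Ex_sum big_seq_cond [RHS]big_seq_cond; apply: eq_bigr => V /andP[VV _].
        have [uV VN] : uniq V /\ {in V, forall x, (x < N)%N} by apply: HU; rewrite inE VV orbT.
        rewrite -big_filter -(@Ex_all N) ?filter_uniq//; last by move=> x; rewrite mem_filter => /andP[_ /VN].
        apply: Ex_eq => A; rewrite all_filter; congr (nat_of_bool _)%:R.
        by apply: eq_all => x /=; rewrite /addp implyNb.
      rewrite -mulNr -ExZ -[X in _ = X + _](Ex_cst N 1) -ExD; apply: Ex_eq => A.
      by rewrite -mulr_sumr mulNr.
    rewrite lerD2l lerN2; apply: ler_wpM2l => //.
    apply: le_trans (Hd U (mem_head _ _)); rewrite [leRHS]big_cons; case: ifP => // _.
    by rewrite lerDr prodr_ge0// => x _; case/andP: (p01 x).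
  have h2 : E <= Ex N (fun A => Pr (predC hit) Vs (addp U A)).
    apply: Ex_le => A; rewrite (bigID hit)/=.
    have -> : Pr (predC hit) Vs (addp U A) = Pr (predC hit) Vs A.
      apply: eq_bigr => V /hasPn HV; congr (1 - t * (nat_of_bool _)%:R).
      by apply: eq_in_all => x xV; rewrite /addp; move: (HV x xV) => /= /negbTE ->.
    rewrite ler_piMl//; first exact: (Prge0 (predC hit)).
    by apply: prodr_ile1 => V _; rewrite lerBlDr lerDl subr_ge0; case/andP: (tb (all A V)) => ? ?; apply/andP.
  apply: (le_trans (ler_wpM2r E0 h1)); apply: ler_wpM2l h2.
  by apply: Ex_ge0 => A; exact: Prge0.
have -> : - t * (1 - t * d) * \sum_(V <- U :: Vs) \prod_(x <- V) p x =
   - t * (1 - t * d) * q + - t * (1 - t * d) * \sum_(V <- Vs) \prod_(x <- V) p x.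
  by rewrite big_cons mulrDr.
rewrite expRD; apply: (@le_trans _ _ (expR (- t * (1 - t * d) * q) * E)); last exact: ler_wpM2l.
apply: (@le_trans _ _ ((1 + - t * (1 - t * d) * q) * E)); last by apply: ler_wpM2r => //; exact: expR_ge1Dx.
rewrite [leRHS](_ : _ = E - t * q * ((1 - t * d) * E)); last ring.
by rewrite lerD2l lerN2; apply: ler_wpM2l => //; exact: mulr_ge0.
Qed.

End bernoulli.

(** * The uniform convergence theorem for regularly varying functions *)

Section uniform_convergence.
Variable R : realType.
Local Notation mu := (@lebesgue_measure R).

(** Uniqueness of Lebesgue measure: l times its pushforward under the dilation agrees with it on
    half-open intervals. *)
Lemma lebesgue_measure_scale (l : R) (A : set R) : 0 < l -> measurable A ->
  mu ((fun x => l * x) @^-1` A) = ((l^-1)%:E * mu A)%E.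
Proof.
move=> l0 mA.
have ml : measurable_fun [set: measurableTypeR R]
    ((fun x => l * x) : measurableTypeR R -> measurableTypeR R).
  exact: measurable_funM.
have l0' : 0 <= l by exact: ltW.
have := @lebesgue_measure_unique R
  (mscale (NngNum l0') (pushforward mu ((fun x => l * x) : measurableTypeR R -> measurableTypeR R))).
move=> /(_ ml _ A mA) ->; last first.
  move=> _ [[a b]] _ <-.
  change (mu `]a, b]%classic = (l%:E * mu ((fun x => (l * x)%R) @^-1` `]a, b]%classic))%E).
  have -> : (fun x => l * x) @^-1` `]a, b] = `](a / l), (b / l)]%classic.
    apply/seteqP; split => x /=; rewrite !in_itv/=.
      by move=> /andP[ax xb]; rewrite ltr_pdivrMr// ler_pdivlMr// (mulrC x) ax.
    by rewrite ltr_pdivrMr// ler_pdivlMr// (mulrC x).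
  rewrite !lebesgue_measure_itv/= !lte_fin ltr_pM2r ?invr_gt0//.
  case: ifPn => _; last by rewrite mule0.
  rewrite -!EFinD -EFinM; congr (_%:E).
  by field; exact: lt0r_neq0.
rewrite /mscale /= /pushforward muleA -EFinM mulVf ?mul1e//.
exact: lt0r_neq0.
Qed.

(** [F] is measurable for the completed sigma-algebra, while dilations and Egorov's theorem are
    applied to Borel functions. Each rational sublevel set is Borel up to a Borel null set; [Z] is
    the countable union of these null sets. *)
Lemma borel_representative (F : R -> R) : measurable_on_ge1 F ->
  exists Z : set R, exists G : R -> R, [/\ measurable Z, mu Z = 0%E,
    measurable_fun setT G & forall x, 1 <= x -> ~ Z x -> G x = F x].
Proof.
move=> mF.
have H (q : rat) : exists AZ : set R * set R, [/\ measurable AZ.1,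
    measurable AZ.2, mu AZ.2 = 0%E &
    [set x | 1 <= x] `&` F @^-1` `]-oo, ratr q[%classic `\` AZ.2 = AZ.1 `\` AZ.2].
  have := mF `]-oo, ratr q[%classic (measurable_itv _).
  rewrite /lebesgue_measurable_set g_sigma_completed_algebra_genE.
  move=> [A mA [N [Z [mZ Z0 NZ]]] AN].
  exists (A, Z); split => //=; rewrite -AN.
  apply/seteqP; split => x /=; last by move=> [Ax Zx]; split => //; left.
  by move=> [[//|/NZ //]].
have [AZ HAZ] := choice H.
pose Z := \bigcup_(q : rat) (AZ q).2.
have mZ : measurable Z.
  by apply: countable_bigcupT_measurable => // q; case: (HAZ q).
exists Z, (fun x => if (1 <= x) && (x \notin Z) then F x else 0); split => //.
- apply/negligibleP => //.
  have -> : Z = \bigcup_(n : nat) (if unpickle n is Some q then (AZ q).2 else set0).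
    apply/seteqP; split => x [i _] /=.
      by move=> H'; exists (pickle i); [exact: I|rewrite pickleK].
    by case: (unpickle i) => // q H'; exists q.
  apply: negligible_bigcup => n; case: unpickle => [q|]; last exact: negligible_set0.
  by apply/negligibleP; case: (HAZ q).
- move=> mT; apply: (measurability _ (RGenInftyO.measurableE R)) => //.
  move=> _ [_ [r ->] <-].
  set G := (fun x => _).
  have GF x : 1 <= x -> ~ Z x -> G x = F x.
    by move=> x1 Zx; rewrite /G x1 /= ifT//; apply/negP => /set_mem.
  have G0 x : ~ (1 <= x /\ ~ Z x) -> G x = 0.
    move=> Hx; rewrite /G ifF//; apply/negP => /andP[x1 /negP Zx]; apply: Hx.
    by split => // /mem_set.
  have mD : measurable ([set x : R | 1 <= x] `\` Z).
    apply: measurableD => //; have -> : [set x : R | 1 <= x] = `[1, +oo[%classic; last exact: measurable_itv.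
    by apply/seteqP; split => x /=; rewrite in_itv/= andbT.
  have -> : setT `&` G @^-1` `]-oo, r[%classic =
    (\bigcup_(q : rat) (if (ratr q < r) then (AZ q).1 `\` Z else set0)) `|`
    (if 0 < r then ~` ([set x : R | 1 <= x] `\` Z) else set0).
    apply/seteqP; split => x /=; rewrite ?in_itv/=.
      move=> [_ Gr]; have [[x1 Zx]|nD] := pselect (1 <= x /\ ~ Z x); last first.
        right; have -> : 0 < r by rewrite -(G0 _ nD).
        by move=> [? ?]; exact: nD.
      left; rewrite GF// in Gr; have [q] := rat_in_itvoo Gr.
      rewrite in_itv/= => /andP[q1 q2]; exists q => //; rewrite q2.
      have [_ _ _ /seteqP[+ _]] := HAZ q; move=> /(_ x) /= h'.
      split => //; apply: (h' _).1; split; last by move=> ?; apply: Zx; exists q.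
      by split => //=; rewrite in_itv/=.
    move=> [[q _]|].
      case: ifPn => // qr [Ax Zx].
      have [_ _ _ /seteqP[_ +]] := HAZ q; move=> /(_ x) /= h'.
      have : ~ (AZ q).2 x by move=> ?; apply: Zx; exists q.
      move=> /(conj Ax)/h'[[x1]]; rewrite in_itv/= => Fq _.
      by split => //; rewrite GF// (lt_trans Fq).
    by case: ifPn => // r0 nD; rewrite G0.
  apply: measurableU.
    apply: bigcupT_measurable_rat => q; case: ifPn => // _.
    by apply: measurableD => //; case: (HAZ q).
  by case: ifPn => // _; exact: measurableC.
- by move=> x x1 Zx; rewrite x1 /= ifT//; apply/negP => /set_mem.
Qed.

Lemma egorov_eps (f : nat -> R -> R) (g : R -> R) (A : set R) (d : R) :
  (forall n, measurable_fun A (f n)) -> measurable A -> (mu A < +oo)%E ->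
  (forall x, A x -> (fun n => f n x) @ \oo --> g x) -> 0 < d ->
  exists B : set R, [/\ measurable B, (mu B < d%:E)%E &
    forall e : R, 0 < e -> exists N, forall n, (N <= n)%N -> forall u, A u ->
      ~ B u -> `|f n u - g u| < e].
Proof.
move=> mf mA Afin fg d0.
have [B [mB Bd uB]] := @pointwise_almost_uniform _ R _ mu f g A d mf mA Afin fg d0.
exists B; split => // e e0.
have : nbhs (g : {uniform` (A `\` B) -> R}) [set h | forall y, (A `\` B) y -> `|h y - g y| < e].
  apply/uniform_nbhs; exists [set xy | `|xy.1 - xy.2| < e]; split.
    by rewrite -entourage_ballE; exists e.
  by move=> h /= H y /H /=; rewrite distrC.
move=> /uB [N _ HN]; exists N => n Nn u uA nBu.
exact: (HN n Nn u).
Qed.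

(** Egorov's theorem along the dilations [x n], applied to a Borel representative of [F]. The
    exceptional set also absorbs the rescaled copies of the null set and a small set off which the
    limit is bounded. *)
Lemma ln_ratio_almost_uniform (F : R -> R) (g : R -> R) (x : nat -> R) (M d : R) :
  (forall t, 1 <= t -> 0 < F t) -> measurable_on_ge1 F ->
  (forall n, 1 <= x n) -> 0 < d ->
  (forall u, 1 <= u -> (fun n => ln (F (u * x n)) - ln (F (x n))) @ \oo --> g u) ->
  exists B : set R, [/\ measurable B, (mu B < d%:E)%E,
    exists K : R, forall u, 1 <= u <= M -> ~ B u -> `|g u| <= K &
    forall e : R, 0 < e -> exists N, forall n, (N <= n)%N -> forall u, 1 <= u <= M ->
      ~ B u -> `|ln (F (u * x n)) - ln (F (x n)) - g u| < e].
Proof.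
move=> Fpos mF x1 d0 cv.
have [Z [G [mZ Z0 mG GF]]] := borel_representative mF.
have x0 n : 0 < x n by exact: lt_le_trans (x1 n).
pose Zs := \bigcup_n ((fun u => x n * u) @^-1` Z).
have mscale n : measurable_fun setT (fun u : R => x n * u) by exact: measurable_funM.
have mZn n : measurable ((fun u => x n * u) @^-1` Z).
  by rewrite -[X in measurable X]setTI; exact: mscale.
have mZs : measurable Zs by exact: bigcupT_measurable.
have Zs0 : mu Zs = 0%E.
  apply/negligibleP => //; apply: negligible_bigcup => n; apply/negligibleP; first exact: mZn.
  by rewrite [LHS](lebesgue_measure_scale (x0 n) mZ) Z0 mule0.
pose A := `[1, M]%classic `\` Zs.
pose f n u := ln (G (x n * u)) - ln (F (x n)).
have mA : measurable A by apply: measurableD.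
have fE n u : A u -> f n u = ln (F (u * x n)) - ln (F (x n)).
  move=> [/=]; rewrite in_itv/= => /andP[u1 _] Zu; rewrite /f GF ?(mulrC u)//.
    by rewrite -[1]mulr1 ler_pM.
  by move=> ?; apply: Zu; exists n.
have mf n : measurable_fun A (f n).
  apply: measurable_funTS; apply: measurable_funB => //.
  apply: measurableT_comp; first exact: measurable_ln.
  by apply: measurableT_comp.
have Afin : (mu A < +oo)%E.
  apply: (@le_lt_trans _ _ (mu `[1, M]%classic)).
    by apply: le_measure; rewrite ?inE//; [exact: subDsetl].
  by rewrite lebesgue_measure_itv/=; case: ifPn; rewrite ?ltry// -EFinD ltry.
have fg u : A u -> (fun n => f n u) @ \oo --> g u.
  move=> Au; have u1 : 1 <= u by case: Au => /=; rewrite in_itv/= => /andP[].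
  apply: cvg_trans (cv u u1); apply: near_eq_cvg; near=> n.
  by rewrite fE.
have d20 : 0 < d / 2 by rewrite divr_gt0.
have [B [mB Bd uB]] := egorov_eps mf mA Afin fg d20.
have mg : measurable_fun A g by exact: measurable_fun_cvg fg.
(* Boundedness of [g] off a small set is again Egorov: g/(n+1) tends to 0, and uniformity at
   tolerance 1 bounds |g| by some N+1. *)
pose g' n u := n.+1%:R^-1 * g u.
have mg' n : measurable_fun A (g' n) by exact: measurable_funM.
have g'0 u : A u -> (fun n => g' n u) @ \oo --> (0 : R).
  move=> _; rewrite -(mul0r (g u)); apply: cvgMr_tmp; exact: cvg_harmonic.
have [B' [mB' Bd' uB']] := egorov_eps mg' mA Afin g'0 d20.
have AE u : 1 <= u <= M -> ~ (B `|` B' `|` Zs) u -> [/\ A u, ~ B u & ~ B' u].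
  move=> uM nB; split; last 2 first.
    by move=> ?; apply: nB; left; left.
    by move=> ?; apply: nB; left; right.
  by split; [rewrite /= in_itv|move=> ?; apply: nB; right].
exists (B `|` B' `|` Zs); split.
- by do !apply: measurableU.
- rewrite measureU0//; last exact: measurableU.
  apply: (@le_lt_trans _ _ (mu B + mu B')%E); first exact: measureU2.
  by rewrite [d]splitr EFinD lteD.
- have [N HN] := uB' _ ltr01; exists N.+1%:R => u uM /(AE _ uM)[Au _ nB'].
  have := HN N (leqnn _) u Au nB'; rewrite subr0 /g' normrM normfV normr_nat.
  by rewrite mulrC ltr_pdivrMr// mul1r => /ltW.
- move=> e e0; have [N HN] := uB e e0; exists N => n Nn u uM /(AE _ uM)[Au nB _].
  by rewrite -fE//; exact: HN.
Unshelve. all: by end_near. Qed.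

(** The interval [1/l, 2/eta] has length at least 1, while [B2] and the dilate of [B1] by 1/l
    together have measure below 1/2, so some v escapes both. *)
Lemma overlap_dilation (l eta : R) (B1 B2 : set R) :
  0 < eta -> eta <= l <= 1 ->
  measurable B1 -> measurable B2 -> (mu B1 < (eta / 4)%:E)%E -> (mu B2 < (eta / 4)%:E)%E ->
  exists v : R, [/\ 1 <= v, v <= 2 / eta, 1 <= l * v, l * v <= 2 / eta & ~ B2 v /\ ~ B1 (l * v)].
Proof.
move=> eta0 /andP[el l1] mB1 mB2 B1e B2e.
have l0 : 0 < l by exact: lt_le_trans el.
have mpre : measurable ((fun v => l * v) @^-1` B1).
  rewrite -[X in measurable X]setTI.
  by apply: (@measurable_funM _ _ R setT (cst l) id).
have [v vI vB] : exists2 v, v \in `[l^-1, 2 / eta] & ~ (B2 `|` (fun v => l * v) @^-1` B1) v.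
  apply: contrapT => H.
  have sub : `[l^-1, 2 / eta]%classic `<=` B2 `|` (fun v => l * v) @^-1` B1.
    move=> v /= vI; apply: contrapT => nv; by apply: H; exists v.
  have li : l^-1 <= eta^-1 by rewrite lef_pV2.
  have ei : 1 <= eta^-1 by rewrite invf_ge1 // (le_trans el).
  have : (mu `[(l^-1)%R, (2 / eta)%R]%classic <= mu (B2 `|` (fun v => (l * v)%R) @^-1` B1))%E.
    by apply: le_measure => //; rewrite inE; [exact: measurable_itv|exact: measurableU].
  rewrite lebesgue_measure_itv/= lte_fin ifT; last by rewrite (le_lt_trans li)// ltr_pMl ?invr_gt0// ltr1n.
  apply/negP; rewrite -ltNge.
  apply: (@le_lt_trans _ _ (mu B2 + mu ((fun v => (l * v)%R) @^-1` B1))%E).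
    exact: measureU2.
  rewrite lebesgue_measure_scale//.
  apply: (@lt_le_trans _ _ ((eta / 4)%:E + (l^-1)%:E * (eta/4)%:E)%E).
    apply: lteD => //; rewrite lte_pmul2l ?lte_fin ?invr_gt0//.
  rewrite -EFinM -!EFinD lee_fin.
  have : l^-1 * (eta / 4) <= 1/4.
    have : l^-1 * eta <= 1 by rewrite mulrC ler_pdivrMr// mul1r.
    lra.
  have : eta / 4 <= 1/4 by lra.
  lra.
exists v; move: vI; rewrite in_itv/= => /andP[v1 v2]; split.
- apply: le_trans v1; by rewrite invf_ge1.
- done.
- by rewrite -(mulfV (lt0r_neq0 l0)) ler_pM2l.
- apply: le_trans v2; rewrite ler_piMl// (le_trans _ v1)// ltW// invr_gt0//.
- by split => ?; apply: vB; [left|right].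
Qed.

(** Cauchy's functional equation. After removal of the linear part, [D] is additive and 1-periodic.
    Being bounded on a period it is bounded everywhere, and a bounded additive function vanishes. *)
Lemma multiplicative_additive_linear (g : R -> R) (K : R) :
  (forall x y : R, 0 < x -> 0 < y -> g (x * y) = g x + g y) ->
  (forall l, 2^-1 <= l <= 1 -> `|g l| <= K) ->
  exists rho : R, forall l : R, 0 < l -> g l = rho * ln l.
Proof.
move=> gM gK; pose rho := g (expR 1).
pose D t := g (expR t) - t * rho.
have DD s t : D (s + t) = D s + D t.
  by rewrite /D expRD gM ?expR_gt0//; ring.
have D1 : D 1 = 0 by rewrite /D mul1r subrr.
have D0 : D 0 = 0 by have := DD 0 0; rewrite addr0 => ?; lra.
have DN t : D (- t) = - D t by have := DD t (- t); rewrite subrr D0 => ?; lra.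
have Dn n t : D (n%:R * t) = n%:R * D t.
  elim: n => [|n IH]; first by rewrite !mul0r D0.
  by rewrite -natr1 mulrDl mul1r DD IH; ring.
have Dz (z : int) (t : R) : D (t + z%:~R) = D t.
  rewrite DD; suff -> : D z%:~R = 0 by rewrite addr0.
  case: z => n; first by have := Dn n 1; rewrite mulr1 D1 mulr0.
  by rewrite NegzE mulrNz DN; have := Dn n.+1 1; rewrite mulr1 D1 mulr0 => ->; rewrite oppr0.
have Dsmall (t : R) : -1 <= t <= 0 -> `|D t| <= 2 * K + `|rho|.
  move=> /andP[t1 t0].
  (* Halving t keeps the argument of [g] in [1/2, 1], since exp(t/2) >= 1 + t/2 >= 1/2; exp(t)
     itself could fall below 1/2. *)
  have -> : D t = g (expR (t / 2)) *+ 2 - t * rho.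
    by rewrite /D; congr (_ - _); rewrite {1}[t]splitr expRD gM ?expR_gt0// mulr2n.
  have gt : `|g (expR (t / 2))| <= K.
    apply: gK; rewrite expR_le1; apply/andP; split; last lra.
    have := expR_ge1Dx (t / 2); lra.
  apply: (le_trans (ler_normB _ _)); rewrite normrMn normrM mulr2n; apply: lerD; first lra.
  by rewrite ler_piMl// ler_norml; lra.
have Dbd t : `|D t| <= 2 * K + `|rho|.
  rewrite -(Dz (- (Num.floor t + 1)) t) Dsmall//.
  have := floor_itv t => /andP[]; rewrite intrN intrD => ? ?; apply/andP; split; lra.
have Dz0 t : D t = 0.
  apply/eqP; rewrite -normr_le0 leNgt; apply/negP => Dt.
  have [n Hn] : exists n : nat, (2 * K + `|rho|) / `|D t| < n%:R.
    exists (Num.truncn ((2 * K + `|rho|) / `|D t|)).+1; exact: truncnS_gt.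
  have := Dbd (n%:R * t); rewrite Dn normrM normr_nat leNgt => /negP; apply.
  by rewrite -ltr_pdivrMr.
exists rho => l l0; have := Dz0 (ln l); rewrite /D lnK// => ?; rewrite mulrC; lra.
Qed.

(** The uniform convergence theorem. A failure yields sequences x_n and l_n. Writing l = (l v)/v
    moves the comparison to points v and l v lying outside the exceptional sets of Egorov's theorem
    along l_n x_n and along x_n. Ratios l <= 1 are enough, as values are later compared only with
    those at larger arguments. *)
Theorem regularly_varying_uniform (F : R -> R) : regularly_varying F ->
  exists rho : R, forall eta e : R, 0 < eta -> 0 < e ->
    exists X : R, forall x l, X <= x -> eta <= l <= 1 ->
      `|ln (F (l * x)) - ln (F x) - rho * ln l| < e.
Proof.
move=> [Fpos [mF FL]].
have [L HL] : exists L : R -> R, forall l : R, 0 < l -> 0 < L l /\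
    F (l * x) / F x @[x --> +oo] --> L l.
  have H (l : R) : exists y : R, 0 < l -> 0 < y /\ F (l * x) / F x @[x --> +oo] --> y.
    have [l0|] := boolP (0 < l); last by exists 0.
    by have [y y0 ?] := FL l l0; exists y.
  by have [L HL] := choice H; exists L.
pose g l := ln (L l).
have gcv (l : R) : 0 < l -> ln (F (l * x)) - ln (F x) @[x --> +oo] --> g l.
  move=> l0; have [Ll cvl] := HL l l0.
  have cvln : ln (F (l * x) / F x) @[x --> +oo] --> g l.
    apply: (@cvg_comp _ _ _ (fun x => F (l * x) / F x) (@ln R) _ _ _ cvl).
    exact: continuous_ln.
  apply: cvg_trans cvln; apply: near_eq_cvg; near=> x.
  have x1 : 1 <= x by near: x; apply: nbhs_pinfty_ge; rewrite num_real.
  have lx : 1 <= l * x.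
    rewrite -ler_pdivrMl// mulr1; near: x; apply: nbhs_pinfty_ge; rewrite num_real//.
  by rewrite ln_div// ?posrE ?Fpos.
have gM (x y : R) : 0 < x -> 0 < y -> g (x * y) = g x + g y.
  move=> x0 y0; have xy0 : 0 < x * y by rewrite mulr_gt0.
  have /cvg_lim <- // := gcv _ xy0; apply: cvg_lim => //.
  have cy : y * z @[z --> +oo] --> +oo.
    apply/cvgryPge => C; near=> z; rewrite -ler_pdivrMl//.
  have c1 : ln (F (x * (y * z))) - ln (F (y * z)) @[z --> +oo] --> g x.
    exact: (@cvg_comp _ _ _ (fun z => y * z) (fun z => ln (F (x * z)) - ln (F z)) _ _ _ cy (gcv x x0)).
  apply: cvg_trans (cvgD c1 (gcv y y0)); apply: near_eq_cvg; near=> z.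
  rewrite [LHS](_ : _ = (ln (F (x * (y * z))) - ln (F (y * z))) + (ln (F (y * z)) - ln (F z)))//.
  by rewrite mulrA; ring.
have gseq (x : nat -> R) : x @ \oo --> +oo ->
    forall u, 1 <= u -> (fun n => ln (F (u * x n)) - ln (F (x n))) @ \oo --> g u.
  move=> xoo u u1.
  by apply: (@cvg_comp _ _ _ x (fun z => ln (F (u * z)) - ln (F z)) _ _ _ xoo (gcv u _)); rewrite (lt_le_trans _ u1).
have noo (x : nat -> R) : (forall n, n.+1%:R <= x n) -> (forall n, 1 <= x n) /\ x @ \oo --> +oo.
  move=> xn; split; first by move=> n; apply: le_trans (xn n); rewrite ler1n.
  apply: (@ger_cvgy _ _ _ _ (fun n : nat => n%:R)).
    by near=> n; apply: le_trans (xn n); rewrite ler_nat.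
  exact: cvgr_idn.
(* The same device along the plain sequence n+1 bounds [g] on [1/2, 1], which makes [g] a multiple
   of the logarithm. *)
have [K gK] : exists K, forall l, 2^-1 <= l <= 1 -> `|g l| <= K.
  have [x1 xoo] := noo (fun n => n.+1%:R) (fun n => lexx _).
  have h0 : (0 : R) < 2^-1 by rewrite invr_gt0.
  have [|B [mB Bd [K HK] _]] := ln_ratio_almost_uniform (2 / 2^-1) Fpos mF x1 _ (gseq _ xoo) (d := 2^-1 / 4).
    by rewrite divr_gt0.
  exists (K + K) => l lI; have l0 : 0 < l by move/andP: lI => [+ _]; apply: lt_le_trans.
  have [v [v1 v2 lv1 lv2 [nv nlv]]] := overlap_dilation h0 lI mB mB Bd Bd.
  have v0 : 0 < v by exact: lt_le_trans v1.
  have -> : g l = g (l * v) - g v by rewrite gM//; ring.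
  by apply: (le_trans (ler_normB _ _)); apply: lerD; apply: HK => //; apply/andP.
have [rho grho] := multiplicative_additive_linear gM gK.
exists rho => eta e eta0 e0; apply: contrapT => /forallNP H.
(* Taking x_n >= (n+1)/eta makes l_n x_n tend to infinity together with x_n. *)
have {H} H (n : nat) : exists xl : R * R, [/\ n.+1%:R / eta <= xl.1, n.+1%:R <= xl.1, eta <= xl.2 <= 1 &
    e <= `|ln (F (xl.2 * xl.1)) - ln (F xl.1) - rho * ln xl.2|].
  have /existsNP [x /existsNP[l /not_implyP[Xx /not_implyP[lI /negP]]]] :=
    H (Num.max (n.+1%:R / eta) n.+1%:R).
  rewrite -leNgt => ?; exists (x, l); split => //=; apply: le_trans Xx; rewrite le_max lexx ?orbT//.
have [xl Hxl] := choice H.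
pose x n := (xl n).1; pose l n := (xl n).2.
have [x1 xoo] : (forall n, 1 <= x n) /\ x @ \oo --> +oo by apply: noo => n; case: (Hxl n).
have lI n : eta <= l n <= 1 by case: (Hxl n).
have [y1 yoo] : (forall n, 1 <= l n * x n) /\ (fun n => l n * x n) @ \oo --> +oo.
  apply: noo => n; have [+ _ + _] := Hxl n; rewrite ler_pdivrMr// -/(x n) -/(l n) => h1 /andP[h2 h3].
  apply: (le_trans h1); rewrite mulrC ler_wpM2r//.
  by apply: le_trans (x1 n).
have ed : 0 < eta / 4 by rewrite divr_gt0.
have [B1 [mB1 B1d _ HB1]] := ln_ratio_almost_uniform (2 / eta) Fpos mF x1 ed (gseq _ xoo).
have [B2 [mB2 B2d _ HB2]] := ln_ratio_almost_uniform (2 / eta) Fpos mF y1 ed (gseq _ yoo).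
have e20 : 0 < e / 2 by rewrite divr_gt0.
have [N1 {}HB1] := HB1 _ e20; have [N2 {}HB2] := HB2 _ e20.
pose N := maxn N1 N2.
have [v [v1 v2 lv1 lv2 [nv nlv]]] := overlap_dilation eta0 (lI N) mB1 mB2 B1d B2d.
have l0 : 0 < l N by have /andP[+ _] := lI N; apply: lt_le_trans.
have v0 : 0 < v by exact: lt_le_trans v1.
have h1 : `|ln (F (l N * v * x N)) - ln (F (x N)) - g (l N * v)| < e / 2.
  by apply: HB1 => //; [exact: leq_maxl|exact/andP].
have h2 : `|ln (F (v * (l N * x N))) - ln (F (l N * x N)) - g v| < e / 2.
  by apply: HB2 => //; [exact: leq_maxr|exact/andP].
have [_ _ _] := Hxl N; rewrite -/(x N) -/(l N) leNgt => /negP; apply.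
move: h1 h2; have -> : v * (l N * x N) = l N * v * x N by ring.
rewrite gM// -(grho _ l0).
set a := ln _; set b := ln _; set c := ln _; rewrite !ltr_norml.
move=> /andP[? ?] /andP[? ?]; apply/andP; split; lra.
Unshelve. all: by end_near. Qed.

End uniform_convergence.

(** * Regularly varying sequences *)

Section rv.
Variable R : realType.
Implicit Types (v w : nat -> R) (a e eta K : R).

(* The shift by one avoids the junk value of ln at 0. *)
Definition lns (n : nat) : R := ln n.+1%:R.

(* expR \o v is regularly varying of index a, in the uniform form. *)
Definition RV a v := forall eta e : R, 0 < eta -> 0 < e ->
  exists N, forall n k, (N <= n)%N -> (k <= n)%N -> eta * n.+1%:R <= k.+1%:R ->
    `|v k - v n - a * (lns k - lns n)| <= e.

Definition tends0 (f : nat -> R) := forall e, 0 < e ->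
  exists N, forall n, (N <= n)%N -> `|f n| <= e.

Lemma expR_lns n : expR (lns n) = n.+1%:R.
Proof. by rewrite lnK// posrE. Qed.

Lemma lns_le k n : (k <= n)%N -> lns k <= lns n.
Proof. by move=> kn; rewrite ler_ln ?posrE// ler_nat. Qed.

Lemma ln_le_subr1 (x : R) : 0 < x -> ln x <= x - 1.
Proof. by move=> x0; have := expR_ge1Dx (ln x); rewrite lnK ?posrE// => ?; lra. Qed.

Lemma ln_dist_le (x y d : R) : 0 < d -> d <= x -> d <= y -> `|ln x - ln y| <= `|x - y| / d.
Proof.
move=> d0 dx dy; wlog xy : x y dx dy / y <= x => [H|].
  case: (leP y x) => [|/ltW] xy; first exact: H.
  by rewrite distrC (distrC x); exact: H.
have y0 : 0 < y by exact: lt_le_trans dy.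
have x0 : 0 < x by exact: lt_le_trans dx.
rewrite [X in _ <= X / _]ger0_norm ?subr_ge0// ger0_norm; last by rewrite subr_ge0 ler_ln.
rewrite -ln_div ?posrE//; apply: (le_trans (ln_le_subr1 _)); first by rewrite divr_gt0.
have -> : x / y - 1 = (x - y) / y by field; exact: lt0r_neq0.
by rewrite ler_wpM2l ?subr_ge0// lef_pV2.
Qed.

Lemma nat_ge (x : R) : exists N : nat, forall n, (N <= n)%N -> x <= n%:R.
Proof.
exists (Num.truncn `|x|).+1 => n Nn; apply: (@le_trans _ _ (Num.truncn `|x|).+1%:R); last by rewrite ler_nat.
by rewrite (le_trans (ler_norm x))// ltW// truncnS_gt.
Qed.

Lemma RVD a b v w : RV a v -> RV b w -> RV (a + b) (fun n => v n + w n).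
Proof.
move=> Hv Hw eta e eta0 e0; have e20 : 0 < e / 2 by rewrite divr_gt0.
have [N1 H1] := Hv eta _ eta0 e20; have [N2 H2] := Hw eta _ eta0 e20.
exists (maxn N1 N2) => n k; rewrite geq_max => /andP[n1 n2] kn ek.
have := H1 n k n1 kn ek; have := H2 n k n2 kn ek.
rewrite !ler_norml => /andP[? ?] /andP[? ?]; apply/andP; split; lra.
Qed.

Lemma RVZ a c v : RV a v -> RV (c * a) (fun n => c * v n).
Proof.
move=> Hv eta e eta0 e0; have c0 : 0 < `|c| + 1 by rewrite ltr_wpDl.
have [N1 H1] := Hv eta (e / (`|c| + 1)) eta0 (divr_gt0 e0 c0).
exists N1 => n k n1 kn ek; have := H1 n k n1 kn ek.
rewrite ler_pdivlMr// => H.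
have -> : c * v k - c * v n - c * a * (lns k - lns n) = c * (v k - v n - a * (lns k - lns n)) by ring.
rewrite normrM; apply: le_trans H; rewrite mulrC ler_wpM2l//; lra.
Qed.

Lemma RV_lns : RV 1 lns.
Proof. by move=> eta e eta0 e0; exists 0%N => n k _ _ _; rewrite mul1r subrr normr0 ltW. Qed.

Lemma RV_equiv a v w : RV a v -> tends0 (fun n => w n - v n) -> RV a w.
Proof.
move=> Hv Hw eta e eta0 e0; have e30 : 0 < e / 3 by rewrite divr_gt0.
have [N1 H1] := Hv eta _ eta0 e30; have [N2 H2] := Hw _ e30.
have [N3 H3] := nat_ge (N2.+1%:R / eta).
exists (maxn N1 (maxn N2 N3)) => n k; rewrite !geq_max => /and3P[n1 n2 n3] kn ek.
have kN : (N2 <= k)%N.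
  rewrite -ltnS -(ltr_nat R); apply: lt_le_trans ek.
  have := H3 n n3; rewrite ler_pdivrMr// => h; apply: (lt_le_trans (y := N2.+1%:R)); first by rewrite ltr_nat.
  by apply: (le_trans h); rewrite mulrC ler_wpM2l ?ler_nat// ltW.
have := H1 n k n1 kn ek; have := H2 n n2; have := H2 k kN.
rewrite !ler_norml => /andP[? ?] /andP[? ?] /andP[? ?]; apply/andP; split; lra.
Qed.

Lemma lns_half n : (0 < n)%N -> ln (4 / 3) <= lns n - lns n./2.
Proof.
move=> n0; rewrite /lns -ln_div ?posrE// ler_ln ?posrE ?divr_gt0//.
rewrite ler_pdivlMr// mulrAC ler_pdivrMr// -!natrM ler_nat.
have := odd_double_half n; lia.
Qed.

(** One-sided Potter bound, by strong induction through n/2: a halving loses [e] in the uniform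
    estimate and gains at least (a - c) ln(4/3), which is [e]. The constant [K] dominates the
    finitely many pairs up to [N0] by summing over all of them. *)
Lemma potter a c v : RV a v -> c < a -> exists2 K, 0 <= K &
  forall k n, (k <= n)%N -> v k <= v n + K + c * (lns k - lns n).
Proof.
move=> Hv ca.
pose e := (a - c) * ln (4 / 3).
have l43 : 0 < ln (4 / 3) :> R by apply: ln_gt0; lra.
have e0 : 0 < e by rewrite mulr_gt0// subr_gt0.
have [N0 HN] := Hv 2^-1 e (ltac:(by rewrite invr_gt0)) e0.
pose f k n := `|v k - v n - c * (lns k - lns n)|.
pose K := \sum_(n < N0.+1) \sum_(k < N0.+1) f k n + e.
have f0 k n : 0 <= f k n by exact: normr_ge0.
have K0 : 0 <= K by rewrite addr_ge0 ?(ltW e0)//; do 2!(apply: sumr_ge0 => ? _); exact: f0.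
exists K => // k n; have [m] := ubnP n; elim: m n => // m IH n; rewrite ltnS => nm kn.
have lkn := lns_le kn.
have [nN|Nn] := leqP n N0.
  have : f k n <= K.
    have kN : (k < N0.+1)%N by rewrite ltnS (leq_trans kn).
    have nN' : (n < N0.+1)%N by [].
    rewrite /K (bigD1 (Ordinal nN'))//= (bigD1 (Ordinal kN))//= -!addrA lerDl.
    by rewrite !addr_ge0 ?(ltW e0)//; do ?(apply: sumr_ge0 => ? _).
  rewrite /f ler_norml => /andP[? ?]; lra.
have n0 : (0 < n)%N by exact: leq_ltn_trans Nn.
have half2 : 2^-1 * n.+1%:R <= (n./2).+1%:R :> R.
  rewrite mulrC ler_pdivrMr// -natrM ler_nat; have := odd_double_half n; lia.
have acl : (a - c) * (lns k - lns n) <= 0 by rewrite mulr_ge0_le0 ?subr_le0// subr_ge0 ltW.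
have eK : e <= K by rewrite /K lerDr; do 2!(apply: sumr_ge0 => ? _).
have [kh|hk] := leqP k n./2; last first.
  have := HN n k (ltnW Nn) kn _; rewrite ler_norml => /(_ _)/andP[|? ?].
    by apply: (le_trans half2); rewrite ler_nat ltnS ltnW.
  lra.
have hn : (n./2 <= n)%N by have := odd_double_half n; lia.
have h1 : v k <= v n./2 + K + c * (lns k - lns n./2).
  by apply: IH => //; apply: leq_trans nm; have := odd_double_half n; lia.
have := HN n n./2 (ltnW Nn) hn half2; rewrite ler_norml => /andP[? ?].
have : (a - c) * ln (4 / 3) <= (a - c) * (lns n - lns n./2).
  by rewrite ler_wpM2l ?lns_half// subr_ge0 ltW.
rewrite -/e => ?; lra.
Qed.

(** Two tangent-line bounds at s t, for the points t and 0, combined with weights s and 1 - s. *)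
Lemma expR_convex (s t : R) : 0 <= s <= 1 -> expR (s * t) <= 1 - s + s * expR t.
Proof.
move=> /andP[s0 s1].
have h1 : expR (s * t) * (1 + (t - s * t)) <= expR t.
  have := expR_ge1Dx (t - s * t); rewrite -(ler_pM2l (expR_gt0 (s * t))) => /le_trans; apply.
  by rewrite -expRD [s * t + _]addrC subrK.
have h2 : expR (s * t) * (1 + - (s * t)) <= 1.
  have := expR_ge1Dx (- (s * t)); rewrite -(ler_pM2l (expR_gt0 (s * t))) => /le_trans; apply.
  by rewrite -expRD subrr expR0.
have := ler_wpM2l s0 h1; have : 0 <= 1 - s by lra.
move=> s1' ; have := ler_wpM2l s1' h2; lra.
Qed.

(** Comparison of a power sum with its integral; the induction step is Bernoulli's inequality for
    the exponent 1 - tau, which [expR_convex] supplies. *)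
Lemma sum_power_le (tau : R) (m : nat) : 0 <= tau < 1 ->
  \sum_(k < m.+1) expR (- tau * lns k) <= (1 - tau)^-1 * expR ((1 - tau) * lns m).
Proof.
move=> /andP[t0 t1]; have s0 : 0 < 1 - tau by lra.
have ln1' : lns 0 = 0 by rewrite /lns ln1.
elim: m => [|m IH].
  rewrite big_ord_recr big_ord0 /= add0r ln1' !mulr0 expR0 mulr1 invf_ge1//; lra.
rewrite big_ord_recr/=; apply: (le_trans (lerD IH (lexx _))).
have sl : 0 <= 1 - tau <= 1 by apply/andP; split; lra.
have := expR_convex (lns m - lns m.+1) sl.
rewrite expRB !expR_lns -(ler_pM2l (expR_gt0 ((1 - tau) * lns m.+1))) -expRD.
have -> : (1 - tau) * lns m.+1 + (1 - tau) * (lns m - lns m.+1) = (1 - tau) * lns m by ring.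
have -> : 1 - (1 - tau) + (1 - tau) * (m.+1%:R / m.+2%:R) = 1 - (1 - tau) * m.+2%:R^-1.
  have : 0 < m.+1%:R :> R by rewrite ltr0n.
  rewrite -[m.+2%:R]natr1; set x := m.+1%:R => x0; field; apply: lt0r_neq0; lra.
move=> H; rewrite -(ler_pM2l s0) mulrDr !mulrA mulfV ?lt0r_neq0// !mul1r.
have -> : expR (- tau * lns m.+1) = expR ((1 - tau) * lns m.+1) * m.+2%:R^-1.
  by rewrite -(expR_lns m.+1) -expRN -expRD; congr expR; ring.
move: H; set E := expR ((1 - tau) * lns m.+1); set i := m.+2%:R^-1.
rewrite (_ : E * (1 - (1 - tau) * i) = E - (1 - tau) * (E * i)); last ring.
set Z := (1 - tau) * (E * i); lra.
Qed.

Lemma potter_exp a v : RV a v -> -1 < a -> exists tau K, [/\ 0 <= tau < 1, 0 < K &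
  forall k n, (k <= n)%N ->
    expR (v k) <= K * expR (v n) * expR (- tau * (lns k - lns n))].
Proof.
(* [c] lies in (-1, 0) and below [a]; its opposite is the exponent tau. *)
move=> Hv a1; pose c := (Num.min a 0 - 1) / 2.
have m0 : Num.min a 0 <= 0 by rewrite ge_min lexx orbT.
have ma : Num.min a 0 <= a by rewrite ge_min lexx.
have m1 : -1 < Num.min a 0 by rewrite lt_min a1; lra.
have ca : c < a by rewrite /c; lra.
have [K K0 HK] := potter Hv ca.
exists (- c), (expR K); split; [by rewrite /c; apply/andP; split; lra|exact: expR_gt0|].
by move=> k n kn; rewrite opprK -!expRD ler_expR; have := HK k n kn; lra.
Qed.

Lemma rv_local_bound a v eta : RV a v -> -1 < a -> 0 < eta ->
  exists2 K, 0 < K & forall k n, (k <= n)%N -> eta * n.+1%:R <= k.+1%:R ->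
    expR (v k) <= K * expR (v n).
Proof.
move=> Hv a1 eta0; have [tau [K [/andP[t0 t1] K0 HK]]] := potter_exp Hv a1.
exists (K * expR (- tau * ln eta)); first by rewrite mulr_gt0// expR_gt0.
move=> k n kn ek; apply: (le_trans (HK k n kn)).
rewrite mulrAC ler_wpM2r ?expR_ge0// ler_wpM2l ?(ltW K0)// ler_expR.
rewrite !mulNr lerN2 ler_wpM2l// lerBrDr -lnM ?posrE// ler_ln ?posrE//.
by rewrite mulr_gt0.
Qed.

(** The factor (k/n)^s, available because the index exceeds -1, is what later makes the ends of a
    convolution negligible. *)
Lemma rv_sum_bound a v : RV a v -> -1 < a -> exists s K, [/\ 0 < s, 0 < K &
  forall k n, (k <= n)%N -> \sum_(j < k.+1) expR (v j) <=
    K * (n.+1%:R * expR (v n)) * expR (s * (lns k - lns n))].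
Proof.
move=> Hv a1; have [tau [K [t01 K0 HK]]] := potter_exp Hv a1.
have /andP[t0 t1] := t01; have s0 : 0 < 1 - tau by lra.
exists (1 - tau), (K * (1 - tau)^-1); split => //; first by rewrite mulr_gt0// invr_gt0.
move=> k n kn.
apply: (@le_trans _ _ (K * expR (v n) * expR (tau * lns n) * \sum_(j < k.+1) expR (- tau * lns j))).
  rewrite mulr_sumr; apply: ler_sum => j _.
  have jn : (j <= n)%N by apply: leq_trans kn; rewrite -ltnS.
  apply: (le_trans (HK j n jn)); rewrite -!mulrA ler_wpM2l ?(ltW K0)// ler_wpM2l ?expR_ge0//.
  by rewrite -expRD ler_expR; lra.
apply: (le_trans (ler_wpM2l _ (sum_power_le k t01))).
  by rewrite !mulr_ge0 ?expR_ge0// ltW.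
rewrite -(expR_lns n) -!mulrA ler_wpM2l ?(ltW K0)// mulrCA [leRHS]mulrC -!mulrA.
rewrite [leLHS](_ : _ = (1 - tau)^-1 * (expR (v n) * (expR (tau * lns n) * expR ((1 - tau) * lns k)))); last ring.
rewrite [leRHS](_ : _ = (1 - tau)^-1 * (expR (v n) * (expR (lns n) * expR ((1 - tau) * (lns k - lns n))))); last ring.
rewrite -!expRD ler_wpM2l ?invr_ge0 ?(ltW s0)// ler_expR; lra.
Qed.

End rv.

Local Close Scope classical_set_scope.

(** * Representations *)

Lemma ler_sum_inj (R : realType) (T1 T2 : finType) (A : {set T1}) (B : {set T2})
    (phi : T1 -> T2) (f : T1 -> R) (g : T2 -> R) :
  {in A &, injective phi} -> {in A, forall k, phi k \in B} ->
  {in A, forall k, f k = g (phi k)} -> {in B, forall k, 0 <= g k} ->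
  \sum_(k in A) f k <= \sum_(k in B) g k.
Proof.
move=> inj AB fg g0.
rewrite (eq_bigr (fun k => g (phi k))); last by move=> k kA; exact: fg.
rewrite -(big_imset g inj) [leRHS](big_setID (phi @: A))/=.
have /finset.setIidPr -> : phi @: A \subset B by apply/fintype.subsetP => _ /imsetP[k kA ->]; exact: AB.
by rewrite lerDl; apply: sumr_ge0 => k; rewrite finset.in_setD => /andP[_]; exact: g0.
Qed.

Lemma sum_const_pair (R : realType) (T1 T2 : finType) (A : {set T1}) (B : {set T2}) (D : R) :
  \sum_(i in A) \sum_(j in B) D = (#|A| * #|B|)%:R * D.
Proof. by rewrite !sumr_const -mulrnA mulnC mulr_natl. Qed.

Section reps.
Variables (R : realType) (J : finType) (N : nat).
Local Notation T := 'I_N.+1.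
Implicit Types (I : {set J}) (c : J -> nat) (k : {ffun J -> T}) (S U : {set T}).

(* Tuples vanish off I, so that all index sets I share one type of tuples. *)
Definition reps I c (m : nat) : {set {ffun J -> T}} :=
  [set k : {ffun J -> T} | [forall i, (i \notin I) ==> (k i == ord0)] &&
           ((\sum_(i in I) c i * k i)%N == m)].

Lemma repsP I c m k : reflect ((forall i, i \notin I -> k i = ord0) /\
  (\sum_(i in I) c i * k i)%N = m) (k \in reps I c m).
Proof.
rewrite inE; apply: (iffP andP) => -[H /eqP Hs]; split => //; try exact/eqP.
  by move=> i iI; have /forallP/(_ i)/implyP/(_ iI)/eqP := H.
by apply/forallP => i; apply/implyP => iI; apply/eqP/H.
Qed.

Lemma reps_ext I c c' m : {in I, c =1 c'} -> reps I c m = reps I c' m.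
Proof.
move=> cc; apply/finset.setP => k; rewrite !inE; congr (_ && (_ == _)).
by apply: eq_bigr => i iI; rewrite cc.
Qed.

Lemma card_reps0 c m : (#|reps finset.set0 c m| <= 1)%N.
Proof.
rewrite -(cards1 ([ffun=> ord0] : {ffun J -> T})); apply: subset_leq_card.
apply/fintype.subsetP => k /repsP[H _]; rewrite inE; apply/eqP/ffunP => i.
by rewrite ffunE H// inE.
Qed.

Definition upd k i x : {ffun J -> T} := [ffun j => if j == i then x else k j].

Lemma upd_inj i k k' x : upd k i x = upd k' i x -> k i = k' i -> k = k'.
Proof.
move=> /ffunP H Hi; apply/ffunP => j; have := H j; rewrite !ffunE.
by case: (eqVneq j i) => [->|].
Qed.

Lemma imset_upd k i x I : i \in I -> k @: I = k i |: upd k i x @: (I :\ i).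
Proof.
move=> iI; rewrite -{1}(finset.setD1K iI) finset.imsetU1; congr (_ |: _).
apply: eq_in_imset => j; rewrite in_setD1 => /andP[ji _].
by rewrite ffunE (negbTE ji).
Qed.

Lemma rem_reps I c m i k : i \in I -> k \in reps I c m ->
  (c i * k i <= m)%N /\ upd k i ord0 \in reps (I :\ i) c (m - c i * k i).
Proof.
move=> iI /repsP[k0 <-]; rewrite (big_setD1 i)//=; split; first exact: leq_addr.
apply/repsP; split.
  move=> j; rewrite in_setD1 negb_and negbK ffunE; case: eqP => //= _; exact: k0.
rewrite addKn; apply: eq_bigr => j; rewrite in_setD1 => /andP[ji _].
by rewrite ffunE (negbTE ji).
Qed.

(* The weights once the coordinates i and j are identified and j is dropped. *)
Definition merge c i j : J -> nat := fun t => if t == i then (c i + c j)%N else c t.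

Lemma merge_reps I c m i j k : i \in I -> j \in I :\ i -> k i = k j ->
  k \in reps I c m -> upd k j ord0 \in reps (I :\ j) (merge c i j) m.
Proof.
move=> iI; rewrite in_setD1 => /andP[ji jI] kij /repsP[k0 <-].
have iIj : i \in I :\ j by rewrite in_setD1 eq_sym ji.
apply/repsP; split.
  move=> t; rewrite in_setD1 negb_and negbK ffunE; case: eqP => //= _; exact: k0.
rewrite [RHS](big_setD1 j)//= [in RHS](big_setD1 i)//= (big_setD1 i)//= addnA.
rewrite /merge eqxx ffunE eq_sym (negbTE ji) mulnDl -kij [in RHS](addnC (c j * _)%N); congr (_ + _)%N.
apply: eq_bigr => t; rewrite !in_setD1 => /and3P[ti tj _].
by rewrite (negbTE ti) ffunE (negbTE tj).
Qed.

Definition injon I k := #|k @: I| == #|I|.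

Variable w : {set T} -> R.
Hypothesis w0 : forall U, 0 <= w U.

(** A tuple meeting [S] has a coordinate i equal to some x in [S]; clearing it leaves a
    representation of m - c_i x from which the tuple can be recovered. The weight [w] is abstract so
    as to cover both expectations and indicators for a fixed set. *)
Lemma sum_hit S I c m :
  \sum_(k in reps I c m | ~~ [disjoint k @: I & S]) w (k @: I) <=
  \sum_(i in I) \sum_(x in S | (c i * x <= m)%N)
    \sum_(k in reps (I :\ i) c (m - c i * x)) w (x |: k @: (I :\ i)).
Proof.
apply: (@le_trans _ _ (\sum_(k in reps I c m) \sum_(i in I) \sum_(x in S | k i == x) w (k @: I))).
  rewrite big_mkcondr/=; apply: ler_sum => k _; case: ifPn => H; last first.
    by apply: sumr_ge0 => i _; apply: sumr_ge0.
  move: H => /pred0Pn[x /= /andP[/imsetP[i iI ->] kS]].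
  rewrite (bigD1 i)//= (bigD1 (k i))/=; last by rewrite kS eqxx.
  by rewrite -addrA lerDl addr_ge0//; do ?[apply: sumr_ge0 => ? _].
rewrite exchange_big/=; apply: ler_sum => i iI.
rewrite (exchange_big_dep (mem S))/=; last by move=> k x _ /andP[].
rewrite [leRHS]big_mkcondr/=; apply: ler_sum => x xS.
rewrite (eq_bigl (fun k => k \in [set k in reps I c m | k i == x])); last first.
  by move=> k /=; rewrite xS [RHS]inE.
case: ifPn => cm; last first.
  rewrite big1// => k; rewrite inE => /andP[/(rem_reps iI)[h _] /eqP kx].
  by move: h cm; rewrite kx => ->.
apply: (@ler_sum_inj _ _ _ _ _ (fun k => upd k i ord0)) => //.
- move=> k k'; rewrite !inE => /andP[_ /eqP kx] /andP[_ /eqP kx'] /upd_inj; apply.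
  by rewrite kx.
- by move=> k; rewrite inE => /andP[/(rem_reps iI)[_ +] /eqP <-].
- by move=> k; rewrite inE => /andP[_ /eqP <-]; rewrite -imset_upd.
Qed.

Lemma sum_noninj I c m :
  \sum_(k in reps I c m | ~~ injon I k) w (k @: I) <=
  \sum_(i in I) \sum_(j in I :\ i)
    \sum_(k in reps (I :\ j) (merge c i j) m) w (k @: (I :\ j)).
Proof.
apply: (@le_trans _ _ (\sum_(k in reps I c m) \sum_(i in I) \sum_(j in I :\ i | k i == k j) w (k @: I))).
  rewrite big_mkcondr/=; apply: ler_sum => k _; case: ifPn => H; last first.
    by apply: sumr_ge0 => i _; apply: sumr_ge0.
  have [i [j [iI jI kij]]] : exists i j, [/\ i \in I, j \in I :\ i & k i = k j].
    apply: contrapT => nH; move/imset_injP: H; apply => i j iI jI kij.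
    apply/eqP; apply: contraPT isT => ij _; apply: nH; exists i, j; split => //.
    by rewrite in_setD1 eq_sym ij.
  rewrite (bigD1 i)//= (bigD1 j)/=; last by rewrite jI kij eqxx.
  by rewrite -addrA lerDl addr_ge0//; do ?[apply: sumr_ge0 => ? _].
rewrite exchange_big/=; apply: ler_sum => i iI.
rewrite (exchange_big_dep (mem (I :\ i)))/=; last by move=> k x _ /andP[].
apply: ler_sum => j jI.
rewrite (eq_bigl (fun k => k \in [set k in reps I c m | k i == k j])); last first.
  by move=> k /=; rewrite jI [RHS]inE.
have [ji jI'] : j != i /\ j \in I by move: jI; rewrite in_setD1 => /andP[].
apply: (@ler_sum_inj _ _ _ _ _ (fun k => upd k j ord0)) => //.
- move=> k k'; rewrite !inE => /andP[_ /eqP kx] /andP[_ /eqP kx'] E.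
  apply: (upd_inj E); rewrite -kx -kx'; move/ffunP: E => /(_ i).
  by rewrite !ffunE eq_sym (negbTE ji).
- by move=> k; rewrite inE => /andP[kr /eqP kij]; apply: merge_reps.
- move=> k; rewrite inE => /andP[_ /eqP kij]; rewrite (imset_upd _ ord0 jI').
  congr w; apply/finset.setUidPr; rewrite finset.sub1set -kij.
  apply/imsetP; exists i; first by rewrite in_setD1 eq_sym ji.
  by rewrite ffunE eq_sym (negbTE ji).
Qed.

Definition good S I k := injon I k && [disjoint k @: I & S].

Lemma sum_good_ge S I c m :
  \sum_(k in reps I c m) w (k @: I) <=
  \sum_(k in reps I c m | good S I k) w (k @: I) +
  \sum_(k in reps I c m | ~~ [disjoint k @: I & S]) w (k @: I) +
  \sum_(k in reps I c m | ~~ injon I k) w (k @: I).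
Proof.
rewrite [X in _ <= X + _ + _]big_mkcondr [X in _ <= _ + X + _]big_mkcondr
  [X in _ <= _ + _ + X]big_mkcondr/= -!big_split/=; apply: ler_sum => k _.
rewrite /good; case: injon; case: [disjoint _ & _] => /=; rewrite ?addr0 ?add0r//.
by rewrite lerDl.
Qed.

End reps.

(** * Representations with entries in a random set *)

Section random_reps.
Variables (R : realType) (p : nat -> R).
Hypothesis p01 : forall x, 0 <= p x <= 1.
Variables (J : finType) (N : nat).
Local Notation T := 'I_N.+1.
Implicit Types (I : {set J}) (c : J -> nat) (k : {ffun J -> T}) (S U : {set T}).
Implicit Type A : pred nat.

Definition elts U : seq nat := [seq val x | x <- enum U].

Lemma elts_uniq U : uniq (elts U).
Proof. by rewrite map_inj_uniq ?enum_uniq//; exact: val_inj. Qed.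

Lemma elts_lt U : {in elts U, forall x, (x < N.+1)%N}.
Proof. by move=> _ /mapP[x _ ->]; exact: ltn_ord. Qed.

Lemma mem_elts U (x : T) : ((x : nat) \in elts U) = (x \in U).
Proof. by rewrite mem_map ?mem_enum//; exact: val_inj. Qed.

Lemma prod_elts U (P : pred nat) (f : nat -> R) :
  \prod_(x <- elts U | P x) f x = \prod_(x in U | P x) f x.
Proof. by rewrite big_map big_enum_cond. Qed.

Definition inA A U := all A (elts U).

Lemma inAP A U : reflect (forall x : T, x \in U -> A x) (inA A U).
Proof.
apply: (iffP allP) => [H x xU|H _ /mapP[x xU ->]]; first by apply: H; rewrite mem_elts.
by apply: H; rewrite -mem_enum.
Qed.

Lemma inA_sub A U U' : U \subset U' -> inA A U' -> inA A U.
Proof. by move=> /fintype.subsetP UU /inAP H; apply/inAP => x /UU /H. Qed.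

Definition pw U : R := \prod_(x in U) p x.

Let p0 x : 0 <= p x. Proof. by case/andP: (p01 x). Qed.
Let p1 x : p x <= 1. Proof. by case/andP: (p01 x). Qed.

Lemma pw_ge0 U : 0 <= pw U. Proof. by apply: prodr_ge0. Qed.

Lemma Ex_inA U f : Ex p N.+1 (fun A => (inA A U)%:R * f A) =
  pw U * Ex p N.+1 (fun A => f (addp (elts U) A)).
Proof.
have := Ex_cond p01 f (elts_uniq U) (@elts_lt U); rewrite /inA => ->.
by rewrite prod_elts; congr (_ * _); apply: eq_bigl => x; rewrite andbT.
Qed.

(** Repeated entries are weighted with multiplicity, which keeps this a true convolution; its terms
    are inclusion probabilities for injective tuples only. *)
Definition sprod I c m : R := \sum_(k in reps N I c m) \prod_(i in I) p (k i).

Lemma pw_injon I k : injon I k -> pw (k @: I) = \prod_(i in I) p (k i).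
Proof. by move=> /imset_injP inj; rewrite /pw big_imset. Qed.

Lemma pw_ge_prod I k : \prod_(i in I) p (k i) <= pw (k @: I).
Proof.
rewrite (partition_big_imset k)/=; apply: ler_prod => y /imsetP[i iI ->].
apply/andP; split; first by apply: prodr_ge0.
rewrite (bigD1 i)/= ?iI ?eqxx// ler_piMr//.
by apply: prodr_ile1 => j _; rewrite p0 p1.
Qed.

Lemma sprod_good S I c m :
  \sum_(k in reps N I c m | good S I k) pw (k @: I) <= sprod I c m.
Proof.
rewrite /sprod [leRHS](bigID (good S I))/= -[leLHS]addr0; apply: lerD.
  by apply: ler_sum => k /andP[_ /andP[/pw_injon -> _]].
by apply: sumr_ge0 => k _; apply: prodr_ge0.
Qed.

(* Number of ordered M-tuples of pairwise disjoint injective representations with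
   entries in A and off S. *)
Fixpoint disjtup (M : nat) I c m S A : R :=
  if M is M'.+1 then
    \sum_(k in reps N I c m | good S I k)
      (inA A (k @: I))%:R * disjtup M' I c m (S :|: k @: I) A
  else 1.

Lemma disjtup_ge0 M I c m S A : 0 <= disjtup M I c m S A.
Proof.
elim: M S => [|M IH] S /=; first by [].
by apply: sumr_ge0 => k _; rewrite mulr_ge0.
Qed.

(** All the tuples counted avoid [S], so inserting elements of [S] changes nothing; this is the
    independence behind [Ex_disjtup]. *)
Lemma disjtup_addp M I c m S U A : U \subset S ->
  disjtup M I c m S (addp (elts U) A) = disjtup M I c m S A.
Proof.
elim: M S => [|M IH] S US //=; apply: eq_bigr => k /andP[_ /andP[_ dS]].
rewrite IH; last exact: fintype.subset_trans US (finset.subsetUl _ _).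
congr (_ * _); congr (nat_of_bool _)%:R; apply: eq_in_all => _ /mapP[x xk ->]; rewrite /addp mem_elts.
suff /negbTE -> : x \notin U by [].
apply/negP => xU; move/pred0P: dS => /(_ x) /=.
by rewrite -mem_enum xk (fintype.subsetP US).
Qed.

(** Disjointness lets the expectation factor one representation at a time; each factor is then
    bounded by [sprod], forgetting the disjointness constraint. *)
Lemma Ex_disjtup M I c m S : Ex p N.+1 (disjtup M I c m S) <= sprod I c m ^+ M.
Proof.
elim: M S => [|M IH] S; first by rewrite [disjtup 0 _ _ _ _](_ : _ = fun=> 1)// Ex_cst expr0.
rewrite [disjtup M.+1 _ _ _ _](_ : _ = (fun A => \sum_(k in reps N I c m | good S I k)
      (inA A (k @: I))%:R * disjtup M I c m (S :|: k @: I) A))// Ex_sum exprS.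
apply: (@le_trans _ _ (\sum_(k in reps N I c m | good S I k) pw (k @: I) * sprod I c m ^+ M)).
  apply: ler_sum => k _; rewrite Ex_inA ler_wpM2l ?pw_ge0//.
  apply: le_trans (IH (S :|: k @: I)); apply: Ex_le => // A.
  by rewrite disjtup_addp// finset.subsetUr.
rewrite -mulr_suml ler_wpM2r ?sprod_good//.
by rewrite exprn_ge0//; apply: sumr_ge0 => k _; apply: prodr_ge0.
Qed.

Definition cnt A I c m : R := \sum_(k in reps N I c m) (inA A (k @: I))%:R.

(** Greedy choice. The forbidden set never exceeds |S| + |I| M elements. Each forbidden element in
    each position blocks at most [D] representations, and so does each pair of coinciding positions;
    at least [y] choices therefore remain at every stage. *)
Lemma disjtup_ge M I c m S A (D y : R) : 0 <= y -> 0 <= D ->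
  (forall i m', i \in I -> (m' <= m)%N -> cnt A (I :\ i) c m' <= D) ->
  (forall i j, i \in I -> j \in I :\ i -> cnt A (I :\ j) (merge c i j) m <= D) ->
  y + (#|I| * (#|S| + #|I| * M) + #|I| ^ 2)%:R * D <= cnt A I c m ->
  y ^+ M <= disjtup M I c m S A.
Proof.
move=> y0 D0 H1 H2; elim: M S => [|M IH] S Hy; first by rewrite expr0.
pose l := #|I|.
have lS : (#|S| <= #|S| + l * M.+1)%N by exact: leq_addr.
have Hgood : y <= \sum_(k in reps N I c m | good S I k) (inA A (k @: I))%:R.
  have := @sum_good_ge R J N (fun U => (inA A U)%:R) (fun _ => ler0n _ _) S I c m.
  have hhit := @sum_hit R J N (fun U => (inA A U)%:R) (fun _ => ler0n _ _) S I c m.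
  have hni := @sum_noninj R J N (fun U => (inA A U)%:R) (fun _ => ler0n _ _) I c m.
  have {}hhit : \sum_(k in reps N I c m | ~~ [disjoint k @: I & S]) (inA A (k @: I))%:R <= (l * #|S|)%:R * D.
    apply: (le_trans hhit).
    apply: (@le_trans _ _ (\sum_(i in I) \sum_(x in S) D)).
      apply: ler_sum => i iI; rewrite big_mkcondr; apply: ler_sum => x _.
      case: ifPn => // _; apply: le_trans (H1 i (m - c i * x)%N iI (leq_subr _ _)).
      apply: ler_sum => k _; rewrite ler_nat.
      case: (boolP (inA A (x |: _))) => // H.
      by rewrite (inA_sub _ H)// finset.subsetUr.
    by rewrite sum_const_pair.
  have {}hni : \sum_(k in reps N I c m | ~~ injon I k) (inA A (k @: I))%:R <= (l ^ 2)%:R * D.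
    apply: (le_trans hni).
    apply: (@le_trans _ _ (\sum_(i in I) \sum_(j in I) D)).
      apply: ler_sum => i iI.
      apply: (@le_trans _ _ (\sum_(j in I :\ i) D)); first by apply: ler_sum => j jI; exact: H2.
      by rewrite (big_setD1 i iI)/= lerDr.
    by rewrite sum_const_pair mulnn.
  rewrite -/(cnt A I c m) => hg.
  have : (l * #|S|)%:R * D + (l ^ 2)%:R * D <= (l * (#|S| + l * M.+1) + l ^ 2)%:R * D.
    by rewrite -mulrDl -natrD ler_wpM2r// ler_nat leq_add2r leq_mul2l lS orbT.
  lra.
rewrite /= exprSr; apply: (le_trans (ler_wpM2l (exprn_ge0 M y0) Hgood)).
rewrite mulr_sumr; apply: ler_sum => k /andP[_ /andP[/eqP kI _]].
rewrite mulrC ler_wpM2l//; apply: IH; apply: le_trans Hy; rewrite lerD2l ler_wpM2r// ler_nat leq_add2r leq_mul2l.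
apply/orP; right; rewrite mulnS addnA leq_add2r.
by apply: (leq_trans (leq_card_setU _ _)); rewrite kI.
Qed.

Variable B : nat.
(** This class of weights is closed under dropping a variable and under merging two, and the cap [B]
    leaves finitely many families on each index set. *)
Definition adm I c := (forall i, i \in I -> (0 < c i)%N) /\ (\sum_(i in I) c i <= B)%N.

Lemma adm_rem I c i : adm I c -> adm (I :\ i) c.
Proof.
move=> [cp cB]; split; first by move=> j; rewrite in_setD1 => /andP[_]; exact: cp.
by apply: leq_trans cB; rewrite [leqRHS](big_setID [set i])/= leq_addl.
Qed.

Lemma adm_merge I c i j : i \in I -> j \in I :\ i -> adm I c -> adm (I :\ j) (merge c i j).
Proof.
move=> iI; rewrite in_setD1 => /andP[ji jI] [cp cB]; split.
  move=> t; rewrite in_setD1 /merge => /andP[_ tI]; case: eqP => _; last exact: cp.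
  by rewrite addn_gt0 cp.
apply: leq_trans cB; rewrite [leqRHS](big_setD1 j)//= [leqRHS]addnC.
have iIj : i \in I :\ j by rewrite in_setD1 eq_sym ji.
rewrite (big_setD1 i iIj)/= [in leqRHS](big_setD1 i iIj)/= /merge eqxx -addnA [leqRHS]addnAC.
rewrite addnA leq_add2l leq_eqVlt; apply/orP; left; apply/eqP.
by apply: eq_bigr => t; rewrite in_setD1 => /andP[/negbTE -> _].
Qed.

(** The conditional expectation of the number of representations, given that [S] lies in the random
    set. *)
Definition overlap_sum S I c m : R := \sum_(k in reps N I c m) pw (k @: I :\: S).

Lemma pwD_ge0 S U : 0 <= pw (U :\: S). Proof. exact: pw_ge0. Qed.

Lemma hit_le S I c m (D : R) : 0 <= D ->
  (forall i m', i \in I -> (m' <= m)%N -> overlap_sum S (I :\ i) c m' <= D) ->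
  \sum_(k in reps N I c m | ~~ [disjoint k @: I & S]) pw (k @: I :\: S) <= (#|I| * #|S|)%:R * D.
Proof.
move=> D0 H; apply: (le_trans (@sum_hit R J N (fun U => pw (U :\: S)) (pwD_ge0 S) S I c m)).
rewrite -sum_const_pair; apply: ler_sum => i iI; rewrite big_mkcondr; apply: ler_sum => x xS.
case: ifPn => cm //; apply: le_trans (H i (m - c i * x)%N iI (leq_subr _ _)).
apply: ler_sum => k _; rewrite (_ : (_ |: _) :\: S = k @: (I :\ i) :\: S)//.
by rewrite finset.setDUl (_ : [set x] :\: S = finset.set0) ?finset.set0U//; apply/eqP; rewrite finset.setD_eq0 finset.sub1set.
Qed.

Lemma noninj_le S I c m (D : R) : 0 <= D ->
  (forall i j, i \in I -> j \in I :\ i -> overlap_sum S (I :\ j) (merge c i j) m <= D) ->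
  \sum_(k in reps N I c m | ~~ injon I k) pw (k @: I :\: S) <= (#|I| ^ 2)%:R * D.
Proof.
move=> D0 H; apply: (le_trans (@sum_noninj R J N (fun U => pw (U :\: S)) (pwD_ge0 S) I c m)).
rewrite -mulnn -sum_const_pair; apply: ler_sum => i iI.
apply: (@le_trans _ _ (\sum_(j in I :\ i) D)); first by apply: ler_sum => j jI; exact: H.
by rewrite (big_setD1 i iI)/= lerDr.
Qed.

Variables (W : nat -> R) (L : nat) (C : R).
Hypothesis W1 : forall m, 1 <= W m.
Hypothesis Wmono : forall m n, (m <= n)%N -> W m <= W n.
Hypothesis C0 : 0 <= C.

Fixpoint overlap_const (s l : nat) : R :=
  if l is l'.+1 then C + (l'.+1 * s + l'.+1 ^ 2)%:R * overlap_const s l' else 1.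

Lemma overlap_const_ge0 s l : 0 <= overlap_const s l.
Proof. by elim: l => //= l IH; rewrite addr_ge0// mulr_ge0. Qed.

(** Induction on |I|, mirrored by [overlap_const]: injective tuples off [S] are bounded by [sprod],
    and all others reduce to one variable less, with a target that may shrink, whence the
    monotonicity of [W]. *)
Lemma overlap_sum_le (s : nat) S I c m :
  (forall I c m, (#|I| <= L)%N -> adm I c -> (m <= N)%N -> (0 < #|I|)%N -> sprod I c m <= C * W m) ->
  (#|I| <= L)%N -> adm I c -> (m <= N)%N -> (#|S| <= s)%N ->
  overlap_sum S I c m <= overlap_const s #|I| * W m.
Proof.
move=> Hs; move: {-1}#|I| (erefl #|I|) => r.
elim: r I c m => [|r IH] I c m Ir IL ac mN Ss /=.
  move/eqP: Ir; rewrite cards_eq0 => /eqP ->; rewrite mul1r; apply: le_trans (W1 m).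
  rewrite /overlap_sum (eq_bigr (fun=> 1)).
    by rewrite sumr_const -[leRHS](mulr1n 1) ler_pMn2l// card_reps0.
  by move=> k _; rewrite imset0 finset.set0D /pw big_set0.
have H1 := @sum_good_ge R J N (fun U => pw (U :\: S)) (pwD_ge0 S) S I c m.
have W0 n : 0 <= W n by exact: le_trans (W1 n).
have KW0 : 0 <= overlap_const s r * W m by rewrite mulr_ge0// overlap_const_ge0.
have h2 : \sum_(k in reps N I c m | ~~ [disjoint k @: I & S]) pw (k @: I :\: S) <= (r.+1 * s)%:R * (overlap_const s r * W m).
  apply: (@le_trans _ _ ((#|I| * #|S|)%:R * (overlap_const s r * W m))); last first.
    by rewrite Ir ler_wpM2r ?ler_nat ?leq_mul2l ?Ss ?orbT.
  apply: hit_le => // i m' iI m'm.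
  have Ii : #|I :\ i| = r by have := cardsD1 i I; rewrite iI Ir => -[].
  apply: (@le_trans _ _ (overlap_const s r * W m')); last by rewrite ler_wpM2l ?overlap_const_ge0// Wmono.
  apply: IH => //; [exact: leq_trans IL|exact: adm_rem|exact: leq_trans mN].
have h3 : \sum_(k in reps N I c m | ~~ injon I k) pw (k @: I :\: S) <= (r.+1 ^ 2)%:R * (overlap_const s r * W m).
  rewrite -Ir; apply: noninj_le => // i j iI jI.
  have jI' : j \in I by move: jI; rewrite in_setD1 => /andP[].
  have Ij : #|I :\ j| = r by have := cardsD1 j I; rewrite jI' Ir => -[].
  apply: IH => //; [exact: leq_trans IL|exact: adm_merge].
apply: (le_trans H1).
have h1 : \sum_(k in reps N I c m | good S I k) pw (k @: I :\: S) <= C * W m.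
  apply: le_trans (Hs I c m _ ac mN _); rewrite ?Ir//.
  apply: le_trans (sprod_good S I c m); apply: ler_sum => k /andP[_ /andP[_ dS]].
  by rewrite (_ : k @: I :\: S = k @: I)//; apply/finset.setDidPl.
rewrite mulrDl natrD -mulrA mulrDl addrA; apply: lerD => //; exact: lerD.
Qed.

End random_reps.

(** * Iterated convolutions as polynomial coefficients *)

Fixpoint sconv (R : realType) (p : nat -> R) (cs : seq nat) (m : nat) : R :=
  if cs is a :: cs' then
    \sum_(x < m.+1 | (a * x <= m)%N) p x * sconv p cs' (m - a * x)
  else (m == 0%N)%:R.

Lemma coef_prod_sconv (R : realType) (p : nat -> R) (N : nat) (cs : seq nat) (m : nat) :
  all (ltn 0) cs -> (m <= N)%N ->
  (\prod_(a <- cs) \sum_(x < N.+1) p x *: 'X^(a * x))`_m = sconv p cs m.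
Proof.
elim: cs m => [|a cs IH] m; first by rewrite big_nil coef1.
move=> /= /andP[a0 cs0] mN; rewrite big_cons mulr_suml coef_sum.
rewrite (big_ord_widen_cond N.+1 (fun x => a * x <= m)%N
  (fun x => p x * sconv p cs (m - a * x)))//.
rewrite [RHS]big_mkcond/=; apply: eq_bigr => x _.
rewrite -scalerAl coefZ coefXnM ltnNge; case: (leqP (a * x)%N m) => ax /=; last by rewrite mulr0.
rewrite ltnS (leq_trans _ ax) ?leq_pmull// IH//.
by rewrite (leq_trans (leq_subr _ _)).
Qed.

(** Both sides are the coefficient of X^m in the product over i of sum_x p(x) X^(c_i x): expanding
    over tuples gives one, multiplying factor by factor the other. *)
Lemma sprod_sconv (R : realType) (p : nat -> R) (J : finType) (N : nat)
    (I : {set J}) (c : J -> nat) (m : nat) :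
  (forall i, i \in I -> (0 < c i)%N) -> (m <= N)%N ->
  sprod p N I c m = sconv p [seq c i | i <- enum I] m.
Proof.
move=> cp mN; rewrite -(@coef_prod_sconv _ _ N)//; last first.
  by apply/allP => _ /mapP[i iI ->]; apply: cp; rewrite -mem_enum.
rewrite big_map big_enum/= (big_distr_big_dep ord0)/= coef_sum.
rewrite /sprod [LHS]big_mkcond [RHS]big_mkcond/=; apply: eq_bigr => k _.
rewrite inE; have -> : (k \in pfamily ord0 (mem I) (fun=> xpredT)) =
    [forall i, (i \notin I) ==> (k i == ord0)].
  apply/pfamilyP/forallP => [[/fintype.subsetP H _] i|H].
    by apply/implyP => iI; apply/negPn; apply: contra iI => k0; exact: (H i).
  split => //; apply/fintype.subsetP => i; rewrite inE => k0.
  by apply/negPn/negP => iI; move: (H i); rewrite iI (negbTE k0).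
case: ifPn => [/andP[-> /eqP <-]|].
  by rewrite scaler_prod prodrXr coefZ coefXn eqxx mulr1.
rewrite negb_and => /orP[/negbTE ->//|/negbTE km]; case: ifP => // _.
by rewrite scaler_prod prodrXr coefZ coefXn eq_sym km mulr0.
Qed.

(** All n up to N must be counted on one ground set, so entries are allowed up to N; positive
    weights keep them below n+1 anyway. *)
Lemma rep_count_cnt (R : realType) (h : nat) (b : 'I_h -> nat) (A : pred nat) (n N : nat) :
  (forall i, (0 < b i)%N) -> (n <= N)%N ->
  (rep_count b A n)%:R = cnt R N A [set: 'I_h] b n.
Proof.
move=> b0 nN.
pose B := [set k in reps N [set: 'I_h] b n | inA A (k @: [set: 'I_h])].
have -> : cnt R N A [set: 'I_h] b n = #|B|%:R.
  rewrite /cnt -sum1_card natr_sum [LHS]big_mkcond [RHS]big_mkcond/=; apply: eq_bigr => k _.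
  by rewrite [k \in B]inE; case: (k \in reps _ _ _ _) => //=; case: inA.
have nN1 : (n.+1 <= N.+1)%N by [].
pose phi (k : {ffun 'I_h -> 'I_n.+1}) : {ffun 'I_h -> 'I_N.+1} := [ffun i => widen_ord nN1 (k i)].
have phi_inj : injective phi.
  move=> k k' /ffunP E; apply/ffunP => i; have := E i; rewrite !ffunE => /(congr1 val) /= E'.
  exact: val_inj.
congr (_%:R); rewrite /rep_count -(card_imset _ phi_inj); apply: eq_card => k'.
apply/imsetP/idP => [[k]|].
  rewrite inE => /andP[/forallP kA /eqP kn] ->; rewrite inE; apply/andP; split.
    apply/repsP; split; first by move=> i; rewrite inE.
    by rewrite -[RHS]kn; apply: eq_big => [i|i _]; rewrite ?inE ?ffunE.
  by apply/inAP => _ /imsetP[i _ ->]; rewrite ffunE /=; exact: kA.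
rewrite inE => /andP[/repsP[_ kn] /inAP kA].
have kle i : (k' i < n.+1)%N.
  rewrite ltnS -kn (bigD1 i) ?inE//=; apply: leq_trans (leq_addr _ _).
  by rewrite leq_pmull.
exists [ffun i => Ordinal (kle i)].
  rewrite inE; apply/andP; split.
    by apply/forallP => i; rewrite ffunE /=; apply: kA; apply/imsetP; exists i; rewrite ?inE.
  by apply/eqP; rewrite -[RHS]kn; apply: eq_big => [i|i _]; rewrite ?inE ?ffunE.
by apply/ffunP => i; rewrite !ffunE; exact: val_inj.
Qed.

(** * Asymptotics of convolutions *)

(** Over g / gcd(a, g) consecutive x, the product a x meets every multiple of gcd(a, g) modulo g
    exactly once. The size hypothesis gives a x <= n on the window, so the subtraction never
    truncates. *)
Lemma count_dvd_window (a g n y : nat) : (0 < a)%N -> (0 < g)%N ->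
  (a * (y + g %/ gcdn a g) <= n + a)%N ->
  (\sum_(y <= x < y + g %/ gcdn a g) (g %| n - a * x) = (gcdn a g %| n))%N.
Proof.
set d := gcdn a g; set q := (g %/ d)%N => a0 g0 aq.
have d0 : (0 < d)%N by rewrite gcdn_gt0 a0.
have gE : g = (d * q)%N by rewrite mulnC divnK// dvdn_gcdr.
have aE : a = (d * (a %/ d))%N by rewrite mulnC divnK// dvdn_gcdl.
have q0 : (0 < q)%N by move: g0; rewrite gE muln_gt0 => /andP[].
have ax x : (x < y + q)%N -> (a * x <= n)%N.
  by move=> xq; rewrite -(leq_add2r a); apply: leq_trans aq; rewrite -mulnSr leq_mul2l xq orbT.
have [dn|dn] := boolP (d %| n)%N; last first.
  rewrite big_nat_cond big1// => x /andP[/andP[_ /ax axn] _].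
  apply/eqP; rewrite eqb0; apply: contra dn => gd.
  rewrite -(subnK axn) dvdn_add//; first by apply: dvdn_trans gd; exact: dvdn_gcdr.
  by rewrite dvdn_mulr// dvdn_gcdl.
have cop : coprime (a %/ d) q.
  have := gcdn_gt0 a g; rewrite /coprime => _; apply/eqP.
  have : (d * gcdn (a %/ d) q = d * 1)%N by rewrite muln_gcdr -aE -gE muln1.
  by move=> /eqP; rewrite eqn_pmul2l// => /eqP.
have nE : n = (d * (n %/ d))%N by rewrite mulnC divnK.
pose f (i : 'I_q) : 'I_q := Ordinal (ltn_pmod ((a %/ d) * (y + i)) q0).
have f_inj : injective f.
  move=> i j /(congr1 val) /= /eqP; rewrite -/(_ == _ %[mod q]).
  wlog ij : i j / (i <= j)%N.
    move=> H; case: (leqP i j) => [|/ltnW] ij; first exact: H.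
    by rewrite eq_sym => /(H _ _ ij).
  rewrite eq_sym eqn_mod_dvd; last by rewrite leq_mul2l leq_add2l ij orbT.
  rewrite -mulnBr subnDl Gauss_dvdr 1?coprime_sym//.
  move=> qd; apply: val_inj => /=.
  have : (j - i = 0)%N.
    apply/eqP; apply: contraTT qd; rewrite -lt0n => ji; apply/negP => /(dvdn_leq ji).
    by rewrite leqNgt (leq_ltn_trans (leq_subr _ _)).
  by move/eqP; rewrite subn_eq0 => ji; apply/eqP; rewrite eqn_leq ij.
pose t : 'I_q := Ordinal (ltn_pmod (n %/ d) q0).
rewrite -{1}[y]add0n big_addn addKn big_mkord.
rewrite (eq_bigr (fun i : 'I_q => nat_of_bool (f i == t))).
  transitivity (\sum_(j < q) (j == t))%N; first by rewrite [RHS](reindex_inj f_inj).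
  by rewrite (bigD1 t)//= eqxx big1 ?addn0// => j /negbTE ->.
move=> i _; congr nat_of_bool; rewrite -val_eqE /=.
have axi : (a * (i + y) <= n)%N by apply: ax; rewrite addnC ltn_add2l.
rewrite {1}gE {1}nE {1}aE -mulnA -mulnBr dvdn_pmul2l// eq_sym.
rewrite -/(_ == _ %[mod q]) eqn_mod_dvd 1?addnC//.
by rewrite -(leq_pmul2l d0) mulnA -aE -nE.
Qed.

Section convolution.
Variable R : realType.
Implicit Types (v w : nat -> R) (a : nat).

Definition dilated_conv a (P u : nat -> R) (n : nat) : R :=
  \sum_(x < n.+1 | (a * x <= n)%N) P x * u (n - a * x)%N.

(** Here n - a x stays at least n/2, so exp [w] is bounded by a multiple of its value at n and an
    initial sum of exp [v] remains. *)
Lemma conv_head (sg bt : R) a v w : RV sg v -> RV bt w -> -1 < sg -> -1 < bt -> (0 < a)%N ->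
  exists s K : R, [/\ 0 < s, 0 < K & forall n k, (2 * a * k <= n)%N ->
    \sum_(x < k.+1) expR (v x) * expR (w (n - a * x)%N) <=
      K * (n.+1%:R * expR (v n) * expR (w n)) * expR (s * (lns R k - lns R n))].
Proof.
move=> Hv Hw s1 b1 a0.
have [s [K [s0 K0 HK]]] := rv_sum_bound Hv s1.
have [K' K'0 HK'] := rv_local_bound Hw b1 (ltac:(by rewrite invr_gt0) : (0 : R) < 2^-1).
exists s, (K * K'); split => //; first exact: mulr_gt0.
move=> n k kn.
have kn' : (k <= n)%N by apply: leq_trans kn; rewrite leq_pmull// muln_gt0.
apply: (@le_trans _ _ (\sum_(x < k.+1) expR (v x) * (K' * expR (w n)))).
  apply: ler_sum => x _; rewrite ler_wpM2l ?expR_ge0// HK' ?leq_subr//.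
  rewrite mulrC ler_pdivrMr// -natrM ler_nat.
  have : (2 * (a * x) <= n)%N by rewrite mulnA (leq_trans _ kn)// leq_mul2l -ltnS ltn_ord orbT.
  by move: (a * x)%N => ax; lia.
rewrite -mulr_suml; apply: (le_trans (ler_wpM2r _ (HK k n kn'))).
  by rewrite mulr_ge0 ?expR_ge0// ltW.
by rewrite le_eqVlt; apply/orP; left; apply/eqP; ring.
Qed.

(** The mirror image: x is comparable to n, and x -> n - a x is injective into the range of an
    initial sum of exp [w]. *)
Lemma conv_tail (sg bt : R) a v w : RV sg v -> RV bt w -> -1 < sg -> -1 < bt -> (0 < a)%N ->
  exists s K : R, [/\ 0 < s, 0 < K & forall n j, (j <= n)%N ->
    \sum_(x < n.+1 | [&& a * x <= n, n <= 2 * a * x & n - a * x <= j]%N)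
        expR (v x) * expR (w (n - a * x)%N) <=
      K * (n.+1%:R * expR (v n) * expR (w n)) * expR (s * (lns R j - lns R n))].
Proof.
move=> Hv Hw s1 b1 a0.
have [s [K [s0 K0 HK]]] := rv_sum_bound Hw b1.
have a20 : 0 < (2 * a)%:R^-1 :> R by rewrite invr_gt0 ltr0n muln_gt0.
have [K' K'0 HK'] := rv_local_bound Hv s1 a20.
exists s, (K * K'); split => //; first exact: mulr_gt0.
move=> n j jn.
apply: (@le_trans _ _ (\sum_(x < n.+1 | [&& a * x <= n, n <= 2 * a * x & n - a * x <= j]%N)
   (K' * expR (v n)) * expR (w (n - a * x)%N))).
  apply: ler_sum => x /and3P[ax nx _]; rewrite ler_wpM2r ?expR_ge0// HK'//.
    by rewrite -ltnS.
  rewrite mulrC ler_pdivrMr ?ltr0n ?muln_gt0// -natrM ler_nat; nia.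
rewrite -mulr_sumr.
have h : \sum_(x < n.+1 | [&& a * x <= n, n <= 2 * a * x & n - a * x <= j]%N) expR (w (n - a * x)%N)
    <= \sum_(i < j.+1) expR (w i).
  rewrite (eq_bigl (fun x : 'I_n.+1 => x \in [set x : 'I_n.+1 | [&& a * x <= n, n <= 2 * a * x & n - a * x <= j]%N])); last first.
    by move=> x; rewrite inE.
  rewrite [leRHS](eq_bigl (fun x : 'I_j.+1 => x \in [set: 'I_j.+1])); last by move=> x; rewrite inE.
  apply: (@ler_sum_inj _ _ _ _ _ (fun x : 'I_n.+1 => inord (n - a * x) : 'I_j.+1)) => //.
  - move=> x y; rewrite !inE => /and3P[ax _ xj] /and3P[ay _ yj] /(congr1 val) /=.
    rewrite !inordK ?ltnS// => E; apply: val_inj; apply/eqP.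
    have : (a * x = a * y)%N by lia.
    by move/eqP; rewrite eqn_pmul2l.
  - by move=> x; rewrite inE => /and3P[_ _ xj]; rewrite inordK.
apply: (le_trans (ler_wpM2l _ (le_trans h (HK j n jn)))).
  by rewrite mulr_ge0 ?expR_ge0// ltW.
by rewrite le_eqVlt; apply/orP; left; apply/eqP; ring.
Qed.

Lemma conv_bound (sg bt : R) a v w : RV sg v -> RV bt w -> -1 < sg -> -1 < bt -> (0 < a)%N ->
  exists2 K : R, 0 < K & forall n,
    dilated_conv a (fun x => expR (v x)) (fun x => expR (w x)) n <= K * (n.+1%:R * expR (v n) * expR (w n)).
Proof.
move=> Hv Hw s1 b1 a0.
have [s [K [s0 K0 HK]]] := conv_head Hv Hw s1 b1 a0.
have [s' [K' [s'0 K'0 HK']]] := conv_tail Hv Hw s1 b1 a0.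
exists (K + K'); first exact: addr_gt0.
move=> n; rewrite /dilated_conv (bigID (fun x : 'I_n.+1 => 2 * a * x <= n)%N)/= mulrDl; apply: lerD.
  pose k := (n %/ (2 * a))%N.
  have kn : (2 * a * k <= n)%N by rewrite mulnC leq_trunc_div.
  have kn' : (k <= n)%N by exact: leq_div.
  apply: (@le_trans _ _ (\sum_(x < k.+1) expR (v x) * expR (w (n - a * x)%N))).
    rewrite (big_ord_widen n.+1 (fun x => expR (v x) * expR (w (n - a * x)%N)))//.
    rewrite [leLHS]big_mkcond [leRHS]big_mkcond/=; apply: ler_sum => x _.
    case: ifPn => [/andP[_ xn]|_]; last by case: ifP => // _; rewrite mulr_ge0 ?expR_ge0.
    by rewrite ltnS leq_divRL ?muln_gt0// [(x * _)%N]mulnC xn.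
  apply: (le_trans (HK n k kn)).
  rewrite ler_piMr ?mulr_ge0 ?expR_ge0 ?(ltW K0)// expR_le1.
  by rewrite pmulr_rle0// subr_le0 lns_le.
apply: (@le_trans _ _ (\sum_(x < n.+1 | [&& a * x <= n, n <= 2 * a * x & n - a * x <= n]%N)
        expR (v x) * expR (w (n - a * x)%N))).
  rewrite [leLHS]big_mkcond [leRHS]big_mkcond/=; apply: ler_sum => x _.
  case: ifPn => [/andP[-> xn]|_]; last by case: ifP => // _; rewrite mulr_ge0 ?expR_ge0.
  by rewrite leq_subr andbT ltnW // ltnNge.
by apply: (le_trans (HK' n n (leqnn _))); rewrite subrr mulr0 expR0 mulr1.
Qed.

Definition grid (n x : nat) : R := x.+1%:R / n.+1%:R.
(** The Beta-type profile z^sg (1 - a z)^bt of the summands at z = x/n. *)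
Definition phi (sg bt : R) a (z : R) : R := expR (sg * ln z + bt * ln (1 - a%:R * z)).

(* Captures L s e = \int_s^e phi, so that the Lebesgue integral and, for sg = 0,
   the explicit antiderivative giving the exact constant are handled at once. *)
Record antider (sg bt : R) a (L : R -> R -> R) : Prop := Antider {
  antiderD : forall s t e : R, 0 < s -> s <= t -> t <= e -> e < a%:R^-1 -> L s e = L s t + L t e;
  antider_bnd : forall s e m M : R, 0 < s -> s <= e -> e < a%:R^-1 ->
    (forall z, s <= z <= e -> m <= phi sg bt a z <= M) ->
    m * (e - s) <= L s e <= M * (e - s) }.

Lemma phi_bounded (sg bt : R) a (s e : R) : 0 < s -> s <= e -> e < a%:R^-1 ->
  exists M : R, forall z : R, s <= z <= e -> expR (- M) <= phi sg bt a z <= expR M.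
Proof.
move=> s0 se ea.
have h1 (z : R) : s <= z <= e -> `|ln z - ln s| <= (e - s) / s.
  move=> /andP[sz ze]; apply: (le_trans (ln_dist_le s0 sz (lexx _))).
  rewrite ler_wpM2r ?invr_ge0 ?(ltW s0)// ger0_norm ?subr_ge0//; lra.
have a0 : 0 < a%:R :> R by move: (lt_trans (lt_le_trans s0 se) ea); rewrite invr_gt0.
have e1 : 0 < 1 - a%:R * e.
  by move: ea; rewrite -[a%:R^-1]mul1r ltr_pdivlMr// mulrC => ?; lra.
have h2 (z : R) : s <= z <= e -> `|ln (1 - a%:R * z) - ln (1 - a%:R * e)| <= (a%:R * (e - s)) / (1 - a%:R * e).
  move=> /andP[sz ze].
  have az : a%:R * z <= a%:R * e by rewrite ler_wpM2l// ltW.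
  apply: (le_trans (ln_dist_le e1 _ (lexx _))); first lra.
  rewrite ler_wpM2r ?invr_ge0 ?(ltW e1)//.
  have -> : 1 - a%:R * z - (1 - a%:R * e) = a%:R * (e - z) by ring.
  by rewrite ger0_norm ?mulr_ge0 ?subr_ge0 ?(ltW a0)// ler_wpM2l ?(ltW a0)//; lra.
pose M := `|sg| * ((e - s) / s + `|ln s|) + `|bt| * ((a%:R * (e - s)) / (1 - a%:R * e) + `|ln (1 - a%:R * e)|).
exists M => z zI; rewrite !ler_expR -ler_norml; apply: (le_trans (ler_normD _ _)); apply: lerD.
  rewrite normrM ler_wpM2l//.
  have := h1 z zI; have := ler_normD (ln z - ln s) (ln s); rewrite subrK; lra.
rewrite normrM ler_wpM2l//.
have := h2 z zI; have := ler_normD (ln (1 - a%:R * z) - ln (1 - a%:R * e)) (ln (1 - a%:R * e)); rewrite subrK; lra.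
Qed.

Lemma antider_ge (sg bt : R) a L (s e : R) : antider sg bt a L -> 0 < s -> s <= e -> e < a%:R^-1 ->
  exists2 m : R, 0 < m & m * (e - s) <= L s e.
Proof.
move=> HL s0 se ea; have [M HM] := phi_bounded sg bt s0 se ea.
exists (expR (- M)); first exact: expR_gt0.
by have /andP[] := antider_bnd HL s0 se ea HM.
Qed.

Lemma antider_ge0 (sg bt : R) a L (s e : R) : antider sg bt a L -> 0 < s -> s <= e -> e < a%:R^-1 ->
  0 <= L s e.
Proof.
move=> HL s0 se ea; have [m m0] := antider_ge HL s0 se ea; apply: le_trans.
by rewrite mulr_ge0 ?subr_ge0// ltW.
Qed.

Lemma antider_mono (sg bt : R) a L (s s' e e' : R) : antider sg bt a L ->
  0 < s' -> s' <= s -> s <= e -> e <= e' -> e' < a%:R^-1 -> L s e <= L s' e'.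
Proof.
move=> HL s'0 ss se ee ea.
have s0 : 0 < s by exact: lt_le_trans ss.
rewrite (antiderD HL s'0 ss (le_trans se ee) ea) (antiderD HL s0 se ee ea).
have h1 : 0 <= L s' s by apply: (antider_ge0 HL) => //; lra.
have h2 : 0 <= L e e' by apply: (antider_ge0 HL) => //; lra.
lra.
Qed.

Lemma antider_diag (sg bt : R) a L (s : R) : antider sg bt a L -> 0 < s -> s < a%:R^-1 -> L s s = 0.
Proof.
move=> HL s0 sa; have := antiderD HL s0 (lexx s) (lexx s) sa; lra.
Qed.

(** The profile varies little over [q] neighbouring grid points, so each normalised summand is
    within a factor exp(eps) of the block mean [D]. Using means instead of point values makes the
    blocks add up exactly to [L]. *)
Lemma riemann_block_est (sg bt : R) a v w L (q : nat) (eta eps : R) :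
  RV sg v -> RV bt w -> (0 < a)%N -> (0 < q)%N -> antider sg bt a L -> 0 < eta -> 0 < eps ->
  exists N, forall n y x, (N <= n)%N -> (y <= x < y + q)%N ->
    eta <= grid n y -> grid n (y + q) <= a%:R^-1 - eta ->
    let D := n.+1%:R / q%:R * L (grid n y) (grid n (y + q)) in
    [/\ (a * x <= n)%N, eta * n.+1%:R <= (n - a * x).+1%:R,
     expR (- eps) * D <= expR (v x - v n + (w (n - a * x)%N - w n)) &
     expR (v x - v n + (w (n - a * x)%N - w n)) <= expR eps * D].
Proof.
move=> Hv Hw a0 q0 HL eta0 eps0.
have e40 : 0 < eps / 4 by rewrite divr_gt0.
have [N1 H1] := Hv eta _ eta0 e40; have [N2 H2] := Hw eta _ eta0 e40.
pose C := `|sg| * q%:R / eta + `|bt| * (a%:R * (q.+1)%:R) / eta.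
have [N3 H3] := nat_ge (C / (eps / 2)).
exists (maxn N1 (maxn N2 N3)) => n y x; rewrite !geq_max => /and3P[n1 n2 n3] /andP[yx xq] ey ye D.
have aR : 0 < a%:R :> R by rewrite ltr0n.
have aR1 : 1 <= a%:R :> R by rewrite ler1n.
have nR : 0 < n.+1%:R :> R by rewrite ltr0n.
have zyx : grid n y <= grid n x by rewrite ler_wpM2r ?invr_ge0 ?(ltW nR)// ler_nat.
have zxq : grid n x <= grid n (y + q) by rewrite ler_wpM2r ?invr_ge0 ?(ltW nR)// ler_nat ltnW.
have azx : a%:R * grid n x <= 1 - a%:R * eta.
  have := le_trans zxq ye; rewrite -(ler_pM2l aR) mulrBr mulfV ?lt0r_neq0//.
have aeta : eta <= a%:R * eta by rewrite ler_peMl// ltW.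
have axn1 : a%:R * x.+1%:R <= n.+1%:R - a%:R * eta * n.+1%:R.
  by move: azx; rewrite /grid mulrA ler_pdivrMr// mulrBl mul1r.
have axn : (a * x <= n)%N.
  rewrite -ltnS -(ltr_nat R) natrM; apply: (@lt_le_trans _ _ (a%:R * x.+1%:R)); first by rewrite ltr_pM2l// ltr_nat.
  by apply: (le_trans axn1); rewrite lerBlDr lerDl !mulr_ge0// ltW.
have nax : (n - a * x).+1%:R = n.+1%:R - a%:R * x%:R :> R by rewrite -subSn// natrB ?natrM// leqW.
have naxe : eta * n.+1%:R <= (n - a * x).+1%:R.
  rewrite nax; move: axn1; rewrite -[x.+1%:R]natr1 mulrDr mulr1 => ?.
  have : eta * n.+1%:R <= a%:R * eta * n.+1%:R by rewrite ler_wpM2r// ltW.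
  lra.
(* The shifts by one leave (n - a x + 1)/(n + 1) off from 1 - a z by a/(n + 1), z being the grid
   point; hence the q + 1 in [C]. *)
pose t := 1 - a%:R * grid n x + a%:R / n.+1%:R.
have tE : lns R (n - a * x) - lns R n = ln t.
  rewrite /lns -ln_div ?posrE//; congr ln; rewrite nax /t /grid -[x.+1%:R]natr1.
  by move: nR; set m := n.+1%:R => m0; field; exact: lt0r_neq0.
have zE : lns R x - lns R n = ln (grid n x) by rewrite /lns -ln_div ?posrE.
have xn : (x <= n)%N by rewrite (leq_trans _ axn)// leq_pmull.
have xe : eta * n.+1%:R <= x.+1%:R by rewrite -ler_pdivlMr//; exact: le_trans zyx.
have hv := H1 n x n1 xn xe; rewrite zE in hv.
have hw := H2 n (n - a * x)%N n2 (leq_subr _ _) naxe; rewrite tE in hw.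
have Cn : C / n.+1%:R <= eps / 2.
  rewrite ler_pdivrMr// mulrC -ler_pdivrMr ?divr_gt0//; apply: (le_trans (H3 n n3)).
  by rewrite ler_nat.
set psi := v x - v n + (w (n - a * x)%N - w n).
have key (z : R) : grid n y <= z <= grid n (y + q) -> `|sg * ln z + bt * ln (1 - a%:R * z) - psi| <= eps.
  move=> /andP[yz zq].
  have zqy : grid n (y + q) - grid n y = q%:R / n.+1%:R.
    by rewrite /grid -mulrBl -natrB ?ltnS ?leq_addr// subSS addKn.
  have dz : `|z - grid n x| <= q%:R / n.+1%:R by rewrite -zqy ler_norml; apply/andP; split; lra.
  have d1 : `|ln z - ln (grid n x)| <= q%:R / n.+1%:R / eta.
    apply: (le_trans (ln_dist_le eta0 _ _)); [exact: le_trans yz|exact: le_trans zyx|].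
    by rewrite ler_wpM2r ?invr_ge0// ltW.
  have d2 : `|ln (1 - a%:R * z) - ln t| <= a%:R * q.+1%:R / n.+1%:R / eta.
    have az : a%:R * z <= 1 - a%:R * eta.
      have := le_trans zq ye; rewrite -(ler_pM2l aR) mulrBr mulfV ?lt0r_neq0//.
    have an0 : 0 <= a%:R / n.+1%:R :> R by rewrite divr_ge0// ltW.
    apply: (le_trans (ln_dist_le eta0 _ _)); [lra|rewrite /t -[eta]addr0 lerD//; lra|].
    rewrite ler_wpM2r ?invr_ge0 ?(ltW eta0)//.
    have -> : 1 - a%:R * z - t = - (a%:R * (z - grid n x) + a%:R / n.+1%:R) by rewrite /t; ring.
    rewrite normrN; apply: (le_trans (ler_normD _ _)).
    rewrite normrM (ger0_norm (ltW aR)) (ger0_norm an0) -[q.+1%:R]natr1 mulrDr mulr1 mulrDl.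
    by rewrite lerD2r -mulrA ler_wpM2l// ltW.
  have m1 : `|sg * ln z - sg * ln (grid n x)| <= `|sg| * q%:R / eta / n.+1%:R.
    rewrite -mulrBr normrM -!mulrA ler_wpM2l//; apply: (le_trans d1).
    by rewrite -mulrA (mulrC n.+1%:R^-1).
  have m2 : `|bt * ln (1 - a%:R * z) - bt * ln t| <= `|bt| * (a%:R * (q.+1)%:R) / eta / n.+1%:R.
    rewrite -mulrBr normrM -!mulrA ler_wpM2l//; apply: (le_trans d2).
    by rewrite -!mulrA (mulrC n.+1%:R^-1).
  have : `|sg| * q%:R / eta / n.+1%:R + `|bt| * (a%:R * (q.+1)%:R) / eta / n.+1%:R <= eps / 2.
    by rewrite -mulrDl.
  clear - hv hw m1 m2; move: hv hw m1 m2; rewrite /psi !ler_norml.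
  move: (sg * ln z) (sg * ln (grid n x)) (bt * ln (1 - a%:R * z)) (bt * ln t)
    (`|sg| * q%:R / eta / n.+1%:R) (`|bt| * (a%:R * q.+1%:R) / eta / n.+1%:R) => A1 A2 A3 A4 A5 A6.
  move=> /andP[? ?] /andP[? ?] /andP[? ?] /andP[? ?] ?.
  apply/andP; split; lra.
have yqa : grid n (y + q) < a%:R^-1 by lra.
have y0 : 0 < grid n y by exact: lt_le_trans ey.
have key2 (z : R) : grid n y <= z <= grid n (y + q) -> expR (psi - eps) <= phi sg bt a z <= expR (psi + eps).
  move=> zI; have := key z zI; rewrite /phi !ler_expR ler_norml => /andP[? ?]; apply/andP; split; lra.
have /andP[b1 b2] := antider_bnd HL y0 (le_trans zyx zxq) yqa key2.
have qR : 0 < q%:R :> R by rewrite ltr0n.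
have qn : 0 < q%:R / n.+1%:R :> R by rewrite divr_gt0// ltr0n.
have zqy : grid n (y + q) - grid n y = q%:R / n.+1%:R.
  by rewrite /grid -mulrBl -natrB ?ltnS ?leq_addr// subSS addKn.
rewrite zqy in b1 b2.
have DE : L (grid n y) (grid n (y + q)) = D * (q%:R / n.+1%:R).
  rewrite /D; move: nR qR; set m := n.+1%:R; set r := q%:R => m0 r0.
  by field; rewrite !lt0r_neq0.
rewrite DE ler_pM2r// in b1; rewrite DE ler_pM2r// in b2.
split => //.
- by rewrite -(ler_pM2l (expR_gt0 eps)) mulrA -expRD subrr expR0 mul1r -expRD addrC.
- by move: b1; rewrite expRD -(ler_pM2l (expR_gt0 eps)) mulrCA -expRD subrr expR0 mulr1.
Qed.


(** Blocks have length g / gcd(a, g), so each contains exactly one x with g dividing n - a x if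
    gcd(a, g) divides n, and none otherwise. The periodic factor of [u] is thus replaced by its
    average. Induction on the number [J] of blocks. *)
Lemma riemann_sum_est (sg bt : R) a v w L (g : nat) (c : R) (u : nat -> R) (eta eps : R) :
  RV sg v -> RV bt w -> (0 < a)%N -> (0 < g)%N -> antider sg bt a L -> 0 <= c ->
  tends0 (fun m => u m / expR (w m) - c * (g %| m)%N%:R) -> 0 < eta -> 0 < eps ->
  exists N, forall n X J, (N <= n)%N -> eta <= grid n X ->
    grid n (X + g %/ gcdn a g * J) <= a%:R^-1 - eta ->
    `|\sum_(X <= x < X + g %/ gcdn a g * J) expR (v x) * u (n - a * x)%N / (expR (v n) * expR (w n))
      - n.+1%:R * ((gcdn a g %| n)%N%:R * c / (g %/ gcdn a g)%:R) * L (grid n X) (grid n (X + g %/ gcdn a g * J))|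
    <= eps * n.+1%:R * L (grid n X) (grid n (X + g %/ gcdn a g * J)).
Proof.
move=> Hv Hw a0 g0 HL c0 Hu eta0 eps0.
set d := gcdn a g; set q := (g %/ d)%N.
have q0 : (0 < q)%N by rewrite divn_gt0 ?gcdn_gt0 ?a0// dvdn_leq// dvdn_gcdr.
have c10 : 0 < 2 * (1 + c) by lra.
(* Per summand the error is at most 2 e1 D from [u] and 2 c e1 D from the profile, together at most
   eps D. *)
pose e1 := Num.min (2^-1) (eps / (2 * (1 + c))).
have e10 : 0 < e1 by rewrite lt_min invr_gt0 ltr0n divr_gt0.
have e12 : e1 <= 2^-1 by rewrite ge_min lexx.
have e1eps : 2 * (1 + c) * e1 <= eps.
  by rewrite mulrC -ler_pdivlMr// ge_min lexx orbT.
have [N1 H1] := riemann_block_est Hv Hw a0 q0 HL eta0 e10.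
have [N2 H2] := Hu _ e10.
have [N3 H3] := nat_ge (N2.+1%:R / eta).
exists (maxn N1 N3) => n X J; rewrite geq_max => /andP[n1 n3] eX.
have nR : 0 < n.+1%:R :> R by rewrite ltr0n.
have qR : 0 < q%:R :> R by rewrite ltr0n.
have zmono x y : (x <= y)%N -> grid n x <= grid n y.
  by move=> xy; rewrite ler_wpM2r ?invr_ge0 ?(ltW nR)// ler_nat.
have ex1 : expR e1 <= 1 + 2 * e1.
  have := expR_ge1Dx (- e1); rewrite expRN => h.
  have h1 : 0 < 1 - e1 by lra.
  have : expR e1 <= (1 - e1)^-1.
    by rewrite -[leLHS]invrK lef_pV2 ?posrE ?invr_gt0 ?expR_gt0.
  move/le_trans; apply; rewrite -[leLHS]mul1r ler_pdivrMr//.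
  have : 0 <= e1 * (1 - 2 * e1) by rewrite mulr_ge0 ?(ltW e10)//; lra.
  lra.
have ex2 : 1 - e1 <= expR (- e1) by have := expR_ge1Dx (- e1).
elim: J => [|J IH].
  move=> Xe; rewrite muln0 addn0 in Xe *.
  rewrite big_geq// (antider_diag HL) ?mulr0 ?subrr ?normr0//; first exact: lt_le_trans eX.
  by lra.
rewrite mulnSr addnA; set Y := (X + q * J)%N => Ye.
have XY : (X <= Y)%N by rewrite leq_addr.
have YY : (Y <= Y + q)%N by rewrite leq_addr.
have eY : eta <= grid n Y by apply: (le_trans eX); exact: zmono.
have {}IH := IH (le_trans (zmono _ _ YY) Ye).
have X0 : 0 < grid n X by exact: lt_le_trans eX.
have Yea : grid n (Y + q) < a%:R^-1 by lra.
rewrite (antiderD HL X0 (zmono _ _ XY) (zmono _ _ YY) Yea).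
rewrite (big_cat_nat _ (n := Y))//=.
pose D := n.+1%:R / q%:R * L (grid n Y) (grid n (Y + q)).
have LD : L (grid n Y) (grid n (Y + q)) = q%:R / n.+1%:R * D.
  rewrite /D; move: nR qR; set m := n.+1%:R; set r := q%:R => m0 r0.
  by field; rewrite !lt0r_neq0.
have D0 : 0 <= D.
  rewrite mulr_ge0 ?divr_ge0 ?(ltW nR) ?(ltW qR)// (antider_ge0 HL) ?zmono//.
  exact: lt_le_trans eY.
pose chi := (d %| n)%N%:R : R.
have block : `|\sum_(Y <= x < Y + q) expR (v x) * u (n - a * x)%N / (expR (v n) * expR (w n)) - chi * c * D|
    <= q%:R * (eps * D).
  have -> : chi * c * D = \sum_(Y <= x < Y + q) (g %| n - a * x)%N%:R * (c * D).
    rewrite -mulr_suml -natr_sum count_dvd_window ?mulrA//.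
    have Yq0 : (Y + q - 1 < Y + q)%N by rewrite ltn_subrL addn_gt0 q0 orbT.
    have Yqi : (Y <= Y + q - 1 < Y + q)%N by rewrite Yq0 andbT -addnBA// leq_addr.
    have [h _ _ _] := H1 n Y (Y + q - 1)%N n1 Yqi eY Ye.
    by rewrite -(leq_sub2rE (p := a)) ?leq_addl// addnK; rewrite mulnBr muln1 in h.
  rewrite -sumrB; apply: (le_trans (ler_norm_sum _ _ _)).
  apply: (@le_trans _ _ (\sum_(Y <= x < Y + q) eps * D)); last first.
    by rewrite sumr_const_nat addKn mulr_natl.
  rewrite big_nat_cond [leRHS]big_nat_cond; apply: ler_sum => x /andP[xY _].
  have [ax nax b1 b2] := H1 n Y x n1 xY eY Ye; rewrite -/D in b1 b2.
  set psi := expR (v x - v n + (w (n - a * x)%N - w n)) in b1 b2.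
  set r := u (n - a * x)%N / expR (w (n - a * x)%N).
  have -> : expR (v x) * u (n - a * x)%N / (expR (v n) * expR (w n)) = psi * r.
    rewrite /psi /r expRD !expRB.
    have := expR_gt0 (v n); have := expR_gt0 (w n); have := expR_gt0 (w (n - a * x)%N).
    move: (expR _) (expR (w n)) (expR (v n)) => A B E A0 B0 E0.
    by field; rewrite !lt0r_neq0.
  have hr : `|r - c * (g %| n - a * x)%N%:R| <= e1.
    apply: H2; rewrite -ltnS -(ltr_nat R); apply: lt_le_trans nax.
    have := H3 n n3; rewrite ler_pdivrMr// => h; apply: (lt_le_trans (y := N2.+1%:R)); first by rewrite ltr_nat.
    by apply: (le_trans h); rewrite mulrC ler_wpM2l ?ler_nat// ltW.
  have psi0 : 0 <= psi by exact: expR_ge0.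
  set b := (g %| n - a * x)%N%:R : R in hr *.
  have b01 : 0 <= b <= 1 by rewrite /b; case: (_ %| _)%N; rewrite ?lexx ?ler01.
  have -> : psi * r - b * (c * D) = psi * (r - c * b) + c * b * (psi - D) by ring.
  apply: (le_trans (ler_normD _ _)); rewrite !normrM (ger0_norm psi0) (ger0_norm c0).
  have hpsi : psi <= 2 * D.
    apply: (le_trans b2); rewrite ler_wpM2r//; lra.
  have hd : `|psi - D| <= 2 * e1 * D.
    have := ler_wpM2r D0 ex1; have := ler_wpM2r D0 ex2.
    have : 0 <= e1 * D by rewrite mulr_ge0// ltW.
    rewrite ler_norml => h1 h2 h3; apply/andP; split.
      have : (1 - e1) * D <= psi by exact: le_trans b1.
      lra.
    have : psi <= (1 + 2 * e1) * D by exact: le_trans h3.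
    lra.
  have t1 : psi * `|r - c * b| <= 2 * D * e1 by rewrite ler_pM.
  have t2 : c * `|b| * `|psi - D| <= c * (2 * e1 * D).
    have /andP[b0 b1'] := b01; rewrite (ger0_norm b0) -mulrA ler_wpM2l//.
    by apply: le_trans hd; rewrite ler_piMl.
  have : 2 * (1 + c) * e1 * D <= eps * D by rewrite ler_wpM2r.
  lra.
set S1 := \sum_(X <= x < Y) _ in IH *; set S2 := \sum_(Y <= x < Y + q) _ in block *.
set L1 := L (grid n X) (grid n Y) in IH *; set L2 := L (grid n Y) (grid n (Y + q)) in LD *.
have E : n.+1%:R * (chi * c / q%:R) * L2 = chi * c * D.
  rewrite LD; move: nR qR; set m := n.+1%:R; set r := q%:R => m0 r0.
  by field; rewrite !lt0r_neq0.
have E2 : eps * n.+1%:R * L2 = q%:R * (eps * D).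
  rewrite LD; move: nR qR; set m := n.+1%:R; set r := q%:R => m0 r0.
  by field; rewrite !lt0r_neq0.
rewrite !mulrDr E E2.
rewrite [X in `|X|](_ : _ = (S1 - n.+1%:R * (chi * c / q%:R) * L1) + (S2 - chi * c * D)); last by rewrite /chi; ring.
by apply: (le_trans (ler_normD _ _)); apply: lerD.
Qed.

Lemma pick_grid (q : nat) (eta E d : R) : (0 < q)%N -> 0 < eta -> eta < E -> 0 < d ->
  exists N, forall n, (N <= n)%N -> exists X J, [/\ X%:R <= eta * n.+1%:R,
    eta <= grid n X <= eta + d & E - d <= grid n (X + q * J) <= E].
Proof.
move=> q0 eta0 eE d0.
have qR : 0 < q%:R :> R by rewrite ltr0n.
have [N1 H1] := nat_ge (q%:R / d).
have [N2 H2] := nat_ge (1 / (E - eta)).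
exists (maxn N1 N2) => n; rewrite geq_max => /andP[n1 n2].
have nR : 0 < n.+1%:R :> R by rewrite ltr0n.
have h1 : q%:R <= d * n.+1%:R.
  have := H1 n n1; rewrite ler_pdivrMr// => h; apply: (le_trans h).
  by rewrite mulrC ler_wpM2l ?(ltW d0)// ler_nat.
have h2 : 1 <= (E - eta) * n.+1%:R.
  have Ee : 0 < E - eta by lra.
  have := H2 n n2; rewrite ler_pdivrMr// => h; apply: (le_trans h).
  by rewrite mulrC ler_wpM2l ?(ltW Ee)// ler_nat.
have en0 : 0 <= eta * n.+1%:R by rewrite mulr_ge0// ltW.
pose X := Num.truncn (eta * n.+1%:R).
have /andP[X1 X2] := truncn_itv en0; rewrite -/X in X1 X2.
pose t := (E * n.+1%:R - 1 - X%:R) / q%:R.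
have t0 : 0 <= t by rewrite divr_ge0 ?(ltW qR)//; move: h2; rewrite mulrBl; lra.
pose J := Num.truncn t.
have /andP[J1 J2] := truncn_itv t0; rewrite -/J in J1 J2.
rewrite ler_pdivlMr// in J1; rewrite ltr_pdivrMr// -[J.+1%:R]natr1 in J2.
rewrite -[X.+1%:R]natr1 in X2.
have q1 : 1 <= q%:R :> R by rewrite ler1n.
have zE x : grid n x = x.+1%:R / n.+1%:R by [].
exists X, J; split => //.
  rewrite /grid ler_pdivlMr// ler_pdivrMr// -[X.+1%:R]natr1 mulrDl; apply/andP; split; lra.
rewrite /grid ler_pdivlMr// ler_pdivrMr// -[(X + q * J).+1%:R]natr1 natrD natrM mulrBl; apply/andP; split; lra.
Qed.

(** Encodes that [I] is the improper integral over (0, 1/a), where the profile may blow up at either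
    end. *)
Definition total_mass a (L : R -> R -> R) (I : R) :=
  (forall s e : R, 0 < s -> s <= e -> e < a%:R^-1 -> L s e <= I) /\
  (forall eps : R, 0 < eps -> exists2 eta : R, 0 < eta & forall s e : R, 0 < s -> s <= eta ->
    a%:R^-1 - eta <= e -> e < a%:R^-1 -> I - eps <= L s e).

(** Convergence of the Beta integral is read off from the discrete side: for pure powers
    [conv_bound] bounds every Riemann sum, hence [L] on compact intervals, and the supremum is the
    total mass. *)
Lemma antider_total (sg bt : R) a L : -1 < sg -> -1 < bt -> (0 < a)%N -> antider sg bt a L ->
  exists2 I : R, 0 < I & total_mass a L I.
Proof.
move=> s1 b1 a0 HL.
have aR : 0 < a%:R :> R by rewrite ltr0n.
have aV : 0 < a%:R^-1 :> R by rewrite invr_gt0.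
pose v n := sg * lns R n; pose w n := bt * lns R n.
have Hv : RV sg v by have := RVZ sg (@RV_lns R); rewrite mulr1.
have Hw : RV bt w by have := RVZ bt (@RV_lns R); rewrite mulr1.
have [K K0 HK] := conv_bound Hv Hw s1 b1 a0.
(* The factor 2 pays for a relative error 1/2 in the Riemann sum. *)
have bnd s e : 0 < s -> s <= e -> e < a%:R^-1 -> L s e <= 2 * K.
  move=> s0 se ea.
  pose eta := Num.min (s / 2) ((a%:R^-1 - e) / 2).
  have eta0 : 0 < eta by rewrite lt_min !divr_gt0// subr_gt0.
  have etas : eta <= s / 2 by rewrite ge_min lexx.
  have etae : eta <= (a%:R^-1 - e) / 2 by rewrite ge_min lexx orbT.
  have h0 : (0 : R) < 2^-1 by rewrite invr_gt0.
  have Hu : tends0 (fun m => expR (w m) / expR (w m) - 1 * (1 %| m)%N%:R).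
    move=> e' e'0; exists 0%N => n _; rewrite dvd1n mulr1 mulfV ?subrr ?normr0 ?(ltW e'0)//.
    by rewrite lt0r_neq0// expR_gt0.
  have [N1 H1] := riemann_sum_est Hv Hw a0 (ltn0Sn 0) HL ler01 Hu eta0 h0.
  have [N2 H2] := @pick_grid 1 eta (a%:R^-1 - eta) eta isT eta0 (ltac:(lra)) eta0.
  pose n := maxn N1 N2.
  have [X [J [_ /andP[x1 x2] /andP[y1 y2]]]] := H2 n (leq_maxr _ _).
  have g1 : (1 %/ gcdn a 1 = 1)%N by rewrite gcdn1 divn1.
  have := H1 n X J (leq_maxl _ _) x1; rewrite g1 => /(_ y2); rewrite gcdn1 dvd1n mul1r divr1 mulr1.
  have nR : 0 < n.+1%:R :> R by rewrite ltr0n.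
  set L' := L _ _; set S := \sum_(_ <= _ < _) _ => hS.
  have LL : L s e <= L' by apply: (antider_mono HL); lra.
  have SK : S <= K * n.+1%:R.
    have ev0 : 0 < expR (v n) * expR (w n) by rewrite mulr_gt0// expR_gt0.
    rewrite /S -mulr_suml ler_pdivrMr//.
    have := HK n; rewrite mulrA mulrA -mulrA; apply: le_trans.
    rewrite /dilated_conv -(big_mkord (fun x => a * x <= n)%N (fun x => expR (v x) * expR (w (n - a * x)%N))).
    have XJn : (X + 1 * J <= n.+1)%N.
      move: y2; rewrite /grid ler_pdivrMr// => h; apply: ltnW; rewrite -(ler_nat R).
      apply: (le_trans h); rewrite ler_piMl// ?(ltW nR)//.
      have : a%:R^-1 <= 1 :> R by rewrite invf_le1// ler1n.
      lra.
    rewrite [leRHS](big_cat_nat _ (n := X))//=; last by apply: leq_trans XJn; rewrite leq_addr.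
    rewrite [Z in _ <= _ + Z](big_cat_nat _ (n := (X + 1 * J)%N))//=; last by rewrite leq_addr.
    have p0 m M : 0 <= \sum_(m <= i < M | (a * i <= n)%N) expR (v i) * expR (w (n - a * i)%N).
      by apply: sumr_ge0 => ? _; rewrite mulr_ge0 ?expR_ge0.
    rewrite -[leLHS]add0r lerD//.
    rewrite -[leLHS]addr0 lerD//.
    rewrite [leLHS]big_nat_cond [leRHS]big_nat_cond le_eqVlt; apply/orP; left; apply/eqP.
    apply: eq_bigl => x; rewrite andbT; case: (boolP (X <= x < _)%N) => //= /andP[Xx xJ].
    rewrite -ltnS -(ltr_nat R) natrM.
    have zx : grid n x <= a%:R^-1 - eta.
      by apply: le_trans y2; rewrite ler_wpM2r ?invr_ge0 ?(ltW nR)// ler_nat ltnW.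
    move: zx; rewrite /grid ler_pdivrMr// -(ler_pM2l aR) mulrA mulrBr mulfV ?lt0r_neq0// -natr1 mulrBl mul1r.
    have : 0 < a%:R * eta * n.+1%:R by rewrite !mulr_gt0.
    rewrite mulrDr mulr1; lra.
  have L'0 : 0 <= L' by apply: (antider_ge0 HL); lra.
  move: hS; rewrite ler_norml => /andP[hS _].
  have : n.+1%:R * L' <= n.+1%:R * (2 * K) by lra.
  by rewrite ler_pM2l// => /(le_trans LL).
pose S : set R := [set r : R | exists s e : R, [/\ 0 < s, s <= e, e < a%:R^-1 & r = L s e]]%classic.
have hsup : has_sup S.
  split; last by exists (2 * K) => _ [s [e [s0 se ea ->]]]; exact: bnd.
  exists (L (a%:R^-1 / 2) (a%:R^-1 / 2)), (a%:R^-1 / 2), (a%:R^-1 / 2); split => //; lra.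
have ubS s e : 0 < s -> s <= e -> e < a%:R^-1 -> L s e <= sup S.
  by move=> s0 se ea; apply: ub_le_sup; [case: hsup|exists s, e].
exists (sup S).
  have s0 : 0 < a%:R^-1 / 4 :> R by lra.
  have [m m0 hm] := antider_ge HL s0 (e := a%:R^-1 / 2) (ltac:(lra)) (ltac:(lra)).
  apply: lt_le_trans (ubS _ (a%:R^-1 / 2) s0 (ltac:(lra)) (ltac:(lra))).
  by apply: lt_le_trans hm; rewrite mulr_gt0//; lra.
split => // eps eps0.
have [_ [s [e [s0 se ea ->]]] hL] := sup_adherent eps0 hsup.
exists (Num.min s (a%:R^-1 - e)); first by rewrite lt_min s0 subr_gt0.
move=> s' e' s'0; rewrite le_min => /andP[ss' s'e] h e'a.
have mle : Num.min s (a%:R^-1 - e) <= a%:R^-1 - e by rewrite ge_min lexx orbT.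
apply: ltW; apply: (lt_le_trans hL); apply: (antider_mono HL) => //; lra.
Qed.

End convolution.

Local Open Scope classical_set_scope.

Section convolution_asymptotics.
Variable R : realType.
Implicit Types (v w : nat -> R) (a : nat).

Lemma small_exp (s K e : R) : 0 < s -> 0 < K -> 0 < e ->
  exists2 x0 : R, 0 < x0 & forall x : R, 0 < x -> x <= x0 -> K * expR (s * ln x) <= e.
Proof.
move=> s0 K0 e0; exists (expR (ln (e / K) / s)); first exact: expR_gt0.
move=> x x0 xx; rewrite mulrC -ler_pdivlMr//.
have eK : 0 < e / K by rewrite divr_gt0.
rewrite -[leRHS]lnK ?posrE// ler_expR mulrC -ler_pdivlMr//.
by rewrite -[leRHS]expRK ler_ln ?posrE ?expR_gt0.
Qed.

(** The sum is cut near z = eta and z = 1/a - eta: both ends are small by the head and tail bounds,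
    the middle is a Riemann sum. A limit supported on multiples of g becomes one supported on
    multiples of gcd(a, g), divided by the block length. *)
Lemma conv_asymp (sg bt : R) a L I v w (u : nat -> R) (g : nat) (c Ku : R) :
  -1 < sg -> -1 < bt -> (0 < a)%N -> antider sg bt a L -> 0 < I -> total_mass a L I ->
  RV sg v -> RV bt w -> (0 < g)%N -> 0 <= c -> 0 < Ku ->
  (forall m, `|u m| <= Ku * expR (w m)) ->
  tends0 (fun m => u m / expR (w m) - c * (g %| m)%N%:R) ->
  tends0 (fun n => dilated_conv a (fun x => expR (v x)) u n / (n.+1%:R * expR (v n) * expR (w n))
    - c / (g %/ gcdn a g)%:R * I * (gcdn a g %| n)%N%:R).
Proof.
move=> s1 b1 a0 HL I0 [I1 I2] Hv Hw g0 c0 Ku0 uW Hu e e0.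
set d := gcdn a g; set q := (g %/ d)%N.
have q0 : (0 < q)%N by rewrite divn_gt0 ?gcdn_gt0 ?a0// dvdn_leq// dvdn_gcdr.
have qR : 0 < q%:R :> R by rewrite ltr0n.
have q1 : 1 <= q%:R :> R by rewrite ler1n.
have aR : 0 < a%:R :> R by rewrite ltr0n.
have aV : 0 < a%:R^-1 :> R by rewrite invr_gt0.
have e40 : 0 < e / 4 by rewrite divr_gt0.
have [sh [Kh [sh0 Kh0 Hh]]] := conv_head Hv Hw s1 b1 a0.
have [st [Kt [st0 Kt0 Ht]]] := conv_tail Hv Hw s1 b1 a0.
have [xh xh0 Hxh] := small_exp sh0 (mulr_gt0 Ku0 Kh0) e40.
have [xt xt0 Hxt] := small_exp st0 (mulr_gt0 Ku0 Kt0) e40.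
have c10 : 0 < 4 * (c + 1) by lra.
have [eI eI0 HI] := I2 (e / (4 * (c + 1))) (divr_gt0 e0 c10).
have a3 : 0 < 3 * a%:R :> R by lra.
have a8 : 0 < 8 * a%:R :> R by lra.
(* The head has relative size at most eta and the tail at most 3 a eta, which must fall below [xh]
   and [xt]; the grid ends, within 2 eta of 0 and 1/a, must lose little of [I]; and 8 a eta <= 1
   keeps the head below n/(2a) and the tail above it. *)
pose eta := Num.min (Num.min xh (xt / (3 * a%:R))) (Num.min (eI / 2) ((8 * a%:R)^-1)).
have eta0 : 0 < eta by rewrite !lt_min xh0 !divr_gt0 ?invr_gt0.
have etah : eta <= xh by rewrite !ge_min lexx.
have etat : eta * (3 * a%:R) <= xt by rewrite -ler_pdivlMr// !ge_min lexx !orbT.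
have etaI : eta * 2 <= eI by rewrite -ler_pdivlMr// !ge_min lexx !orbT.
have eta8 : eta * (8 * a%:R) <= 1 by rewrite -ler_pdivlMr// div1r !ge_min lexx !orbT.
have aeta0 : 0 < a%:R * eta by rewrite mulr_gt0.
have eta8' : 8 * eta <= a%:R^-1 by rewrite -[leRHS]div1r ler_pdivlMr//; lra.
have I40 : 0 < 4 * (I + 1) by lra.
have [N1 H1] := riemann_sum_est Hv Hw a0 g0 HL c0 Hu eta0 (divr_gt0 e0 I40).
have [N2 H2] := @pick_grid R q eta (a%:R^-1 - eta) eta q0 eta0 (ltac:(lra)) eta0.
have [N3 H3] := nat_ge (4 * a%:R + eta^-1).
exists (maxn N1 (maxn N2 N3)) => n; rewrite !geq_max => /and3P[n1 n2 n3].
have nR : 0 < n.+1%:R :> R by rewrite ltr0n.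
have [X [J [Xe /andP[x1 x2] /andP[y1 y2]]]] := H2 n n2.
have nbig : 4 * a%:R + eta^-1 <= n.+1%:R.
  by apply: (le_trans (H3 n n3)); rewrite ler_nat.
have ei0 : 0 < eta^-1 by rewrite invr_gt0.
have hmid := H1 n X J n1 x1 y2; rewrite -/d -/q in hmid.
set Y := (X + q * J)%N in y1 y2 hmid.
have XY : (X <= Y)%N by rewrite leq_addr.
set V := n.+1%:R * expR (v n) * expR (w n).
have V0 : 0 < V by rewrite !mulr_gt0 ?expR_gt0.
set L' := L _ _ in hmid.
have X0 : 0 < grid R n X by exact: lt_le_trans x1.
have Ya : grid R n Y < a%:R^-1 by lra.
have zXY : grid R n X <= grid R n Y by rewrite ler_wpM2r ?invr_ge0 ?(ltW nR)// ler_nat.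
have L'I : L' <= I by exact: I1.
have L'0 : 0 <= L' by exact: (antider_ge0 HL).
have L'h : I - e / (4 * (c + 1)) <= L'.
  by apply: HI => //; [clear - x2 etaI|clear - y1 etaI]; lra.
have aY1 : a%:R * Y.+1%:R <= (1 - a%:R * eta) * n.+1%:R.
  have h : Y.+1%:R <= (a%:R^-1 - eta) * n.+1%:R by move: y2; rewrite /grid ler_pdivrMr.
  by have := ler_wpM2l (ltW aR) h; rewrite [leRHS]mulrA mulrBr mulfV ?lt0r_neq0.
have aY2 : (1 - 2 * (a%:R * eta)) * n.+1%:R <= a%:R * Y.+1%:R.
  have h : (a%:R^-1 - eta - eta) * n.+1%:R <= Y.+1%:R by move: y1; rewrite /grid ler_pdivlMr.
  apply: le_trans (ler_wpM2l (ltW aR) h).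
  by rewrite [leRHS]mulrA !mulrBr mulfV ?lt0r_neq0// le_eqVlt; apply/orP; left; apply/eqP; ring.
have aYn : (a * Y < n.+1)%N.
  rewrite -(ltr_nat R) natrM; move: aY1; rewrite -[Y.+1%:R]natr1 mulrDr mulr1 mulrBl mul1r.
  have : 0 < a%:R * eta * n.+1%:R by rewrite mulr_gt0.
  clear - aR; lra.
have Yn : (Y <= n)%N by rewrite -ltnS (leq_ltn_trans _ aYn)// leq_pmull.
rewrite /dilated_conv -(big_mkord (fun x => a * x <= n)%N (fun x => expR (v x) * u (n - a * x)%N)).
rewrite (big_cat_nat _ (n := X))//=; last by rewrite (leq_trans XY)// leqW.
rewrite (big_cat_nat _ (n := Y) (m := X))//=; last by rewrite leqW.
set Sh := \sum_(0 <= x < X | _) _; set Sm := \sum_(X <= x < Y | _) _; set St := \sum_(Y <= x < n.+1 | _) _.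
have hh : `|Sh| <= e / 4 * V.
  rewrite /Sh; case: (posnP X) => [->|Xpos]; first by rewrite big_geq// normr0 mulr_ge0 ?ltW.
  have Xk : X = X.-1.+1 by rewrite prednK.
  have kn : (2 * a * X.-1 <= n)%N.
    rewrite -ltnS -(ltr_nat R) !natrM.
    have : (X.-1)%:R <= X%:R :> R by rewrite ler_nat leq_pred.
    have : 2 * a%:R * X%:R <= 2 * a%:R * (eta * n.+1%:R) by rewrite ler_wpM2l// ltW// mulr_gt0.
    have : 2 * a%:R * eta * n.+1%:R < 1 * n.+1%:R by rewrite ltr_pM2r//; clear - eta8 aeta0; lra.
    move=> h1' h2' h3'; have : 2 * a%:R * (X.-1)%:R <= 2 * a%:R * X%:R :> R by rewrite ler_wpM2l// ltW// mulr_gt0.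
    move: h1' h2'; rewrite mul1r !mulrA; clear; lra.
  apply: (le_trans (ler_norm_sum _ _ _)).
  apply: (@le_trans _ _ (Ku * \sum_(x < X.-1.+1) expR (v x) * expR (w (n - a * x)%N))).
    rewrite -Xk -(big_mkord xpredT (fun x => expR (v x) * expR (w (n - a * x)%N))) mulr_sumr.
    rewrite big_mkcond; apply: ler_sum => x _; case: ifP => _; last first.
      by rewrite !mulr_ge0 ?expR_ge0// ltW.
    by rewrite normrM ger0_norm ?expR_ge0// mulrCA ler_wpM2l ?expR_ge0.
  apply: (le_trans (ler_wpM2l (ltW Ku0) (Hh n X.-1 kn))).
  rewrite -/V; set E := expR _; rewrite (_ : Ku * (Kh * V * E) = Ku * Kh * E * V); last ring.
  rewrite ler_wpM2r ?(ltW V0)// /E.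
  apply: le_trans (Hxh (grid R n X.-1) _ _).
  - rewrite ler_wpM2l ?mulr_ge0 ?(ltW Ku0) ?(ltW Kh0)// ler_expR ler_wpM2l ?(ltW sh0)//.
    by rewrite /lns -ln_div ?posrE.
  - by rewrite divr_gt0.
  - by rewrite /grid -Xk ler_pdivrMr// (le_trans Xe)// ler_wpM2r// ltW.
have ht : `|St| <= e / 4 * V.
  apply: (le_trans (ler_norm_sum _ _ _)).
  pose j := (n - a * Y)%N.
  apply: (@le_trans _ _ (Ku * \sum_(x < n.+1 | [&& a * x <= n, n <= 2 * a * x & n - a * x <= j]%N)
        expR (v x) * expR (w (n - a * x)%N))).
    rewrite -(big_mkord (fun x => [&& a * x <= n, n <= 2 * a * x & n - a * x <= j]%N) (fun x => expR (v x) * expR (w (n - a * x)%N))) mulr_sumr.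
    rewrite [leRHS](big_cat_nat _ (n := Y))//=; last by rewrite leqW.
    rewrite -[leLHS]add0r lerD//.
      by apply: sumr_ge0 => x _; rewrite !mulr_ge0 ?expR_ge0// ltW.
    rewrite [leLHS]big_nat_cond [leRHS]big_nat_cond [leLHS]big_mkcond [leRHS]big_mkcond/=; apply: ler_sum => x _.
    case: ifPn => [/andP[/andP[Yx xn] ax]|_]; last first.
      by case: ifP => // _; rewrite !mulr_ge0 ?expR_ge0// ltW.
    rewrite Yx xn ax /j leq_sub2l ?leq_mul2l ?Yx ?orbT//=.
    have -> : (n <= 2 * a * x)%N.
      apply: (@leq_trans (2 * a * Y)); last by rewrite leq_mul2l Yx orbT.
      rewrite -(ler_nat R) !natrM.
      have : 8 * (a%:R * eta) * n.+1%:R <= 1 * n.+1%:R by rewrite ler_wpM2r ?(ltW nR)//; clear - eta8; lra.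
      have : n%:R <= n.+1%:R :> R by rewrite ler_nat.
      move: aY2; rewrite -[Y.+1%:R]natr1 mulrDr mulr1 mulrBl mul1r.
      clear - nbig ei0; lra.
    by rewrite normrM ger0_norm ?expR_ge0// mulrCA ler_wpM2l ?expR_ge0.
  apply: (le_trans (ler_wpM2l (ltW Ku0) (Ht n j (leq_subr _ _)))).
  rewrite -/V; set E := expR _; rewrite (_ : Ku * (Kt * V * E) = Ku * Kt * E * V); last ring.
  rewrite ler_wpM2r ?(ltW V0)// /E.
  apply: le_trans (Hxt (grid R n j) _ _).
  - rewrite ler_wpM2l ?mulr_ge0 ?(ltW Ku0) ?(ltW Kt0)// ler_expR ler_wpM2l ?(ltW st0)//.
    by rewrite /lns -ln_div ?posrE.
  - by rewrite divr_gt0.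
  - rewrite /grid /j -subSn// natrB ?natrM ?(ltnW aYn)//; apply: le_trans etat.
    rewrite ler_pdivrMr//.
    have : 1 <= eta * n.+1%:R.
      by rewrite mulrC -ler_pdivrMr// div1r (le_trans _ nbig)// lerDr mulr_ge0// ltW.
    move=> h; have : a%:R * 1 <= a%:R * (eta * n.+1%:R) by rewrite ler_wpM2l// ltW.
    move: aY2; rewrite -[Y.+1%:R]natr1 mulrDr mulr1 mulrBl mul1r; clear; lra.
have SmE : Sm / V = (\sum_(X <= x < Y) expR (v x) * u (n - a * x)%N / (expR (v n) * expR (w n))) / n.+1%:R.
  rewrite -mulr_suml -mulrA -invfM /V; congr (_ / _); last by ring.
  rewrite /Sm [LHS]big_nat_cond [RHS]big_nat_cond; apply: eq_bigl => x; rewrite andbT.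
  case: (boolP (X <= x < Y)%N) => //= /andP[_ xY]; rewrite -ltnS (leq_ltn_trans _ aYn)//.
  by rewrite leq_mul2l ltnW ?orbT.
set S' := \sum_(X <= x < Y) _ in hmid SmE.
pose chi : R := (d %| n)%N%:R.
have chi01 : 0 <= chi <= 1 by rewrite /chi; case: (_ %| _)%N; rewrite ?lexx ?ler01.
have hm : `|Sm / V - chi * c / q%:R * L'| <= e / 4.
  rewrite SmE -(ler_pM2r nR) -{2}(gtr0_norm nR) -normrM mulrBl divfK ?lt0r_neq0//.
  rewrite (_ : chi * c / q%:R * L' * n.+1%:R = n.+1%:R * (chi * c / q%:R) * L'); last ring.
  apply: (le_trans hmid).
  rewrite mulrAC ler_wpM2r ?(ltW nR)// mulrAC ler_pdivrMr//.
  have : e * L' <= e * (I + 1) by rewrite ler_wpM2l ?(ltW e0)//; clear - L'I; lra.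
  clear; lra.
have hI : `|chi * c / q%:R * L' - c / q%:R * I * chi| <= e / 4.
  have -> : chi * c / q%:R * L' - c / q%:R * I * chi = chi * (c / q%:R) * (L' - I) by ring.
  rewrite normrM distrC [`|I - L'|]ger0_norm ?subr_ge0//.
  have cq : 0 <= chi * (c / q%:R) <= c.
    have /andP[h0 h1] := chi01; rewrite mulr_ge0 ?divr_ge0 ?(ltW qR)//=.
    apply: (@le_trans _ _ (c / q%:R)); first by rewrite ler_piMl ?divr_ge0 ?(ltW qR).
    by rewrite ler_pdivrMr// ler_peMr.
  have /andP[cq0 cq1] := cq; rewrite ger0_norm//.
  apply: (@le_trans _ _ (c * (e / (4 * (c + 1))))).
    by rewrite ler_pM ?subr_ge0//; clear - L'h; lra.
  rewrite mulrA ler_pdivrMr//; have : 0 <= e by exact: ltW.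
  clear; lra.
have hh' : `|Sh / V| <= e / 4 by rewrite normrM normfV (gtr0_norm V0) ler_pdivrMr.
have ht' : `|St / V| <= e / 4 by rewrite normrM normfV (gtr0_norm V0) ler_pdivrMr.
rewrite !mulrDl -/chi.
move: hh' ht' hm hI; rewrite !ler_norml.
move: (Sh / V) (Sm / V) (St / V) (chi * c / q%:R * L') (c / q%:R * I * chi) => A1 A2 A3 A4 A5; clear.
by move=> /andP[? ?] /andP[? ?] /andP[? ?] /andP[? ?]; apply/andP; split; lra.
Qed.

(** The explicit primitive of (1 - a z)^l; the two-sided bound comes from factoring x^(l+1) -
    y^(l+1). *)
Lemma antider_poly a (l : nat) : (0 < a)%N ->
  antider 0 l%:R a (fun s e : R => ((1 - a%:R * s) ^+ l.+1 - (1 - a%:R * e) ^+ l.+1) / (a%:R * l.+1%:R)).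
Proof.
move=> a0; have aR : 0 < a%:R :> R by rewrite ltr0n.
have al : 0 < a%:R * l.+1%:R :> R by rewrite mulr_gt0 ?ltr0n.
split; first by move=> s t e _ _ _ _; field; rewrite !lt0r_neq0 ?ltr0n.
move=> s e m M s0 se ea H.
have e1 : 0 < 1 - a%:R * e.
  by move: ea; rewrite -[a%:R^-1]mul1r ltr_pdivlMr// mulrC => ?; lra.
have ase : a%:R * s <= a%:R * e by rewrite ler_wpM2l// ltW.
have s1 : 0 < 1 - a%:R * s by lra.
have phiE (z : R) : 0 < 1 - a%:R * z -> phi 0 l%:R a z = (1 - a%:R * z) ^+ l.
  by move=> z1; rewrite /phi mul0r add0r expRM_natl lnK.
have /andP[mP _] := H e (ltac:(by rewrite se lexx)); have /andP[_ PM] := H s (ltac:(by rewrite se lexx)).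
rewrite phiE// in mP; rewrite phiE// in PM.
rewrite subrXX mulrAC.
have -> : 1 - a%:R * s - (1 - a%:R * e) = a%:R * (e - s) by ring.
have es : 0 <= e - s by lra.
have -> : a%:R * (e - s) / (a%:R * l.+1%:R) = (e - s) / l.+1%:R by field; rewrite !lt0r_neq0 ?ltr0n.
set x := 1 - a%:R * s in s1 PM *; set y := 1 - a%:R * e in e1 mP *.
have yx : y <= x by rewrite /x /y; lra.
have lR : 0 < l.+1%:R :> R by rewrite ltr0n.
have xy : l.+1%:R * y ^+ l <= \sum_(i < l.+1) x ^+ (l.+1.-1 - i) * y ^+ i <= l.+1%:R * x ^+ l.
  have sE (t : R) : l.+1%:R * t = \sum_(i < l.+1) t by move=> *; rewrite sumr_const card_ord mulr_natl.
  rewrite !sE; apply/andP; split; apply: ler_sum => i _ /=.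
    rewrite -{1}(subnK (_ : i <= l)%N) -1?ltnS// exprD ler_wpM2r ?exprn_ge0 ?(ltW e1)//.
    by rewrite lerXn2r ?nnegrE ?(ltW e1) ?(ltW s1).
  rewrite -[in leRHS](subnK (_ : i <= l)%N) -1?ltnS// exprD ler_wpM2l ?exprn_ge0 ?(ltW s1)//.
  by rewrite lerXn2r ?nnegrE ?(ltW e1) ?(ltW s1).
have /andP[h1 h2] := xy; set S := \sum_(i < _) _ in h1 h2 *.
have -> : (e - s) / l.+1%:R * S = (S / l.+1%:R) * (e - s) by ring.
apply/andP; split; apply: ler_wpM2r => //.
  by rewrite ler_pdivlMr// mulrC; apply: le_trans h1; rewrite ler_wpM2l// ltW.
by rewrite ler_pdivrMr// mulrC; apply: (le_trans h2); rewrite ler_wpM2l// ltW.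
Qed.

(** These masses, one per added variable, multiply up to the exact constant of [sconv_asymp] for
    index 0. *)
Lemma total_poly a (l : nat) (I : R) : (0 < a)%N ->
  total_mass a (fun s e : R => ((1 - a%:R * s) ^+ l.+1 - (1 - a%:R * e) ^+ l.+1) / (a%:R * l.+1%:R)) I ->
  I = (a%:R * l.+1%:R)^-1.
Proof.
move=> a0 [I1 I2]; have aR : 0 < a%:R :> R by rewrite ltr0n.
have aV : 0 < a%:R^-1 :> R by rewrite invr_gt0.
have al : 0 < a%:R * l.+1%:R :> R by rewrite mulr_gt0 ?ltr0n.
have alV : 0 < (a%:R * l.+1%:R)^-1 :> R by rewrite invr_gt0.
apply/eqP; rewrite eq_le; apply/andP; split; apply/ler_addgt0Pr => eps eps0.
  have [eta eta0 H] := I2 eps eps0.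
  pose t := Num.min eta (a%:R^-1 / 2).
  have t0 : 0 < t by rewrite lt_min eta0 divr_gt0.
  have te : t <= eta by rewrite ge_min lexx.
  have ta : t <= a%:R^-1 / 2 by rewrite ge_min lexx orbT.
  have := H t (a%:R^-1 - t) t0 te (ltac:(lra)) (ltac:(lra)).
  have at1 : a%:R * t <= 2^-1 by have := ler_wpM2l (ltW aR) ta; rewrite mulrA mulfV ?lt0r_neq0// mul1r.
  have at0 : 0 < a%:R * t by rewrite mulr_gt0.
  have h1 : (1 - a%:R * t) ^+ l.+1 <= 1 by rewrite exprn_ile1//; lra.
  have h2 : 0 <= (1 - a%:R * (a%:R^-1 - t)) ^+ l.+1.
    by rewrite exprn_ge0// mulrBr mulfV ?lt0r_neq0//; lra.
  rewrite lerBlDr => /le_trans; apply; rewrite lerD2r -[leRHS]mul1r ler_wpM2r ?(ltW alV)//; lra.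
pose t := Num.min ((eps * l.+1%:R * a%:R / 2) / (l.+1%:R * a%:R)) (a%:R^-1 / 2).
have lR : 0 < l.+1%:R :> R by rewrite ltr0n.
have t0 : 0 < t by rewrite lt_min !divr_gt0// !mulr_gt0.
have ta : t <= a%:R^-1 / 2 by rewrite ge_min lexx orbT.
have te : t <= eps / 2.
  rewrite /t (_ : eps * l.+1%:R * a%:R / 2 / (l.+1%:R * a%:R) = eps / 2); first by rewrite ge_min lexx.
  by field; rewrite !lt0r_neq0.
have := I1 t (a%:R^-1 - t) t0 (ltac:(lra)) (ltac:(lra)).
have at1 : a%:R * t <= 2^-1 by have := ler_wpM2l (ltW aR) ta; rewrite mulrA mulfV ?lt0r_neq0// mul1r.
have at0 : 0 < a%:R * t by rewrite mulr_gt0.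
have h1 : 1 - l.+1%:R * (a%:R * t) <= (1 - a%:R * t) ^+ l.+1.
  have h01 (i : 'I_l.+1) : 0 <= a%:R * t <= 1 by apply/andP; split; lra.
  by have := prod_1B_ge (index_enum _) xpredT h01; rewrite sumr_const prodr_const card_ord [in X in _ -> X]mulr_natl.
have h2 : (1 - a%:R * (a%:R^-1 - t)) ^+ l.+1 <= a%:R * t.
  rewrite mulrBr mulfV ?lt0r_neq0// opprB addrC subrK exprS ler_piMr ?(ltW at0)//.
  by rewrite exprn_ile1//; lra.
move=> h; rewrite -lerBlDr; apply: le_trans h.
rewrite -[X in X - eps](mul1r) -(ler_pM2r al) mulrBl !divfK ?lt0r_neq0//.
have a1 : 1 <= l.+1%:R :> R by rewrite ler1n.
have : (l.+1%:R + 1) * (a%:R * t) <= 2 * l.+1%:R * (a%:R * (eps / 2)).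
  apply: ler_pM; [by rewrite addr_ge0|exact: ltW|lra|by rewrite ler_wpM2l// ltW].
lra.
Qed.

End convolution_asymptotics.

(** * Asymptotics of iterated convolutions *)

Section sconv_asymptotics.
Variable R : realType.
Implicit Types (v w : nat -> R) (a : nat).
Local Notation mu := (@lebesgue_measure R).

Lemma antider_integral (sg bt : R) a : (0 < a)%N ->
  antider sg bt a (fun s e : R => Rintegral mu `[s, e]%classic (phi sg bt a)).
Proof.
move=> a0; have aR : 0 < a%:R :> R by rewrite ltr0n.
have cont (s e : R) : 0 < s -> e < a%:R^-1 -> {within `[s, e]%classic, continuous (phi sg bt a)}.
  move=> s0 ea; apply: continuous_in_subspaceT => z; rewrite inE/= in_itv/= => /andP[sz ze].
  have z0 : 0 < z by exact: lt_le_trans sz.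
  have z1 : 0 < 1 - a%:R * z.
    have : z < a%:R^-1 by exact: le_lt_trans ea.
    by rewrite -[a%:R^-1]mul1r ltr_pdivlMr// mulrC subr_gt0.
  apply: continuous_comp; last exact: continuous_expR.
  apply: (@continuousD _ _ _ (fun z => sg * ln z) (fun z => bt * ln (1 - a%:R * z))).
    apply: (@continuousM _ _ (cst sg) (@ln R)); [exact: cvg_cst|exact: continuous_ln].
  rewrite /prop_for /continuous_at; apply: cvgM; first exact: cvg_cst.
  apply: (@cvg_comp _ _ _ (fun z : R => 1 - a%:R * z) (@ln R) _ (nbhs (1 - a%:R * z))); last exact: continuous_ln.
  by apply: cvgB; [exact: cvg_cst|apply: cvgM; [exact: cvg_cst|exact: cvg_id]].
have int (s e : R) : 0 < s -> e < a%:R^-1 -> mu.-integrable `[s, e]%classic (EFin \o phi sg bt a).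
  move=> s0 ea; apply: continuous_compact_integrable; first exact: segment_compact.
  exact: cont.
split => [s t e s0 st te ea|s e m M s0 se ea H].
  have := @Rintegral_itvB R (phi sg bt a) (BLeft s) (BRight e) t (int s e s0 ea).
  rewrite !bnd_simp => /(_ st te) h.
  rewrite -(@Rintegral_itv_obnd_cbnd R t (BRight e)) -?h; first ring.
  apply: integrableS (int t e (lt_le_trans s0 st) ea) => //.
  by apply: subset_itvr; rewrite bnd_simp.
have cst_int (r : R) : mu.-integrable `[s, e]%classic (EFin \o cst r).
  apply: continuous_compact_integrable; first exact: segment_compact.
  by apply: continuous_subspaceT => z; exact: cvg_cst.
have cstE (r : R) : Rintegral mu `[s, e]%classic (cst r) = r * (e - s).
  have muE : mu `[s, e]%classic = (e - s)%:E.
    rewrite lebesgue_measure_itv/= lte_fin; case: ltP => [_|es]; first by rewrite -EFinD.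
    by congr (_%:E); apply/eqP; rewrite eq_sym subr_eq0 eq_le es se.
  by rewrite Rintegral_cst//= [X in fine X](_ : _ = (e - s)%:E).
rewrite -!cstE; apply/andP; split; apply: le_Rintegral => //; try exact: int; try exact: cst_int.
  by move=> z /=; rewrite in_itv/= => /H /andP[].
by move=> z /=; rewrite in_itv/= => /H /andP[].
Qed.

Lemma expR_near1 (x : R) : `|x| <= 2^-1 -> `|expR x - 1| <= 2 * `|x|.
Proof.
move=> x2; have h1 := expR_ge1Dx x; have h2 := expR_ge1Dx (- x).
have hx := ler_norm x; have hx' := ler_norm (- x); rewrite normrN in hx'.
have x1 : 0 < 1 - x by lra.
have h3 : expR x <= (1 - x)^-1.
  by rewrite -[leLHS]invrK lef_pV2 ?posrE ?invr_gt0 ?expR_gt0// -expRN.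
have h4 : (1 - x)^-1 <= 1 + 2 * `|x|.
  rewrite -[leLHS]mul1r ler_pdivrMr//.
  have : 0 <= `|x| - x by lra.
  have : 0 <= `|x| * (1 - 2 * x) by rewrite mulr_ge0//; lra.
  lra.
rewrite ler_norml; apply/andP; split; lra.
Qed.

(* Logarithm of (n+1)^(l-1) p(n)^l for p = expR \o v, the order of the l-fold convolution. *)
Definition log_scale (l : nat) v n : R := (l%:R - 1) * lns R n + l%:R * v n.

Lemma RV_log_scale (sg : R) l v : RV sg v -> RV (l%:R * (sg + 1) - 1) (log_scale l v).
Proof.
move=> Hv; have := RVD (RVZ (l%:R - 1) (@RV_lns R)) (RVZ l%:R Hv).
by rewrite (_ : (l%:R - 1) * 1 + l%:R * sg = l%:R * (sg + 1) - 1)//; ring.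
Qed.

Lemma log_scale_index (sg : R) l : -1 < sg -> (0 < l)%N -> -1 < l%:R * (sg + 1) - 1.
Proof.
move=> s1 l0; have : 0 < l%:R * (sg + 1) by rewrite mulr_gt0 ?ltr0n// -ltrBlDr sub0r.
lra.
Qed.

Lemma expR_log_scaleS l v n : expR (log_scale l.+1 v n) = n.+1%:R * expR (v n) * expR (log_scale l v n).
Proof. by rewrite -(expR_lns R n) -!expRD /log_scale -[l.+1%:R]natr1; congr expR; ring. Qed.

Lemma sconv1 (p : nat -> R) a n : (0 < a)%N ->
  sconv p [:: a] n = if (a %| n)%N then p (n %/ a)%N else 0.
Proof.
move=> a0 /=; case: ifPn => [an|an].
  have xn : (n %/ a < n.+1)%N by rewrite ltnS leq_div.
  rewrite (bigD1 (Ordinal xn))/=; last by rewrite mulnC divnK.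
  rewrite mulnC divnK// subnn eqxx mulr1 big1 ?addr0// => x /andP[ax xN].
  rewrite (_ : (n - a * x == 0)%N = false) ?mulr0//; apply/negbTE; apply: contra xN => E.
  rewrite -val_eqE /= -(eqn_pmul2l a0) [(a * (n %/ a))%N]mulnC divnK// eqn_leq ax /=.
  by rewrite -subn_eq0.
rewrite big1// => x ax; rewrite (_ : (n - a * x == 0)%N = false) ?mulr0//.
apply/negbTE; apply: contra an; rewrite subn_eq0 => h.
by rewrite (_ : n = a * x)%N ?dvdn_mulr//; apply/eqP; rewrite eqn_leq h ax.
Qed.

Lemma sconv_ge0 (p : nat -> R) cs n : (forall x, 0 <= p x) -> 0 <= sconv p cs n.
Proof.
move=> p0; elim: cs n => [|a cs IH] n /=; first by case: eqP.
by apply: sumr_ge0 => x _; rewrite mulr_ge0.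
Qed.

Lemma sconv_bound (sg : R) v cs : RV sg v -> -1 < sg -> all (ltn 0) cs -> (0 < size cs)%N ->
  exists2 K : R, 0 < K & forall n,
    sconv (fun x => expR (v x)) cs n <= K * expR (log_scale (size cs) v n).
Proof.
move=> Hv s1; case: cs => // a cs; elim: cs a => [|b cs IH] a.
  move=> /andP[a0 _] _.
  have aV : 0 < a%:R^-1 :> R by rewrite invr_gt0 ltr0n.
  have [K K0 HK] := rv_local_bound Hv s1 aV.
  exists K => // n; rewrite sconv1// [size _]/=.
  have -> : log_scale 1 v n = v n by rewrite /log_scale subrr mul0r add0r mul1r.
  case: ifPn => an; last by rewrite mulr_ge0 ?expR_ge0 ?(ltW K0).
  apply: HK; first exact: leq_div.
  rewrite mulrC ler_pdivrMr ?ltr0n// -natrM ler_nat.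
  by rewrite mulSn divnK// -add1n leq_add2r.
move=> /andP[a0 cs0] _; have [K K0 HK] := IH b cs0 isT.
have [K' K'0 HK'] := conv_bound Hv (RV_log_scale (size (b :: cs)) Hv) s1 (log_scale_index s1 (ltn0Sn _ : (0 < size (b :: cs))%N)) a0.
exists (K * K'); first exact: mulr_gt0.
move=> n; rewrite [size _]/= expR_log_scaleS.
apply: (@le_trans _ _ (K * dilated_conv a (fun x => expR (v x)) (fun x => expR (log_scale (size (b :: cs)) v x)) n)).
  rewrite [sconv _ _ _]/= /dilated_conv mulr_sumr; apply: ler_sum => x _.
  by rewrite mulrCA ler_wpM2l ?expR_ge0//; exact: HK.
by rewrite -mulrA ler_wpM2l ?(ltW K0)//; exact: HK'.
Qed.

(** [C] is fixed before [v], which later allows [v] to be defined in terms of [C]. The gcd factor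
    compensates for the sparse support. For sg = 0 the constant is that of counting lattice points
    on a simplex. *)
Lemma sconv_asymp (sg : R) cs : -1 < sg -> all (ltn 0) cs -> (0 < size cs)%N ->
  exists C : R, [/\ 0 < C, sg = 0 -> C = ((size cs).-1`!%:R * (\prod_(c <- cs) c)%:R)^-1 &
   forall v, RV sg v ->
    tends0 (fun n => sconv (fun x => expR (v x)) cs n / expR (log_scale (size cs) v n)
      - C * (foldr gcdn 0 cs)%:R * (foldr gcdn 0 cs %| n)%N%:R)].
Proof.
move=> s1; case: cs => // a cs; elim: cs a => [|b cs IH] a.
  move=> /andP[a0 _] _; have aR : 0 < a%:R :> R by rewrite ltr0n.
  exists (expR (- sg * ln a%:R) / a%:R); split.
  - by rewrite divr_gt0 ?expR_gt0.
  - by move=> ->; rewrite oppr0 mul0r expR0 /= big_seq1 fact0 !mul1r.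
  have fE : foldr gcdn 0%N [:: a] = a by rewrite /= gcdn0.
  move=> v Hv e e0; rewrite fE divfK ?lt0r_neq0//.
  (* With one variable, p(n/a)/p(n) tends to a^(-sg) along multiples of a. *)
  pose E := expR (- sg * ln a%:R).
  have E0 : 0 < E by exact: expR_gt0.
  pose d := Num.min 2^-1 (e / (2 * E)).
  have d0 : 0 < d by rewrite lt_min invr_gt0 ltr0n divr_gt0// mulr_gt0.
  have d1 : d <= 2^-1 by rewrite ge_min lexx.
  have d2 : d * (2 * E) <= e by rewrite -ler_pdivlMr ?mulr_gt0// ge_min lexx orbT.
  have d20 : 0 < d / 2 by rewrite divr_gt0.
  have aV : 0 < a%:R^-1 :> R by rewrite invr_gt0.
  have [N1 H1] := Hv _ _ aV d20.
  have [N2 H2] := nat_ge (`|sg| * a%:R / (d / 2)).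
  exists (maxn N1 N2) => n; rewrite geq_max => /andP[n1 n2].
  rewrite sconv1// [size _]/=.
  have -> : log_scale 1 v n = v n by rewrite /log_scale subrr mul0r add0r mul1r.
  case: ifPn => an; last by rewrite mul0r mulr0 subrr normr0 ltW.
  rewrite mulr1 -expRB.
  set m := (n %/ a)%N; have nE : n = (m * a)%N by rewrite divnK.
  have nR : 0 < n.+1%:R :> R by rewrite ltr0n.
  have h1 := H1 n m n1 (leq_div _ _) (ltac:(by
    rewrite mulrC ler_pdivrMr ?ltr0n// -natrM ler_nat mulSn -nE -add1n leq_add2r)).
  have h2 : `|lns R m - lns R n + ln a%:R| <= a%:R / n.+1%:R.
    rewrite addrAC /lns -lnM ?posrE ?ltr0n//.
    apply: (le_trans (ln_dist_le nR _ (lexx _))).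
      by rewrite -natrM ler_nat mulSn -nE -add1n leq_add2r.
    rewrite ler_wpM2r ?invr_ge0 ?(ltW nR)//.
    have -> : m.+1%:R * a%:R - n.+1%:R = a%:R - 1 :> R.
      by rewrite -natrM mulSn -nE natrD -[n.+1%:R]natr1; ring.
    by rewrite ger0_norm ?subr_ge0 ?ler1n// lerBlDr lerDl.
  have h3 : `|sg * (lns R m - lns R n + ln a%:R)| <= d / 2.
    rewrite normrM; apply: (le_trans (ler_wpM2l (normr_ge0 _) h2)).
    rewrite mulrA ler_pdivrMr// [leRHS]mulrC -ler_pdivrMr//; apply: (le_trans (H2 n n2)).
    by rewrite ler_nat.
  set x := v m - v n + sg * ln a%:R.
  have hx : `|x| <= d.
    rewrite (_ : x = (v m - v n - sg * (lns R m - lns R n)) + sg * (lns R m - lns R n + ln a%:R)); last by rewrite /x; ring.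
    by apply: (le_trans (ler_normD _ _)); rewrite [d]splitr lerD.
  have -> : expR (v m - v n) - expR (- sg * ln a%:R) = E * (expR x - 1).
    rewrite mulrBr mulr1 /E -expRD /x; congr (expR _ - _); ring.
  rewrite normrM (gtr0_norm E0); apply: le_trans d2.
  rewrite mulrC; have := expR_near1 (le_trans hx d1) => h.
  have : `|expR x - 1| <= 2 * d by lra.
  move=> h'; have := ler_wpM2r (ltW E0) h'; lra.
move=> /andP[a0 cs0] _; have [C [C0 C1 HC]] := IH b cs0 isT.
set cs' := b :: cs in cs0 C1 HC *.
have l0 : (0 < size cs')%N by [].
set g := foldr gcdn 0%N cs' in HC.
have g0 : (0 < g)%N by rewrite /g /= gcdn_gt0; move: cs0 => /= /andP[->].
have b1 := log_scale_index s1 l0.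
(* Index 0 takes the explicit primitive, for the exact constant; any other index takes the Lebesgue
   integral. *)
have [L HL HI] : exists2 L, antider sg ((size cs')%:R * (sg + 1) - 1) a L &
    forall I, total_mass a L I -> sg = 0 -> I = (a%:R * (size cs')%:R)^-1.
  have [->|sn] := eqVneq sg 0; last first.
    by eexists; [exact: antider_integral|move=> I _ /eqP; rewrite (negbTE sn)].
  rewrite add0r mulr1 (_ : (size cs')%:R - 1 = (size cs)%:R :> R); last by rewrite /= -natr1 addrK.
  eexists; first exact: antider_poly.
  by move=> I HI _; rewrite (total_poly a0 HI).
have [I I0 tI] := antider_total s1 b1 a0 HL.
exists (C * I); split.
- exact: mulr_gt0.
- move=> sg0; rewrite (HI I tI sg0) (C1 sg0) -invfM; congr (_^-1).
  rewrite [size (a :: _)]/= [_.+1.-1]/= big_cons /=.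
  by rewrite factS natrM natrM; ring.
move=> v Hv.
have cs0' : all (ltn 0) cs' by exact: cs0.
  have [Ku Ku0 HKu] := sconv_bound (cs := cs') Hv s1 cs0' l0.
have := conv_asymp s1 b1 a0 HL I0 tI Hv (RV_log_scale (size cs') Hv) g0 (mulr_ge0 (ltW C0) (ler0n R g)) Ku0 _ (HC v Hv).
move=> H e e0; have [|N HN] := H _ e e0.
  by move=> m; rewrite ger0_norm//; apply: sconv_ge0 => x; exact: expR_ge0.
exists N => n Nn; have := HN n Nn.
rewrite [size (a :: _)]/= -[(size cs).+2]/((size cs').+1) expR_log_scaleS.
have -> : foldr gcdn 0%N (a :: cs') = gcdn a g by [].
suff -> : C * I * (gcdn a g)%:R = C * g%:R / (g %/ gcdn a g)%:R * I by [].
have q0 : (0 < g %/ gcdn a g)%N by rewrite divn_gt0 ?gcdn_gt0 ?a0// dvdn_leq// dvdn_gcdr.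
have {2}<- : ((g %/ gcdn a g) * gcdn a g = g)%N by rewrite divnK// dvdn_gcdr.
rewrite natrM; set q := (g %/ gcdn a g)%:R; have : 0 < q :> R by rewrite ltr0n.
by move=> q0'; field; exact: lt0r_neq0.
Qed.

End sconv_asymptotics.

(** * Concentration *)

(** Koenig's lemma on the binary tree. A prefix is kept if for every N it extends to a set good up
    to N. Were both next bits to fail, the larger of the two failing bounds would contradict the
    prefix. *)
Lemma pred_compactness (Good : nat -> pred nat -> Prop) :
  (forall n (A B : pred nat), (forall i, (i <= n)%N -> A i = B i) -> Good n A -> Good n B) ->
  (forall N, exists A, forall n, (n <= N)%N -> Good n A) ->
  exists A, forall n, Good n A.
Proof.
move=> loc fin.
pose ext (s : seq bool) := forall N, exists A : pred nat,
  (forall i, (i < size s)%N -> A i = nth false s i) /\ forall n, (n <= N)%N -> Good n A.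
have ext0 : ext [::] by move=> N; have [A HA] := fin N; exists A.
pose step s := if `[< ext (rcons s true) >] then rcons s true else rcons s false.
have extS s : ext s -> ext (step s).
  move=> es; rewrite /step; case: asboolP => // nt; apply: contrapT => nf.
  move/existsNP: nt => [N1 H1]; move/existsNP: nf => [N2 H2].
  have [A [As HA]] := es (maxn N1 N2).
  have HA1 n : (n <= N1)%N -> Good n A by move=> h; apply: HA; rewrite leq_max h.
  have HA2 n : (n <= N2)%N -> Good n A by move=> h; apply: HA; rewrite leq_max h orbT.
  case E : (A (size s)); [apply: H1|apply: H2]; exists A; split => // i; rewrite size_rcons nth_rcons ltnS leq_eqVlt;
    by move=> /orP[/eqP ->|h]; rewrite ?ltnn ?eqxx ?E// h As.
pose s i := iter i step [::].
have ssz i : size (s i) = i.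
  by elim: i => //= i IH; rewrite /step; case: asboolP; rewrite size_rcons IH.
have exts i : ext (s i) by elim: i => //= i; exact: extS.
have snth i j : (i < j)%N -> nth false (s j) i = nth false (s i.+1) i.
  elim: j => // j IH; rewrite ltnS leq_eqVlt => /orP[/eqP ->//|ij].
  rewrite -(IH ij) /= /step; case: asboolP => _; by rewrite nth_rcons ssz ij.
exists (fun i => nth false (s i.+1) i) => n.
have [A [As HA]] := exts n.+1 n.
apply: loc (HA n (leqnn n)) => i ile.
by rewrite As ?ssz ?ltnS// snth.
Qed.

Section diagonal.
Variable R : realType.

(** At n the tolerance is 1/(j+3), with j <= n the largest index whose threshold n has passed; the 3
    respects the bound e <= 1/3. *)
Lemma diagonal_eps (Q : R -> nat -> Prop) :
  (forall e : R, 0 < e -> e <= 3^-1 -> exists N, forall n, (N <= n)%N -> Q e n) ->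
  exists (e : nat -> R) (n0 : nat), (forall n, (n0 <= n)%N -> 0 < e n /\ Q (e n) n) /\ tends0 e.
Proof.
move=> H.
have H' (j : nat) : exists N, forall n, (N <= n)%N -> Q ((j + 3)%:R^-1) n.
  apply: H; first by rewrite invr_gt0 ltr0n addn_gt0 orbT.
  by rewrite lef_pV2 ?posrE ?ltr0n ?addn_gt0 ?orbT// ler_nat leq_addl.
have [N HN] := choice H'.
pose j n := \max_(i < n.+1 | (N i <= n)%N) i.
have jP n : (N 0%N <= n)%N -> (N (j n) <= n)%N.
  move=> h; rewrite /j; have [|i /= Hi ->] := @eq_bigmax_cond _ (fun i : 'I_n.+1 => N i <= n)%N (fun i => i : nat).
    by apply/card_gt0P; exists ord0.
  exact: Hi.
have jge J : exists M, forall n, (M <= n)%N -> (J <= j n)%N.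
  exists (maxn J (N J)) => n; rewrite geq_max => /andP[Jn NJ].
  have Jn' : (J < n.+1)%N by [].
  exact: (@leq_bigmax_cond _ (fun i : 'I_n.+1 => N i <= n)%N (fun i => i : nat) (Ordinal Jn')).
exists (fun n => (j n + 3)%:R^-1), (N 0%N); split.
  move=> n hn; split; first by rewrite invr_gt0 ltr0n addn_gt0 orbT.
  by apply: HN; exact: jP.
move=> e e0; have [J HJ] := nat_ge (e^-1); have [M HM] := jge J.
exists M => n Mn; rewrite ger0_norm ?invr_ge0// -[leRHS]invrK lef_pV2 ?posrE ?invr_gt0 ?ltr0n ?addn_gt0 ?orbT//.
by apply: (le_trans (HJ _ (HM n Mn))); rewrite ler_nat leq_addr.
Qed.

Lemma sum_inv_sq (n N : nat) : (0 < n)%N ->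
  \sum_(n <= m < N) (m.+1%:R ^+ 2)^-1 <= n%:R^-1 :> R.
Proof.
move=> n0; have [Nn|nN] := leqP N n; first by rewrite big_geq.
apply: (@le_trans _ _ (\sum_(n <= m < N) - ((m.+1)%:R^-1 - (m%:R)^-1 : R))).
  rewrite big_nat_cond [leRHS]big_nat_cond; apply: ler_sum => m /andP[/andP[nm _] _].
  have m0 : 0 < m%:R :> R by rewrite ltr0n (leq_trans n0).
  rewrite -natr1; set x := m%:R in m0 *.
  have x1 : 0 < x + 1 by lra.
  have -> : - ((x + 1)^-1 - x^-1) = (x * (x + 1))^-1 by field; rewrite !lt0r_neq0.
  by rewrite lef_pV2 ?posrE ?exprn_gt0 ?mulr_gt0// expr2 ler_pM2r//; lra.
rewrite sumrN (telescope_sumr (fun m => m%:R^-1)) ?(ltnW nN)// opprB lerBlDr lerDl invr_ge0 ler0n//.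
Qed.

End diagonal.

Local Close Scope classical_set_scope.

(** * Functionals controlling the random counts *)

Section tails.
Variables (R : realType) (p : nat -> R).
Hypothesis p01 : forall x, 0 <= p x <= 1.
Variables (J : finType) (B : nat).
Implicit Types (I : {set J}) (c : J -> nat).

Let p0 x : 0 <= p x. Proof. by case/andP: (p01 x). Qed.

Lemma sprod_ge0 N I c m : 0 <= sprod p N I c m.
Proof. by apply: sumr_ge0 => k _; apply: prodr_ge0. Qed.

Fixpoint sparse_const (K : R) (M l : nat) : R :=
  if l is l'.+1 then K + (l'.+1 * (l'.+1 * M) + l'.+1 ^ 2)%:R * sparse_const K M l' else 1.

Lemma sparse_const_ge0 K M l : 0 <= K -> 0 <= sparse_const K M l.
Proof. by move=> K0; elim: l => //= l IH; rewrite addr_ge0// mulr_ge0. Qed.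

Lemma sparse_const_mono K M l l' : 1 <= K -> (l <= l')%N -> sparse_const K M l <= sparse_const K M l'.
Proof.
move=> K1; have K0 : 0 <= K by lra.
move=> /subnKC <-; elim: (l' - l)%N => [|r IH]; first by rewrite addn0.
rewrite addnS /=; apply: (le_trans IH); set r' := (l + r)%N.
have D0 := @sparse_const_ge0 K M r' K0.
have h : 1 <= (r'.+1 * (r'.+1 * M) + r'.+1 ^ 2)%:R :> R by rewrite ler1n addn_gt0 expn_gt0 orbT.
have := ler_wpM2r D0 h; lra.
Qed.

Lemma disjtup_ext M N I c c' m (S : {set 'I_N.+1}) A : {in I, c =1 c'} ->
  disjtup R M I c m S A = disjtup R M I c' m S A.
Proof.
move=> cc; elim: M S => //= M IH S; rewrite (reps_ext _ _ cc).
by apply: eq_bigr => k _; rewrite IH.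
Qed.

(** [G] adds the normalised numbers of disjoint M-tuples over all index sets, weights and targets.
    Below 1 it keeps every one of them small, and [disjtup_ge], read contrapositively by induction
    on |I|, bounds every count with a [D] independent of N. *)
Lemma low_levels (W : nat -> R) (L : nat) (C z : R) :
  (forall m, 1 <= W m) -> (forall m n, (m <= n)%N -> W m <= W n) -> 0 <= C -> 0 < z ->
  (forall N I c m, (0 < #|I| <= L)%N -> adm B I c -> (m <= N)%N ->
    sprod p N I c m <= C * W m * expR (- z * lns R m)) ->
  exists2 D : R, 0 <= D & forall N, exists G : pred nat -> R, [/\ forall A, 0 <= G A,
    Ex p N.+1 G <= 4^-1 &
    forall A, G A < 1 -> forall I c m, (#|I| <= L)%N -> adm B I c -> (m <= N)%N ->
      cnt R N A I c m <= D * W m].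
Proof.
move=> W1 Wm C0 z0 Hs.
(* z M >= 2 makes the M-th power of the saving (m+1)^(-z) summable over the targets. *)
have [M0' HM0] := nat_ge (2 / z); pose M := M0'.+1.
have zM : 2 <= z * M%:R.
  by have := HM0 M (leqnSn _); rewrite ler_pdivrMr// mulrC.
(* [q] counts the pairs of an index set and bounded weights. As the sum over m costs a factor 2, [K]
   is sized so that 2 q C / K <= 1/4. *)
pose q := (#|{set J}| * #|{ffun J -> 'I_B.+1}|)%N.
pose K := 8 * (q%:R + 1) * (C + 1).
have q0 : 0 <= q%:R :> R by [].
have qC : 0 <= q%:R * C by rewrite mulr_ge0.
have K1 : 1 <= K by rewrite /K; lra.
have CK : C <= K by rewrite /K; lra.
have K0 : 0 < K by lra.
exists (sparse_const K M L); first by apply: sparse_const_ge0; exact: ltW.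
move=> N.
pose G A : R := \sum_(I : {set J}) \sum_(c : {ffun J -> 'I_B.+1} | (0 < #|I| <= L)%N && `[< adm B I (fun i => c i : nat) >])
  \sum_(m < N.+1) ((K * W m) ^+ M)^-1 * @disjtup R J N M I (fun i => c i : nat) m finset.set0 A.
have W0 m : 0 < W m by exact: lt_le_trans (W1 m).
have KW0 m : 0 < K * W m by rewrite mulr_gt0.
have G0 I c m A : 0 <= ((K * W m) ^+ M)^-1 * @disjtup R J N M I c m finset.set0 A.
  by rewrite mulr_ge0 ?disjtup_ge0// invr_ge0 exprn_ge0// ltW.
exists G; split.
- by move=> A; do 3!(apply: sumr_ge0 => ? _).
- have -> : Ex p N.+1 G = \sum_(I : {set J}) \sum_(c : {ffun J -> 'I_B.+1} | (0 < #|I| <= L)%N && `[< adm B I (fun i => c i : nat) >])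
      \sum_(m < N.+1) ((K * W m) ^+ M)^-1 * Ex p N.+1 (@disjtup R J N M I (fun i => c i : nat) m finset.set0).
    rewrite /G Ex_sum; apply: eq_bigr => I _; rewrite Ex_sum; apply: eq_bigr => c _.
    by rewrite Ex_sum; apply: eq_bigr => m _; rewrite ExZ.
  apply: (@le_trans _ _ (\sum_(I : {set J}) \sum_(c : {ffun J -> 'I_B.+1}) (C / K * 2))).
    apply: ler_sum => I _; rewrite big_mkcond; apply: ler_sum => c _.
    have CK0 : 0 <= C / K by rewrite divr_ge0// ltW.
    case: ifPn => [/andP[IL /asboolP ac]|_]; last by rewrite mulr_ge0.
    apply: (@le_trans _ _ (\sum_(m < N.+1) C / K * (m.+1%:R ^+ 2)^-1)).
      apply: ler_sum => m _.
      have mN : (m <= N)%N by rewrite -ltnS.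
      apply: (@le_trans _ _ (((K * W m) ^+ M)^-1 * (C * W m * expR (- z * lns R m)) ^+ M)).
        rewrite ler_wpM2l ?invr_ge0 ?exprn_ge0 ?(ltW (KW0 _))//.
        apply: (le_trans (Ex_disjtup p01 _ _ _ _ _)).
        by rewrite lerXn2r ?nnegrE ?sprod_ge0 ?Hs// !mulr_ge0 ?expR_ge0// ltW.
      rewrite -(exprVn (K * W m)) -exprMn.
      have -> : (K * W m)^-1 * (C * W m * expR (- z * lns R m)) = C / K * expR (- z * lns R m).
        by have := W0 m; move: (W m) => w w0; field; rewrite !lt0r_neq0.
      rewrite exprMn; apply: ler_pM.
      + by rewrite exprn_ge0.
      + by rewrite exprn_ge0// expR_ge0.
      + rewrite exprS ler_piMr// exprn_ile1// ler_pdivrMr// mul1r//.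
      + rewrite -expRM_natl -(expR_lns R m) -expRM_natl -expRN ler_expR.
        have l0 : 0 <= lns R m by rewrite ln_ge0// ler1n.
        have := ler_wpM2r l0 zM; lra.
    rewrite -mulr_sumr ler_wpM2l//.
    rewrite -(big_mkord xpredT (fun m => (m.+1%:R ^+ 2)^-1 : R)) big_ltn// expr1n invr1.
    by have := @sum_inv_sq R 1 N.+1 isT; rewrite invr1 => h; lra.
  have -> : \sum_(I : {set J}) \sum_(c : {ffun J -> 'I_B.+1}) (C / K * 2) = q%:R * C * 2 / K.
    by rewrite !sumr_const -mulrnA mulnC -mulr_natl -/q; field; exact: lt0r_neq0.
  by rewrite ler_pdivrMr// /K; lra.
move=> A GA.
have key I c m : (0 < #|I| <= L)%N -> adm B I c -> (m <= N)%N ->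
    @disjtup R J N M I c m finset.set0 A < (K * W m) ^+ M.
  move=> IL ac mN.
  have cB i : i \in I -> (c i < B.+1)%N.
    by move=> iI; rewrite ltnS; apply: leq_trans ac.2; rewrite (bigD1 i)//= leq_addr.
  pose c' : {ffun J -> 'I_B.+1} := [ffun i => inord (c i)].
  have cc' i : i \in I -> c i = c' i by move=> iI; rewrite ffunE inordK// cB.
  have YE S : @disjtup R J N M I c m S A = @disjtup R J N M I (fun i => c' i : nat) m S A.
    exact: disjtup_ext.
  have ac' : adm B I (fun i => c' i : nat).
    split; first by move=> i iI; rewrite -cc'//; exact: ac.1.
    by rewrite -(eq_bigr _ cc'); exact: ac.2.
  rewrite YE -[ltRHS]mulr1 -ltr_pdivrMl ?exprn_gt0//; apply: le_lt_trans GA.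
  have mN' : (m < N.+1)%N by [].
  rewrite /G (bigD1 I)//= (bigD1 c')/=; last by rewrite IL; apply/asboolP.
  rewrite (bigD1 (Ordinal mN'))//= -!addrA lerDl !addr_ge0//.
  + by apply: sumr_ge0 => ? _; exact: G0.
  + by do 2!(apply: sumr_ge0 => ? _); exact: G0.
  + by do 3!(apply: sumr_ge0 => ? _); exact: G0.
have main l I c m : #|I| = l -> (l <= L)%N -> adm B I c -> (m <= N)%N ->
    cnt R N A I c m <= sparse_const K M l * W m.
  elim: l I c m => [|l IH] I c m Il lL ac mN.
    rewrite /= mul1r; apply: le_trans (W1 m).
    move/eqP: Il; rewrite cards_eq0 => /eqP ->.
    apply: (@le_trans _ _ (\sum_(k in reps N finset.set0 c m) 1)).
      by apply: ler_sum => k _; rewrite lern1 leq_b1.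
    by rewrite sumr_const lern1 card_reps0.
  rewrite leNgt; apply/negP => hc.
  have := key I c m; rewrite Il lL => /(_ isT ac mN); apply/negP; rewrite -leNgt.
  apply: (@disjtup_ge _ _ _ _ _ _ _ _ _ (sparse_const K M l * W m)).
  - exact: ltW.
  - by rewrite mulr_ge0 ?sparse_const_ge0 ?(ltW K0)// ltW.
  - move=> i m' iI m'm.
    have Ii : #|I :\ i| = l by have := cardsD1 i I; rewrite iI Il => -[].
    apply: (le_trans (IH (I :\ i) c m' Ii (ltnW lL) (adm_rem _ ac) (leq_trans m'm mN))).
    by rewrite ler_wpM2l ?sparse_const_ge0 ?(ltW K0)// Wm.
  - move=> i j iI jI.
    have jI' : j \in I by move: jI; rewrite in_setD1 => /andP[].
    have Ij : #|I :\ j| = l by have := cardsD1 j I; rewrite jI' Il => -[].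
    exact: (IH _ _ _ Ij (ltnW lL) (adm_merge iI jI ac) mN).
  - rewrite Il cards0 add0n; apply: ltW; apply: le_lt_trans hc.
    by rewrite /= mulrDl mulrA.
move=> I c m IL ac mN; apply: (le_trans (main #|I| I c m erefl IL ac mN)).
by rewrite ler_wpM2r ?(ltW (W0 _))// sparse_const_mono.
Qed.

(** Since 1 - t >= exp(-t/(1-t)), the product in [janson_prod] dominates exp(-t/(1-t) times the
    count), so a small count forces the rescaled product up to 1. The hypothesis on [S] is applied
    to the entries of a single representation. *)
Lemma lower_tail (N n : nat) I c (t d tau : R) :
  0 < t < 1 ->
  (forall S : {set 'I_N.+1}, (#|S| <= #|I|)%N ->
    \sum_(k in reps N I c n | ~~ [disjoint k @: I & S]) pw p (k @: I :\: S) <= d) ->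
  exists G : pred nat -> R, [/\ forall A, 0 <= G A,
    Ex p N.+1 G <= expR (tau - t * (1 - t * d) * \sum_(k in reps N I c n | injon I k) pw p (k @: I)) &
    forall A, G A < 1 -> tau < t / (1 - t) * cnt R N A I c n].
Proof.
move=> /andP[t0 t1] Hd.
pose E := [set k in reps N I c n | injon I k].
pose Us := [seq elts (k @: I) | k : {ffun J -> 'I_N.+1} in E].
pose G A := expR tau * \prod_(U <- Us) (1 - t * (all A U)%:R).
have t01 : 0 <= t <= 1 by rewrite !ltW.
exists G; split.
- move=> A; rewrite mulr_ge0 ?expR_ge0//; apply: prodr_ge0 => U _.
  by rewrite subr_ge0; case: (all A U); rewrite ?mulr1 ?mulr0 ?(ltW t1).
- rewrite ExZ expRD ler_wpM2l ?expR_ge0//.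
  have := @janson_prod R p p01 N.+1 t d Us t01.
  have -> : \sum_(U <- Us) \prod_(x <- U) p x = \sum_(k in reps N I c n | injon I k) pw p (k @: I).
    rewrite big_map big_enum/= (eq_bigl (fun k => (k \in reps N I c n) && injon I k)); last by move=> k; rewrite inE.
    by apply: eq_bigr => k _; rewrite prod_elts; apply: eq_bigl => x; rewrite andbT.
  rewrite mulNr mulNr; apply.
    by move=> _ /mapP[k _ ->]; split; [exact: elts_uniq|exact: elts_lt].
  move=> _ /mapP[k kE ->]; rewrite big_map big_enum_cond/=.
  have kI : (#|k @: I| <= #|I|)%N by exact: leq_imset_card.
  apply: le_trans (Hd _ kI).
  rewrite (eq_bigl (fun k' : {ffun J -> 'I_N.+1} => [&& k' \in reps N I c n, injon I k' & ~~ [disjoint k' @: I & k @: I]])); last first.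
    move=> k'; rewrite inE -andbA; congr [&& _, _ & _].
    apply/hasP/pred0Pn => [[_ /mapP[x xk ->]]|[x /andP[xk' xk]]].
      by rewrite /= mem_elts => xk'; exists x; rewrite /= xk' -mem_enum xk.
    by exists (val x); rewrite /= mem_elts.
  rewrite [leLHS]big_mkcond [leRHS]big_mkcond/=; apply: ler_sum => k' _.
  case: (k' \in reps N I c n) => //=; case: [disjoint _ & _] => /=; rewrite ?andbF// andbT.
  rewrite prod_elts (_ : \prod_(x in k' @: I | _) _ = pw p (k' @: I :\: k @: I)).
    by case: ifP => // _; exact: pw_ge0.
  by apply: eq_bigl => x; rewrite finset.in_setD mem_elts andbC.
move=> A GA.
have h1 : 0 < 1 - t by lra.
have ht : expR (- (t / (1 - t))) <= 1 - t.
  have := expR_ge1Dx (t / (1 - t)); have -> : 1 + t / (1 - t) = (1 - t)^-1 by field; exact: lt0r_neq0.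
  by move=> h; rewrite expRN -[leRHS]invrK lef_pV2 ?posrE ?invr_gt0 ?expR_gt0.
have : expR (tau - t / (1 - t) * cnt R N A I c n) < 1.
  apply: le_lt_trans GA; rewrite /G expRD ler_wpM2l ?expR_ge0//.
  apply: (@le_trans _ _ (expR (- (t / (1 - t)) * \sum_(k in E) (inA A (k @: I))%:R))).
    rewrite ler_expR -mulNr ler_wnM2l ?oppr_le0 ?divr_ge0 ?(ltW t0) ?(ltW h1)//.
    rewrite /cnt [leLHS]big_mkcond [leRHS]big_mkcond; apply: ler_sum => k _.
    by rewrite inE; case: (k \in reps N I c n) => //=; case: ifP.
  rewrite mulr_sumr expR_sum big_map big_enum/=.
  apply: ler_prod => k _; rewrite expR_ge0/= -/(inA A (k @: I)).
  by case: inA; rewrite ?mulr1 ?mulr0 ?expR0 ?subr0.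
by rewrite expR_lt1 subr_lt0.
Qed.

End tails.

(** From t d <= e/2 the Janson exponent is at least t (1 - e) x, while the threshold costs at most t
    (1 - 2 e) x; the difference t e x is at least 2 l by the growth hypothesis. *)
Lemma lower_exponent (R : realType) (e d t l x S : R) :
  0 < e -> e <= 3^-1 -> 0 <= d -> 0 <= l -> 0 < x -> 0 < t -> t * (1 + d) = e / 2 ->
  4 * (1 + d) * (l + 1) <= e ^+ 2 * x -> (1 - e / 4) * x - d <= S ->
  t / (1 - t) * ((1 - 3 * e) * x) - t * (1 - t * d) * S <= - (2 * l).
Proof.
move=> e0 e3 d0 l0 x0 t0 te g2 hS.
have td0 : 0 <= t * d by rewrite mulr_ge0// ltW.
have h1t : 0 < 1 - t by lra.
have g3 : 4 * d <= e * x.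
  have : e ^+ 2 * x <= e * x by rewrite ler_wpM2r ?(ltW x0)// expr2 ler_piMl ?(ltW e0)//; lra.
  apply: le_trans; apply: le_trans g2.
  have : 0 <= (1 + d) * l by rewrite mulr_ge0//; lra.
  lra.
have hS1 : (1 - e / 2) * x <= S by lra.
have td : t * d <= e / 2 by lra.
have lw : t * ((1 - e) * x) <= t * (1 - t * d) * S.
  rewrite -mulrA ler_wpM2l ?(ltW t0)//.
  have a0 : 0 <= 1 - t * d by lra.
  apply: le_trans (ler_wpM2l a0 hS1); rewrite mulrA ler_wpM2r ?(ltW x0)//.
  have a1 : 0 <= 1 - e / 2 by lra.
  have : (1 - e / 2) * (1 - e / 2) <= (1 - t * d) * (1 - e / 2) by rewrite ler_wpM2r//; lra.
  have : 0 <= e * e by rewrite mulr_ge0 ?(ltW e0).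
  lra.
have up : t / (1 - t) * ((1 - 3 * e) * x) <= t * ((1 - 2 * e) * x).
  rewrite -mulrA ler_wpM2l ?(ltW t0)// mulrC ler_pdivrMr// mulrAC ler_wpM2r ?(ltW x0)//.
  have : (1 - 2 * e) * (1 - e / 2) <= (1 - 2 * e) * (1 - t) by rewrite ler_wpM2l//; lra.
  have : 0 <= e * e by rewrite mulr_ge0 ?(ltW e0).
  lra.
have fin : 2 * l <= t * (e * x).
  have tE : t * (e * x) * (2 * (1 + d)) = e ^+ 2 * x.
    have -> : t * (e * x) * (2 * (1 + d)) = t * (1 + d) * (2 * (e * x)) by ring.
    by rewrite te; field.
  have d1 : 0 < 2 * (1 + d) by lra.
  rewrite -(ler_pM2r d1) tE; apply: le_trans g2.
  lra.
lra.
Qed.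

Section concentration.
Variables (R : realType) (h : nat) (b : 'I_h -> nat) (p : nat -> R).
Hypothesis p01 : forall x, 0 <= p x <= 1.
Hypothesis b0 : forall i, (0 < b i)%N.
Variables (W : nat -> R) (C z : R).
Hypothesis W1 : forall m, 1 <= W m.
Hypothesis Wmono : forall m n, (m <= n)%N -> W m <= W n.
Hypothesis C0 : 0 <= C.
Hypothesis z0 : 0 < z.
Local Notation B := (\sum_(i < h) b i)%N.
Hypothesis sprod_low : forall N (I : {set 'I_h}) c m, (0 < #|I| <= h.-1)%N -> adm B I c ->
  (m <= N)%N -> sprod p N I c m <= C * W m * expR (- z * lns R m).

Let W0 m : 0 < W m. Proof. exact: lt_le_trans (W1 m). Qed.

Let admT : adm B [set: 'I_h] b.
Proof. by split=> //; rewrite (eq_bigl xpredT)// => i; rewrite inE. Qed.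

Let cardT : #|[set: 'I_h]| = h. Proof. by rewrite cardsT card_ord. Qed.

Let cardT1 i : #|[set: 'I_h] :\ i| = h.-1.
Proof. by have E := cardsD1 i [set: 'I_h]; rewrite -[in RHS]cardT E inE. Qed.

Definition low_sparse (D : R) (N : nat) (A : pred nat) :=
  forall (I : {set 'I_h}) c m, (#|I| <= h.-1)%N -> adm B I c -> (m <= N)%N ->
    cnt R N A I c m <= D * W m.

(** The ratio of [sprod] to (1 + e) Fn is at most exp(-e/2), so M >= 4 ln(n+1)/e brings its M-th
    power below (n+1)^(-2). The greedy loss h^2 (M + 1) D W(n) is at most e Fn, as Fn exceeds a
    large multiple of W(n) log n. *)
Lemma upper_functional (N n : nat) (e D Fn : R) : 0 < e <= 3^-1 -> 0 <= D -> 0 < Fn -> (n <= N)%N ->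
  sprod p N [set: 'I_h] b n <= (1 + e / 4) * Fn ->
  h%:R ^+ 2 * D * (4 / e + 2) / e * W n * (lns R n + 1) <= Fn ->
  exists G : pred nat -> R, [/\ forall A, 0 <= G A, Ex p N.+1 G <= (n.+1%:R ^+ 2)^-1 &
    forall A, G A < 1 -> low_sparse D N A -> cnt R N A [set: 'I_h] b n <= (1 + 2 * e) * Fn].
Proof.
move=> /andP[e0 e3] D0 F0 nN sF growth.
have l0 : 0 <= lns R n by rewrite ln_ge0// ler1n.
have le0 : 0 <= 4 * lns R n / e by rewrite divr_ge0 ?mulr_ge0// ltW.
pose M := (Num.truncn (4 * lns R n / e)).+1.
have M1 : 4 * lns R n / e <= M%:R by apply: ltW; exact: truncnS_gt.
have M2 : M%:R <= 4 * lns R n / e + 1.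
  by rewrite /M -natr1 lerD2r; have /andP[] := truncn_itv le0.
pose y := (1 + e) * Fn.
have y0 : 0 < y by rewrite mulr_gt0// addr_gt0.
exists (fun A => (y ^+ M)^-1 * @disjtup R _ N M [set: 'I_h] b n finset.set0 A); split.
- by move=> A; rewrite mulr_ge0 ?disjtup_ge0// invr_ge0 exprn_ge0// ltW.
- rewrite ExZ; apply: (@le_trans _ _ ((y ^+ M)^-1 * (sprod p N [set: 'I_h] b n) ^+ M)).
    by rewrite ler_wpM2l ?Ex_disjtup// invr_ge0 exprn_ge0// ltW.
  rewrite -(exprVn y) -exprMn.
  have ratio : y^-1 * sprod p N [set: 'I_h] b n <= expR (- (e / 2)).
    rewrite mulrC ler_pdivrMr//; apply: (le_trans sF).
    rewrite /y mulrA ler_wpM2r ?(ltW F0)//.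
    have e1 : 0 <= 1 + e by lra.
    apply: le_trans (ler_wpM2r e1 (expR_ge1Dx (- (e / 2)))).
    have : 0 <= e * (3^-1 - e) by rewrite mulr_ge0 ?subr_ge0// ltW.
    lra.
  have r0 : 0 <= y^-1 * sprod p N [set: 'I_h] b n.
    by rewrite mulr_ge0 ?sprod_ge0// invr_ge0 ltW.
  apply: (@le_trans _ _ (expR (- (e / 2)) ^+ M)); first by rewrite lerXn2r ?nnegrE ?expR_ge0.
  rewrite -expRM_natl -(expR_lns R n) -expRM_natl -expRN ler_expR.
  have := ler_wpM2r (ltW e0) M1; rewrite divfK ?lt0r_neq0//; lra.
move=> A GA low; rewrite leNgt; apply/negP => hc.
move: GA; apply/negP; rewrite -leNgt ler_pdivlMl ?exprn_gt0// mulr1.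
apply: (@disjtup_ge _ _ _ _ _ _ _ _ _ (D * W n)).
- exact: ltW.
- by rewrite mulr_ge0// ltW.
- move=> i m' iI m'n; apply: (@le_trans _ _ (D * W m')).
    apply: low; [by rewrite cardT1|exact: adm_rem|exact: leq_trans nN].
  by rewrite ler_wpM2l ?Wmono.
- by move=> i j iI jI; apply: low; [rewrite cardT1|exact: adm_merge|].
rewrite cards0 cardT add0n; apply: ltW; apply: le_lt_trans hc.
have -> : (h * (h * M) + h ^ 2)%:R = h%:R ^+ 2 * (M%:R + 1) :> R.
  by rewrite -mulnn natrD !natrM; ring.
suff : h%:R ^+ 2 * (M%:R + 1) * (D * W n) <= e * Fn by rewrite /y; lra.
have q0 : 0 <= h%:R ^+ 2 * D * W n by rewrite !mulr_ge0 ?exprn_ge0// ltW.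
have := ler_wpM2l (ltW e0) growth.
apply: le_trans.
rewrite [leLHS](_ : _ = h%:R ^+ 2 * D * W n * (M%:R + 1)); last ring.
rewrite [leRHS](_ : _ = h%:R ^+ 2 * D * W n * ((4 / e + 2) * (lns R n + 1))); last first.
  by field; exact: lt0r_neq0.
rewrite ler_wpM2l//.
have : 0 <= 4 / e by rewrite divr_ge0// ltW.
move: M2; rewrite [4 * lns R n / e]mulrAC; move: (4 / e) (lns R n) l0 => x l l0 hM x0.
lra.
Qed.

(** One quantity [d], of order W(n), bounds both the Janson overlaps and the non-injective part of
    the mean: each reduces to h - 1 variables, where [overlap_sum_le] applies. *)
Lemma lower_functional (N n : nat) (e Fn : R) : 0 < e <= 3^-1 -> 0 < Fn -> (n <= N)%N ->
  (1 - e / 4) * Fn <= sprod p N [set: 'I_h] b n ->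
  (4 * (1 + h%:R ^+ 2 * overlap_const C h h.-1)) / e ^+ 2 * W n * (lns R n + 1) <= Fn ->
  exists G : pred nat -> R, [/\ forall A, 0 <= G A, Ex p N.+1 G <= (n.+1%:R ^+ 2)^-1 &
    forall A, G A < 1 -> (1 - 3 * e) * Fn <= cnt R N A [set: 'I_h] b n].
Proof.
move=> /andP[e0 e3] F0 nN sF growth.
have l0 : 0 <= lns R n by rewrite ln_ge0// ler1n.
pose q := h%:R ^+ 2 * overlap_const C h h.-1.
have q0 : 0 <= q by rewrite mulr_ge0 ?exprn_ge0// overlap_const_ge0.
pose d := q * W n.
have d0 : 0 <= d by rewrite mulr_ge0// ltW.
have Hs (I : {set 'I_h}) c m : (#|I| <= h.-1)%N -> adm B I c -> (m <= N)%N -> (0 < #|I|)%N ->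
    sprod p N I c m <= C * W m.
  move=> Ih ac mN I0; apply: (le_trans (sprod_low _ ac mN)); first by rewrite I0.
  rewrite ler_piMr ?mulr_ge0 ?(ltW (W0 _))// -expR0 ler_expR mulNr oppr_le0 mulr_ge0 ?(ltW z0)//.
  by rewrite ln_ge0// ler1n.
have KQW m : 0 <= overlap_const C h h.-1 * W m by rewrite mulr_ge0 ?overlap_const_ge0// ltW.
have hE : (h * h)%:R * (overlap_const C h h.-1 * W n) = d by rewrite /d /q natrM; ring.
have Qlow (S : {set 'I_N.+1}) (I : {set 'I_h}) c m : #|I| = h.-1 -> adm B I c -> (m <= n)%N ->
    (#|S| <= h)%N -> overlap_sum p S I c m <= overlap_const C h h.-1 * W n.
  move=> Ih ac mn Sh; apply: (@le_trans _ _ (overlap_const C h h.-1 * W m)).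
    rewrite -{1}Ih; apply: (overlap_sum_le p01 W1 Wmono C0 Hs) => //; first by rewrite Ih.
    exact: leq_trans nN.
  by rewrite ler_wpM2l ?overlap_const_ge0 ?Wmono.
have hit (S : {set 'I_N.+1}) : (#|S| <= #|[set: 'I_h]|)%N ->
    \sum_(k in reps N [set: 'I_h] b n | ~~ [disjoint k @: [set: 'I_h] & S]) pw p (k @: [set: 'I_h] :\: S) <= d.
  rewrite cardT => Sh; apply: (@le_trans _ _ ((#|[set: 'I_h]| * #|S|)%:R * (overlap_const C h h.-1 * W n))).
    apply: hit_le => // i m' iI m'n; apply: Qlow => //; exact: adm_rem.
  by rewrite cardT -hE ler_wpM2r// ler_nat leq_mul2l Sh orbT.
have nonin : \sum_(k in reps N [set: 'I_h] b n | ~~ injon [set: 'I_h] k) pw p (k @: [set: 'I_h]) <= d.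
  have := @noninj_le R p p01 _ N finset.set0 [set: 'I_h] b n (overlap_const C h h.-1 * W n) (KQW n).
  rewrite cardT -mulnn hE => H.
  under eq_bigr => k _ do rewrite -[k @: _]finset.setD0.
  apply: H => i j iI jI; apply: Qlow => //; [exact: adm_merge|by rewrite cards0].
have inj : sprod p N [set: 'I_h] b n - d <=
    \sum_(k in reps N [set: 'I_h] b n | injon [set: 'I_h] k) pw p (k @: [set: 'I_h]).
  rewrite lerBlDr; apply: (@le_trans _ _ (\sum_(k in reps N [set: 'I_h] b n) pw p (k @: [set: 'I_h]))).
    by apply: ler_sum => k _; exact: pw_ge_prod.
  by rewrite (bigID (injon [set: 'I_h]))/= lerD2l.
pose t := e / (2 * (1 + d)).
have d1 : 0 < 2 * (1 + d) by lra.
have t0 : 0 < t by rewrite divr_gt0.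
have te : t * (1 + d) = e / 2 by rewrite /t; field; lra.
have td0 : 0 <= t * d by rewrite mulr_ge0// ltW.
have t1 : t <= e / 2 by lra.
have t01 : 0 < t < 1 by rewrite t0/=; lra.
have h1t : 0 < 1 - t by lra.
pose x := (1 - 3 * e) * Fn.
have [G [G0 GE GA]] := lower_tail p01 (t / (1 - t) * x) t01 hit.
exists G; split => //; last first.
  move=> A /GA; rewrite ltr_pM2l ?divr_gt0// => /ltW; exact.
apply: (le_trans GE); rewrite -(expR_lns R n) -expRM_natl -expRN ler_expR.
have g1 : 4 * (1 + q) * W n * (lns R n + 1) <= e ^+ 2 * Fn.
  have e20 : 0 <= e ^+ 2 by rewrite exprn_ge0// ltW.
  have := ler_wpM2l e20 growth; rewrite -/q; apply: le_trans.
  rewrite le_eqVlt; apply/orP; left; apply/eqP; field; exact: lt0r_neq0.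
have g2 : 4 * (1 + d) * (lns R n + 1) <= e ^+ 2 * Fn.
  apply: le_trans g1; rewrite ler_wpM2r ?addr_ge0// /d.
  have := W1 n; move: (W n) => w w1.
  have : 0 <= w * 1 by lra.
  lra.
apply: (lower_exponent e0 e3 d0 l0 F0 t0 te g2); apply: le_trans inj; lra.
Qed.

(** The tolerance is diagonalised before any set is chosen, so that a single set serves tolerances
    tending to 0. *)
Lemma random_set (f : nat -> R) :
  tends0 (fun n => sconv p [seq b i | i <- enum [set: 'I_h]] n / f n - 1) ->
  (forall K : R, exists N, forall n, (N <= n)%N -> K * W n * (lns R n + 1) <= f n) ->
  exists A : pred nat, tends0 (fun n => (rep_count b A n)%:R / f n - 1).
Proof.
move=> Hs Hg.
have [D D0 HD] := low_levels p01 W1 Wmono C0 z0 sprod_low.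
pose Q (e : R) n := 0 < f n /\ forall N, (n <= N)%N -> exists G : pred nat -> R,
  [/\ forall A, 0 <= G A, Ex p N.+1 G <= 2 * (n.+1%:R ^+ 2)^-1 &
   forall A, G A < 1 -> low_sparse D N A -> `|(rep_count b A n)%:R - f n| <= 3 * e * f n].
have [e [n0 [Hn te]]] : exists (e : nat -> R) (n0 : nat),
    (forall n, (n0 <= n)%N -> 0 < e n /\ Q (e n) n) /\ tends0 e.
  apply: diagonal_eps => e e0 e3; have e03 : 0 < e <= 3^-1 by rewrite e0.
  have [N1 H1] := Hs (e / 4) (ltac:(by rewrite divr_gt0)).
  have [N2 H2] := Hg 1.
  have [N3 H3] := Hg (h%:R ^+ 2 * D * (4 / e + 2) / e).
  have [N4 H4] := Hg ((4 * (1 + h%:R ^+ 2 * overlap_const C h h.-1)) / e ^+ 2).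
  exists (maxn (maxn N1 N2) (maxn N3 N4)) => n.
  rewrite !geq_max => /andP[/andP[n1 n2] /andP[n3 n4]].
  have l0 : 0 <= lns R n by rewrite ln_ge0// ler1n.
  have f0 : 0 < f n.
    by apply: lt_le_trans (H2 n n2); rewrite mul1r mulr_gt0// ltr_wpDl.
  split => // N nN.
  have sE : sprod p N [set: 'I_h] b n = sconv p [seq b i | i <- enum [set: 'I_h]] n.
    by apply: sprod_sconv.
  have := H1 n n1; rewrite -sE ler_norml => /andP[s1 s2].
  have {}s1 : (1 - e / 4) * f n <= sprod p N [set: 'I_h] b n by rewrite -ler_pdivlMr//; lra.
  have {}s2 : sprod p N [set: 'I_h] b n <= (1 + e / 4) * f n by rewrite -ler_pdivrMr//; lra.
  have [G1 [G10 EG1 HG1]] := upper_functional e03 D0 f0 nN s2 (H3 n n3).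
  have [G2 [G20 EG2 HG2]] := lower_functional e03 f0 nN s1 (H4 n n4).
  exists (fun A => G1 A + G2 A); split.
  - by move=> A; rewrite addr_ge0.
  - by rewrite ExD mulr_natl mulr2n; exact: lerD.
  move=> A GA low; rewrite (rep_count_cnt _ _ b0 nN).
  have h1 : cnt R N A [set: 'I_h] b n <= (1 + 2 * e) * f n.
    by apply: HG1 => //; apply: le_lt_trans GA; rewrite lerDl.
  have h2 : (1 - 3 * e) * f n <= cnt R N A [set: 'I_h] b n.
    by apply: HG2; apply: le_lt_trans GA; rewrite lerDr.
  have ef : 0 <= e * f n by rewrite mulr_ge0 ?ltW.
  by rewrite ler_norml; apply/andP; split; lra.
(* From 8 on, the tails sum to at most 2/8, which together with the 1/4 from [low_levels] stays
   below 1. *)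
pose n1 := maxn n0 8.
have n10 n : (n1 <= n)%N -> (n0 <= n)%N by rewrite geq_max => /andP[].
have [A HA] : exists A : pred nat, forall n, (n1 <= n)%N ->
    `|(rep_count b A n)%:R - f n| <= 3 * e n * f n.
  apply: (@pred_compactness (fun n (A : pred nat) => (n1 <= n)%N -> `|(rep_count b A n)%:R - f n| <= 3 * e n * f n)).
    move=> n A A' AA' H /H; rewrite !(rep_count_cnt _ _ b0 (leqnn n)).
    suff -> : cnt R n A [set: 'I_h] b n = cnt R n A' [set: 'I_h] b n by [].
    apply: eq_bigr => k _; congr (nat_of_bool _)%:R.
    by apply: eq_in_all => x /elts_lt; rewrite ltnS; exact: AA'.
  move=> N; have [GL [GL0 EGL HGL]] := HD N.
  have /choice[Gs HGs] n : exists G : pred nat -> R, (n1 <= n <= N)%N ->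
     [/\ forall A, 0 <= G A, Ex p N.+1 G <= 2 * (n.+1%:R ^+ 2)^-1 &
      forall A, G A < 1 -> low_sparse D N A -> `|(rep_count b A n)%:R - f n| <= 3 * e n * f n].
    have [/andP[nn nN]|_] := boolP (n1 <= n <= N)%N; last by exists (fun=> 0).
    by have [_ [_ /(_ N nN)[G HG]]] := Hn n (n10 _ nn); exists G.
  pose G A := GL A + \sum_(n1 <= n < N.+1) Gs n A.
  have : Ex p N.+1 G < 1.
    rewrite /G ExD Ex_sum.
    apply: (@le_lt_trans _ _ (4^-1 + \sum_(n1 <= n < N.+1) 2 * (n.+1%:R ^+ 2)^-1)).
      rewrite lerD// big_nat_cond [leRHS]big_nat_cond; apply: ler_sum => n /andP[nN _].
      by have [] := HGs n nN.
    rewrite -mulr_sumr.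
    have n18 : (8 <= n1)%N by rewrite leq_maxr.
    have := @sum_inv_sq R n1 N.+1 (leq_trans (isT : 0 < 8)%N n18).
    have : n1%:R^-1 <= 8^-1 :> R by rewrite lef_pV2 ?posrE ?ltr0n ?ler_nat// (leq_trans _ n18).
    lra.
  move=> /(Ex_exists p01)[A GA]; exists A => n nN nn.
  have Gs0 (m : nat) : (n1 <= m < N.+1)%N -> 0 <= Gs m A by move=> /HGs[].
  have Sg0 (P : pred nat) : 0 <= \sum_(n1 <= m < N.+1 | P m) Gs m A.
    by rewrite big_nat_cond; apply: sumr_ge0 => m /andP[/Gs0].
  have nnN : (n1 <= n <= N)%N by rewrite nn.
  have [_ _] := HGs n nnN; apply.
    apply: le_lt_trans GA; rewrite /G (bigD1_seq n)/= ?mem_index_iota ?iota_uniq//.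
    by rewrite addrCA lerDl addr_ge0.
  by apply: HGL; apply: le_lt_trans GA; rewrite lerDl.
exists A => d d0; have [N HN] := te (d / 3) (ltac:(by rewrite divr_gt0)).
exists (maxn N n1) => n; rewrite geq_max => /andP[nN nn].
have [_ [f0 _]] := Hn n (n10 _ nn).
have -> : (rep_count b A n)%:R / f n - 1 = ((rep_count b A n)%:R - f n) / f n.
  by field; exact: lt0r_neq0.
rewrite normrM normfV (gtr0_norm f0) ler_pdivrMr//; apply: (le_trans (HA n nn)).
rewrite ler_wpM2r ?(ltW f0)//.
have := HN n nN; have := ler_norm (e n); lra.
Qed.

End concentration.

Local Open Scope classical_set_scope.

(** * Choice of the probabilities *)

Section sequences.
Variable R : realType.
Implicit Types f v : nat -> R.

Lemma lns_ge0 n : 0 <= lns R n. Proof. by rewrite ln_ge0// ler1n. Qed.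

Lemma lns0 : lns R 0 = 0. Proof. exact: ln1. Qed.

Lemma lns_unbounded (x : R) : exists N, forall n, (N <= n)%N -> x <= lns R n.
Proof.
have [N HN] := nat_ge (expR x); exists N => n Nn.
rewrite -[x]expRK ler_ln ?posrE ?expR_gt0//; apply: (le_trans (HN n Nn)).
by rewrite ler_nat.
Qed.

Lemma RV_ge (a c : R) v : RV a v -> c < a -> exists K : R, forall n, K + c * lns R n <= v n.
Proof.
move=> Hv ca; have [K _ HK] := potter Hv ca; exists (v 0%N - K) => n.
by have := HK 0%N n isT; rewrite lns0; lra.
Qed.

Lemma RV_le (a c : R) v : RV a v -> a < c -> exists K : R, forall n, v n <= K + c * lns R n.
Proof.
move=> Hv ac; have [K HK] := RV_ge (RVZ (-1) Hv) (ltac:(rewrite mulN1r ltrN2; exact: ac) : - c < -1 * a).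
by exists (- K) => n; have := HK n; rewrite mulN1r; lra.
Qed.

(** The uniform convergence theorem at integers. Replacing ln n by ln(n+1) costs O(1/n), and eta/2
    leaves room for passing from (k+1)/(n+1) to k/n. *)
Lemma RV_ln_regularly_varying (F : R -> R) : regularly_varying F -> exists rho, RV rho (fun n => ln (F n%:R)).
Proof.
move=> /regularly_varying_uniform[rho HF]; exists rho => eta e eta0 e0.
have eta2 : 0 < eta / 2 by rewrite divr_gt0.
have e2 : 0 < e / 2 by rewrite divr_gt0.
have [X HX] := HF _ _ eta2 e2.
have [N1 H1] := nat_ge X; have [N2 H2] := nat_ge (2 / eta).
have [N3 H3] := nat_ge (`|rho| * (2 / eta + 1) / (e / 2)).
exists (maxn (maxn N1 N2) (maxn N3 1)) => n k.
rewrite !geq_max => /andP[/andP[n1 n2] /andP[n3 n0]] kn ek.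
have nR : 0 < n%:R :> R by rewrite ltr0n.
have kge : eta / 2 * n%:R <= k%:R.
  have := H2 n n2; rewrite ler_pdivrMr// => h.
  by move: ek; rewrite -[n.+1%:R]natr1 -[k.+1%:R]natr1 mulrDr mulr1; lra.
have kR : 0 < k%:R :> R by apply: lt_le_trans kge; rewrite mulr_gt0.
have := HX n%:R (k%:R / n%:R) (H1 n n1) _.
rewrite divfK ?lt0r_neq0// ler_pdivlMr// kge ler_pdivrMr// mul1r ler_nat kn => /(_ isT)/ltW h1.
rewrite ln_div ?posrE// in h1.
have d1 : `|lns R k - ln k%:R| <= 2 / eta / n%:R.
  apply: (le_trans (ln_dist_le kR _ (lexx _))); first by rewrite ler_nat.
  rewrite -natr1 addrAC subrr add0r normr1 mul1r.
  have -> : 2 / eta / n%:R = (eta / 2 * n%:R)^-1 by field; rewrite !lt0r_neq0.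
  by rewrite lef_pV2 ?posrE ?mulr_gt0.
have d2 : `|lns R n - ln n%:R| <= 1 / n%:R.
  apply: (le_trans (ln_dist_le nR _ (lexx _))); first by rewrite ler_nat.
  by rewrite -natr1 addrAC subrr add0r normr1.
have d3 : `|rho * ((lns R n - ln n%:R) - (lns R k - ln k%:R))| <= e / 2.
  rewrite normrM; apply: (le_trans (ler_wpM2l (normr_ge0 _) (ler_normB _ _))).
  apply: (le_trans (ler_wpM2l (normr_ge0 _) (lerD d2 d1))).
  rewrite -mulrDl mulrA ler_pdivrMr// [leRHS]mulrC -ler_pdivrMr// [1 + _]addrC; exact: H3.
rewrite (_ : _ - _ = (ln (F k%:R) - ln (F n%:R) - rho * (ln k%:R - ln n%:R)) +
  rho * ((lns R n - ln n%:R) - (lns R k - ln k%:R))); last by ring.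
by apply: (le_trans (ler_normD _ _)); rewrite [e]splitr lerD.
Qed.

Lemma tends0_ratio (s g : nat -> R) (C : R) (d : nat -> R) : 0 < C ->
  tends0 (fun n => s n / expR (g n) - C) -> tends0 d ->
  tends0 (fun n => s n / expR (g n + ln C + d n) - 1).
Proof.
move=> C0 Hs Hd e e0.
pose y := Num.min 2^-1 (e / (1 + C^-1 * 3)).
have CV : 0 < C^-1 by rewrite invr_gt0.
have q0 : 0 < 1 + C^-1 * 3 by lra.
have y0 : 0 < y by rewrite lt_min invr_gt0 ltr0n divr_gt0.
have y1 : y <= 2^-1 by rewrite ge_min lexx.
have y2 : y * (1 + C^-1 * 3) <= e by rewrite -ler_pdivlMr// ge_min lexx orbT.
have [N1 H1] := Hs _ y0; have [N2 H2] := Hd (y / 2) (ltac:(by rewrite divr_gt0)).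
exists (maxn N1 N2) => n; rewrite geq_max => /andP[n1 n2].
have := H1 n n1; have := H2 n n2; set u := _ - C; set x := d n => hx hu.
have hx2 : `|expR (- x) - 1| <= y.
  apply: (le_trans (expR_near1 _)); rewrite normrN; lra.
set w := expR (- x) - 1 in hx2.
have -> : s n / expR (g n + ln C + x) - 1 = w + C^-1 * u + C^-1 * (u * w).
  rewrite expRD expRD lnK ?posrE// !invfM -(expRN x) -[expR (- x)](subrK 1) -/w.
  have -> : s n = (u + C) * expR (g n) by rewrite /u subrK divfK// lt0r_neq0// expR_gt0.
  by field; rewrite !lt0r_neq0// expR_gt0.
apply: le_trans y2.
apply: (le_trans (ler_normD _ _)); apply: (le_trans (lerD (ler_normD _ _) (lexx _))).
rewrite !normrM (gtr0_norm CV).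
have huw : `|u| * `|w| <= y * 1 by apply: ler_pM => //; lra.
have := ler_wpM2l (ltW CV) huw; have := ler_wpM2l (ltW CV) hu.
have := mulr_gt0 CV y0; lra.
Qed.

Lemma exp_beats_linear (E g K : R) : 0 < E -> 0 < g ->
  exists N, forall n, (N <= n)%N -> K * (lns R n + 1) <= E * expR (g * lns R n).
Proof.
move=> E0 g0; pose g' := Num.min 1 (g / 2).
have g2 : 0 < g / 2 by rewrite divr_gt0.
have g'0 : 0 < g' by rewrite lt_min ltr01.
have g'1 : g' <= 1 by rewrite ge_min lexx.
have g'2 : g' <= g / 2 by rewrite ge_min lexx orbT.
have [N HN] := lns_unbounded (K / (E * (g / 2 * g'))).
exists N => n Nn; have l0 := lns_ge0 n; have := HN n Nn; set l := lns R n in l0 *.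
rewrite ler_pdivrMr ?mulr_gt0// => hK.
have h1 : 1 + g / 2 * l <= expR (g / 2 * l) by exact: expR_ge1Dx.
have -> : expR (g * l) = expR (g / 2 * l) * expR (g / 2 * l).
  by rewrite -expRD; congr expR; field.
have gl : 0 <= g / 2 * l by rewrite mulr_ge0// ltW.
have h2 : g' * (l + 1) <= 1 + g / 2 * l.
  by have := ler_wpM2r l0 g'2; lra.
have h3 : g / 2 * l * (g' * (l + 1)) <= expR (g / 2 * l) * expR (g / 2 * l).
  apply: ler_pM => //; [by rewrite mulr_ge0 ?(ltW g'0)//; lra|lra|lra].
apply: (le_trans _ (ler_wpM2l (ltW E0) h3)).
have l1 : 0 <= l + 1 by lra.
by have := ler_wpM2r l1 hK; lra.
Qed.

End sequences.

Local Close Scope classical_set_scope.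

(** * The theorem for sequences: choice of indices and probabilities *)

Section sequence_theorem.
Variables (R : realType) (h : nat) (b : 'I_h -> nat).
Hypothesis h2 : (2 <= h)%N.
Hypothesis b0 : forall i, (0 < b i)%N.
Hypothesis bgcd : \big[gcdn/0%N]_(i < h) b i = 1%N.
Variables (rho : R) (f : nat -> R).
Hypothesis Hf : RV rho f.
Hypothesis Hgrow : forall K : R, exists N, forall n, (N <= n)%N -> K * (lns R n + 1) <= expR (f n).
Local Notation C1 := ((h.-1`!%:R * (\prod_(i < h) b i)%:R)^-1 : R).
Hypothesis Hup : forall e : R, 0 < e -> exists N, forall n, (N <= n)%N ->
  f n <= (h%:R - 1) * lns R n + ln C1 + e.

Let h0 : (0 < h)%N. Proof. exact: ltnW. Qed.
Let hR : 0 < h%:R :> R. Proof. by rewrite ltr0n. Qed.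

Lemma index_ge0 : 0 <= rho.
Proof.
rewrite leNgt; apply/negP => r0.
have [K HK] := RV_le Hf r0; have [N HN] := Hgrow (expR K + 1).
have := HN N (leqnn N); have := HK N; rewrite mul0r addr0 -ler_expR => h1.
have := lns_ge0 R N; move: (lns R N) => l l0.
have : 0 <= expR K * l by rewrite mulr_ge0// expR_ge0.
lra.
Qed.

Lemma index_le : rho <= h%:R - 1.
Proof.
rewrite leNgt; apply/negP => r0.
pose c := (rho + (h%:R - 1)) / 2.
have [K HK] := RV_ge Hf (ltac:(rewrite /c; lra) : c < rho).
have [N HN] := Hup ltr01.
have c0 : 0 < c - (h%:R - 1) by rewrite /c; lra.
have [N' HN'] := lns_unbounded ((ln C1 + 2 - K) / (c - (h%:R - 1))).
have := HN (maxn N N') (leq_maxl _ _); have := HK (maxn N N').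
have := HN' (maxn N N') (leq_maxr _ _); rewrite ler_pdivrMr//; lra.
Qed.

(** Solves h (sg + 1) - 1 = rho with sg = kap - 1: an h-fold convolution of sequences of index sg
    has index rho. *)
Let kap := (rho + 1) / h%:R.
Let sg := kap - 1.
Let hkap : h%:R * kap = rho + 1.
Proof. by rewrite /kap mulrC divfK// lt0r_neq0. Qed.
Let kap0 : 0 < kap.
Proof. by rewrite divr_gt0//; have := index_ge0; lra. Qed.
Let sg1 : -1 < sg. Proof. by rewrite /sg; have := kap0; lra. Qed.
Let cs := [seq b i | i <- enum [set: 'I_h]].

Let cs0 : all (ltn 0) cs. Proof. by apply/allP => _ /mapP[i _ ->]; exact: b0. Qed.
Let size_cs : size cs = h. Proof. by rewrite size_map -cardE cardsT card_ord. Qed.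
Let gcd_cs : foldr gcdn 0%N cs = 1%N.
Proof. by rewrite -bgcd foldrE big_map big_enum/=; apply: eq_bigl => i; rewrite inE. Qed.
Let prod_cs : (\prod_(c <- cs) c = \prod_(i < h) b i)%N.
Proof. by rewrite big_map big_enum/=; apply: eq_bigl => i; rewrite inE. Qed.

(** [v0] solves log_scale h v0 + ln C = f exactly and is cut at 0 to be the logarithm of a
    probability. For sg < 0 it tends to minus infinity and the cut stops acting; for sg = 0 the
    constant [C] is that of [Hup], so v0 <= o(1) and the cut changes it by o(1). *)
Lemma probability_sequence : exists v : nat -> R, [/\ RV sg v, forall n, v n <= 0 &
  tends0 (fun n => sconv (fun x => expR (v x)) cs n / expR (f n) - 1)].
Proof.
have [C [C0 CE HC]] := @sconv_asymp R sg cs sg1 cs0 (ltac:(by rewrite size_cs)).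
rewrite size_cs prod_cs gcd_cs in CE HC.
pose v0 n := h%:R^-1 * (f n + (- (h%:R - 1) * lns R n + - ln C)).
have Hcst : RV 0 (fun=> - ln C).
  by move=> eta e _ e0; exists 0%N => n k _ _ _; rewrite subrr mul0r subrr normr0 ltW.
have Hv0 : RV sg v0.
  have := RVZ h%:R^-1 (RVD Hf (RVD (RVZ (- (h%:R - 1)) (@RV_lns R)) Hcst)).
  rewrite (_ : _ * _ = sg)// /sg /kap; field; exact: lt0r_neq0.
pose v n : R := Num.min 0 (v0 n).
have vle n : v n <= 0 by rewrite ge_min lexx.
have wE n : f n = log_scale h v n + ln C + - (h%:R * (v n - v0 n)).
  by rewrite /log_scale /v0; field; exact: lt0r_neq0.
have tv : tends0 (fun n => v n - v0 n).
  move=> e e0.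
  suff [N HN] : exists N, forall n, (N <= n)%N -> v0 n <= e.
    exists N => n Nn; have := HN n Nn; rewrite /v minEle; case: ifPn => [h1 h3|h1 _].
      by rewrite sub0r normrN ger0_norm.
    by rewrite subrr normr0 ltW.
  have [s0|sn] := eqVneq sg 0.
    have [N HN] := Hup (mulr_gt0 hR e0); exists N => n Nn; have := HN n Nn.
    rewrite /v0 (CE s0) ler_pdivrMl//; lra.
  have s0 : sg < 0.
    rewrite lt_neqAle sn /sg subr_le0 /kap ler_pdivrMr// mul1r.
    by have := index_le; lra.
  have [K HK] := RV_le Hv0 (ltac:(lra) : sg < sg / 2).
  have sg2 : 0 < - (sg / 2) by lra.
  have [N HN] := lns_unbounded (K / - (sg / 2)); exists N => n Nn.
  have := HN n Nn; rewrite ler_pdivrMr//; have := HK n; lra.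
have Hv : RV sg v by exact: RV_equiv tv.
exists v; split => //.
have td : tends0 (fun n => - (h%:R * (v n - v0 n))).
  move=> e e0; have [N HN] := tv (e / h%:R) (divr_gt0 e0 hR).
  exists N => n Nn; have := HN n Nn.
  by rewrite ler_pdivlMr// normrN normrM (gtr0_norm hR) mulrC.
have tC : tends0 (fun n => sconv (fun x => expR (v x)) cs n / expR (log_scale h v n) - C).
  move=> e e0; have [N HN] := HC v Hv e e0; exists N => n Nn.
  by have := HN n Nn; rewrite dvd1n !mulr1.
have := tends0_ratio C0 tC td.
by move=> H e e0; have [N HN] := H e e0; exists N => n Nn; rewrite (wE n); exact: HN.
Qed.

(** At most h - 1 variables give index at most (h - 1) kap - 1 = rho - kap. For rho > 0 a power of n
    is left between theta and rho; for rho = 0 one takes theta = 0, and the room is the growth of F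
    against log. *)
Lemma low_exponent : exists theta : R, [/\ 0 <= theta, rho - kap < theta &
  forall K : R, exists N, forall n, (N <= n)%N ->
    K * expR (theta * lns R n) * (lns R n + 1) <= expR (f n)].
Proof.
have r0 := index_ge0.
have [r1|rn] := eqVneq rho 0.
  exists 0; split => //; first by have := kap0; lra.
  by move=> K; have [N HN] := Hgrow K; exists N => n Nn; rewrite mul0r expR0 mulr1; exact: HN.
have {rn} r1 : 0 < rho by rewrite lt_def rn.
pose theta := Num.max (rho / 2) (rho - kap / 2).
have t1 : rho / 2 <= theta by rewrite le_max lexx.
have t2 : rho - kap / 2 <= theta by rewrite le_max lexx orbT.
have k0 := kap0.
have t3 : theta < rho by rewrite gt_max; apply/andP; split; lra.
exists theta; split; [lra|lra|move=> K].
pose c := (theta + rho) / 2.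
have [K' HK'] := RV_ge Hf (ltac:(rewrite /c; lra) : c < rho).
have g0 : 0 < c - theta by rewrite /c; lra.
have [N HN] := exp_beats_linear K (expR_gt0 K') g0.
exists N => n Nn; have h3 := HN n Nn; have h1 := HK' n; rewrite -ler_expR in h1.
apply: le_trans h1; rewrite mulrAC.
apply: (le_trans (ler_wpM2r (expR_ge0 _) h3)).
by rewrite -!expRD ler_expR; lra.
Qed.

Lemma sequence_theorem : exists A : pred nat,
  tends0 (fun n => (rep_count b A n)%:R / expR (f n) - 1).
Proof.
have [v [Hv v0 Hs]] := probability_sequence.
have [theta [t0 t1 Hg]] := low_exponent.
pose p x := expR (v x).
have p01 x : 0 <= p x <= 1 by rewrite expR_ge0 -expR0 ler_expR v0.
pose W m := expR (theta * lns R m).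
have W1 m : 1 <= W m by rewrite -expR0 ler_expR mulr_ge0// lns_ge0.
have Wm m n : (m <= n)%N -> W m <= W n by move=> mn; rewrite ler_expR ler_wpM2l// lns_le.
(* Half of the gap above rho - kap becomes the power saving asked for by [random_set]. *)
pose z := (theta - (rho - kap)) / 2.
have z0 : 0 < z by rewrite /z; lra.
have low (s : seq nat) : all (ltn 0) s -> (0 < size s <= h.-1)%N ->
    exists C : R, 0 <= C /\ forall m, sconv p s m <= C * W m * expR (- z * lns R m).
  move=> s0 /andP[sz sh].
  have [K K0 HK] := sconv_bound Hv sg1 s0 sz.
  have ind : (size s)%:R * (sg + 1) - 1 < theta - z.
    have : (size s)%:R * kap <= (h%:R - 1) * kap.
      rewrite ler_wpM2r ?(ltW kap0)// lerBrDr natr1 ler_nat.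
      by rewrite -(prednK h0) ltnS.
    rewrite mulrBl hkap mul1r /sg subrK /z; lra.
  have [K' HK'] := RV_le (RV_log_scale (size s) Hv) ind.
  exists (K * expR K'); split; first by rewrite mulr_ge0 ?expR_ge0// ltW.
  move=> m; apply: (le_trans (HK m)); rewrite -!mulrA ler_wpM2l ?(ltW K0)// -!expRD ler_expR.
  by have := HK' m; lra.
pose B := (\sum_(i < h) b i)%N.
(* Admissible weights form a finite family, so the constants of the individual families are summed
   into a uniform one. *)
pose T := ({set 'I_h} * {ffun 'I_h -> 'I_B.+1})%type.
have /choice[Cf HCf] (x : T) : exists C : R, 0 <= C /\
    ((0 < #|x.1| <= h.-1)%N -> (forall i, i \in x.1 -> (0 < x.2 i)%N) ->
     forall m, sconv p [seq (x.2 i : nat) | i <- enum x.1] m <= C * W m * expR (- z * lns R m)).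
  have [H|nH] := pselect ((0 < #|x.1| <= h.-1)%N /\ (forall i, i \in x.1 -> (0 < x.2 i)%N)).
    have [||C [C0 HC]] := low [seq (x.2 i : nat) | i <- enum x.1].
    - by apply/allP => _ /mapP[i ix ->]; apply: H.2; rewrite -mem_enum.
    - by rewrite size_map -cardE; exact: H.1.
    by exists C.
  by exists 0; split => // h1 h3; case: nH.
pose C := \sum_(x : T) Cf x.
have C0 : 0 <= C by apply: sumr_ge0 => x _; have [] := HCf x.
apply: (@random_set R h b p p01 b0 W C z W1 Wm C0 z0 _ (fun n => expR (f n))) => //.
move=> N I c m Ih [cp cB] mN; rewrite sprod_sconv//.
have cB' i : i \in I -> (c i < B.+1)%N.
  by move=> iI; rewrite ltnS; apply: leq_trans cB; rewrite (bigD1 i)//= leq_addr.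
pose x : T := (I, [ffun i => inord (c i)]).
have xc i : i \in I -> c i = x.2 i by move=> iI; rewrite ffunE inordK// cB'.
have -> : [seq c i | i <- enum I] = [seq (x.2 i : nat) | i <- enum x.1].
  by apply/eq_in_map => i; rewrite mem_enum; exact: xc.
have [Cx0 HCx] := HCf x.
apply: (le_trans (HCx Ih _ m)); first by move=> i iI; rewrite -xc//; exact: cp.
rewrite -!mulrA ler_wpM2r ?mulr_ge0 ?expR_ge0// /C (bigD1 x)//= lerDl.
by apply: sumr_ge0 => y _; have [] := HCf y.
Qed.

End sequence_theorem.

Local Open Scope classical_set_scope.

Theorem theorem1 (R : realType) (h : nat) (b : 'I_h -> nat)
  (h2 : (2 <= h)%N)
  (bpos : forall i, (0 < b i)%N)
  (bgcd : \big[gcdn/0%N]_(i < h) b i = 1%N)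
  (F : R -> R)
  (Freg : regularly_varying F)
  (Flog : (F x / ln x) @[x --> +oo%R] --> +oo)
  (Fup : exists eps : R -> R, eps x @[x --> +oo%R] --> 0 /\
     \forall x \near +oo,
        F x <= (1 + eps x) *
               (x ^+ h.-1 / ((h.-1)`!%:R * (\prod_(i < h) b i)%:R))) :
  exists A : pred nat,
    ((rep_count b A n)%:R / F n%:R) @[n --> \oo] --> (1 : R).
Proof.
have [rho Hf] := RV_ln_regularly_varying Freg.
have Fpos n : (0 < n)%N -> 0 < F n%:R by move=> n0; apply: Freg.1; rewrite ler1n.
have FE n : (0 < n)%N -> expR (ln (F n%:R)) = F n%:R by move=> n0; rewrite lnK// posrE Fpos.
have near_nat (P : R -> Prop) : (\forall x \near +oo, P x) -> exists N, forall n, (N <= n)%N -> P n%:R.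
  move=> [M [Mr HM]]; have [N HN] := nat_ge (M + 1); exists N => n Nn; apply: HM.
  by have := HN n Nn; lra.
have Hgrow (K : R) : exists N, forall n, (N <= n)%N -> K * (lns R n + 1) <= expR (ln (F n%:R)).
  (* For n >= e one has K (ln(n+1) + 1) <= |K| (ln n + 2) <= 3 |K| ln n. *)
  have /cvgryPge/(_ (3 * `|K|))/near_nat[N1 H1] := Flog.
  have [N2 H2] := nat_ge (expR 1 : R).
  exists (maxn (maxn N1 N2) 1) => n; rewrite !geq_max => /andP[/andP[n1 n2] n0].
  rewrite FE//.
  have nR : 0 < n%:R :> R by rewrite ltr0n.
  have l1 : 1 <= ln n%:R :> R by rewrite -ler_expR lnK ?posrE//; exact: H2.
  have := H1 n n1; rewrite ler_pdivlMr; last lra.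
  apply: le_trans.
  have l2 : lns R n <= ln n%:R + 1.
    rewrite -lerBlDl; apply: (le_trans (ler_norm _)).
    apply: (le_trans (ln_dist_le nR _ (lexx _))); first by rewrite ler_nat.
    by rewrite -natr1 addrAC subrr add0r normr1 mul1r invf_le1// ler1n.
  apply: (le_trans (ler_norm _)); rewrite normrM [3 * _]mulrC -mulrA ler_wpM2l//.
  rewrite ger0_norm; first lra.
  by rewrite addr_ge0// lns_ge0.
pose C1 : R := ((h.-1`!%:R * (\prod_(i < h) b i)%:R)^-1).
have C10 : 0 < C1.
  by rewrite invr_gt0 mulr_gt0// ltr0n ?fact_gt0// prodn_gt0.
have Hup (e : R) : 0 < e -> exists N, forall n, (N <= n)%N ->
    ln (F n%:R) <= (h%:R - 1) * lns R n + ln C1 + e.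
  move=> e0; have [eps [eps0 Feps]] := Fup.
  have [N1 H1] := near_nat _ Feps.
  have /cvgrPdist_le/(_ e e0)/near_nat[N2 H2] := eps0.
  exists (maxn (maxn N1 N2) 1) => n; rewrite !geq_max => /andP[/andP[n1 n2] n0].
  have := H2 n n2; rewrite sub0r normrN => /(le_trans (ler_norm _)) he.
  have e1 : 0 < 1 + e by lra.
  have hE : h%:R - 1 = h.-1%:R :> R by rewrite -(prednK (ltnW h2)) -natr1 addrK.
  have xn : 0 < n.+1%:R ^+ h.-1 :> R by rewrite exprn_gt0// ltr0n.
  have hF : F n%:R <= (1 + e) * (n.+1%:R ^+ h.-1 * C1).
    apply: (le_trans (H1 n n1)).
    have q0 : 0 <= n%:R ^+ h.-1 * C1 by rewrite mulr_ge0 ?exprn_ge0// ltW.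
    apply: (@le_trans _ _ ((1 + e) * (n%:R ^+ h.-1 * C1))); first by rewrite ler_wpM2r// lerD2l.
    by rewrite ler_wpM2l ?(ltW e1)// ler_wpM2r ?(ltW C10)// lerXn2r ?nnegrE// ler_nat.
  have : ln (F n%:R) <= ln ((1 + e) * (n.+1%:R ^+ h.-1 * C1)).
    by rewrite ler_ln ?posrE ?mulr_gt0// Fpos.
  rewrite lnM ?posrE ?mulr_gt0// lnM ?posrE// lnXn// -[ln n.+1%:R *+ h.-1]mulr_natl -hE -/(lns R n) => h3.
  by have := ln_le_subr1 e1; lra.
have [A HA] := sequence_theorem h2 bpos bgcd Hf Hgrow Hup.
exists A; apply/cvgrPdist_le => e e0; have [N HN] := HA e e0.
exists (maxn N 1) => // n /=; rewrite geq_max => /andP[Nn n0].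
by rewrite distrC -(FE n n0); exact: HN.
Qed.
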